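(* Let $u\in H^4(y_1,y_2)$ satisfy $u''\neq0$ at every point of $\{u'=0\}$. (1) Let $0<\beta\le\frac98\kappa_+$. Then (i) $\lim_{c\to u_{\min}^-}\lambda_n(c)=-\infty$ for $1\le n\le m_\beta$; (ii) $M_\beta<\infty$; (iii) there exists an integer $N_\beta>m_\beta$ such that $\inf_{c\in(-\infty,u_{\min})}\lambda_{N_\beta}(c)\ge0$. (2) Let $\frac98\kappa_-\le\beta<0$. Then (i) $\lim_{c\to u_{\max}^+}\lambda_n(c)=-\infty$ for $1\le n\le m_\beta$; (ii) $M_\beta<\infty$; (iii) there exists an integer $N_\beta>m_\beta$ such that $\inf_{c\in(u_{\max},\infty)}\lambda_{N_\beta}(c)\ge0$. (3) Let $\beta>\frac98\kappa_+$. Then $\lim_{c\to u_{\min}^-}\lambda_n(c)=-\infty$ for every $n\ge1$. (4) Let $\beta<\frac98\kappa_-$. Then $\lim_{c\to u_{\max}^+}\lambda_n(c)=-\infty$ for every $n\ge1$.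
   Context: $y_1<y_2$; $u$ is real-valued; $u_{\min}=\min_{[y_1,y_2]}u$, $u_{\max}=\max_{[y_1,y_2]}u$; sets such as $\{u'=0\}$ are subsets of $[y_1,y_2]$. $\kappa_+=\min\{u''(y): y\in[y_1,y_2],\,u'(y)=0,\,u(y)=u_{\min}\}$ if $\{u'=0\}\cap\{u=u_{\min}\}\ne\emptyset$ and $\kappa_+=\infty$ otherwise; $\kappa_-=\max\{u''(y): y\in[y_1,y_2],\,u'(y)=0,\,u(y)=u_{\max}\}$ if $\{u'=0\}\cap\{u=u_{\max}\}\ne\emptyset$ and $\kappa_-=-\infty$ otherwise. (If $\kappa_+=\infty$, the condition $0<\beta\le\frac98\kappa_+$ means $\beta\in(0,\infty)$; similarly for $\kappa_-=-\infty$.) For real $c\notin\mathrm{Ran}(u)$, $\lambda_n(c)$ is the $n$-th eigenvalue ($n\ge1$, in increasing order) of the Rayleigh–Kuo boundary value problem $-\phi''+\frac{u''-\beta}{u-c}\phi=\lambda\phi$, $\phi(y_1)=\phi(y_2)=0$, $\phi\in H_0^1\cap H^2(y_1,y_2)$. If $0<\beta\le\frac98\kappa_+$: $m_\beta=\sharp\{a\in(y_1,y_2): u(a)=u_{\min},\,u''(a)-\beta<0\}$ and $M_\beta=-\inf_{c\in(-\infty,u_{\min})}\lambda_{m_\beta+1}(c)$. If $\frac98\kappa_-\le\beta<0$: $m_\beta=\sharp\{a\in(y_1,y_2): u(a)=u_{\max},\,u''(a)-\beta>0\}$ and $M_\beta=-\inf_{c\in(u_{\max},\infty)}\lambda_{m_\beta+1}(c)$.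 *)

(* Defs.v *)
From HB Require Import structures.
From mathcomp Require Import all_boot all_order all_algebra.
From mathcomp Require Import finmap.
From mathcomp Require Import all_classical all_reals all_analysis.
Set Implicit Arguments.
Unset Strict Implicit.
Unset Printing Implicit Defensive.
Import Order.TTheory GRing.Theory Num.Theory.
Import numFieldNormedType.Exports.
Local Open Scope classical_set_scope.
Local Open Scope ring_scope.

(* A function on [a, b] is represented by a total function R -> R; no
   definition below looks at its values outside [a, b]. *)

(* Derivative relative to [a, b]: two-sided inside, one-sided at the endpoints. *)
Definition D (R : realType) (a b : R) (f : R -> R) (x : R) : R :=
  lim ((f y - f x) / (y - x) @[y --> within `[a, b] x^']).

Definition L2 (R : realType) (a b : R) (f : R -> R) : Prop :=
  measurable_fun `[a, b] f /\
  (\int[lebesgue_measure]_(x in `[a, b]) ((f x) ^+ 2)%:E < +oo)%E.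

(* The one-dimensional Sobolev space H^k(a, b), for a < b.  Functions in
   H^(k+1)(a, b) are identified with their continuous representatives on
   [a, b], i.e. with the absolutely continuous functions whose derivative g
   lies in H^k(a, b); so for u in H^4 the derivatives D u, D (D u) and
   D (D (D u)) exist everywhere on [a, b], and for phi in H^2 the derivative
   D (D phi) exists almost everywhere and is the weak second derivative. *)
Fixpoint Sobolev (R : realType) (a b : R) (k : nat) (f : R -> R) : Prop :=
  match k with
  | 0 => L2 a b f
  | k'.+1 => exists g : R -> R, Sobolev a b k' g /\
      forall x, x \in `[a, b] ->
        f x = f a + \int[lebesgue_measure]_(t in `[a, x]) g t
  end.

(* mu is an eigenvalue of - phi'' + q phi = mu phi, phi(a) = phi(b) = 0, with
   phi in H^1_0 and H^2; in dimension one, H^1_0 is the subspace of H^1 of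
   functions vanishing at the endpoints. *)
Definition dirichlet_eigenvalue (R : realType) (a b : R) (q : R -> R) (mu : R) :
    Prop :=
  exists phi : R -> R,
    [/\ Sobolev a b 2 phi,
        phi a = 0 /\ phi b = 0,
        exists2 x, x \in `[a, b] & phi x != 0 &
        {ae lebesgue_measure, forall x, x \in `]a, b[ ->
           - D a b (D a b phi) x + q x * phi x = mu * phi x}].

(* The n-th eigenvalue, n >= 1: the one with exactly n eigenvalues less than or
   equal to it.  Distinct values are counted, since Dirichlet eigenvalues in
   dimension one are all simple.  The default value 0 is irrelevant for
   continuous q and n >= 1, where the n-th eigenvalue exists. *)
Definition nth_eigenvalue (R : realType) (a b : R) (q : R -> R) (n : nat) : R :=
  xget 0 [set l | dirichlet_eigenvalue a b q l /\
    ([set mu | dirichlet_eigenvalue a b q mu /\ mu <= l] #= `I_n)%card].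

(* A minimum and a maximum as soon as u is continuous on [y1, y2]. *)
Definition umin (R : realType) (y1 y2 : R) (u : R -> R) : R := inf (u @` `[y1, y2]).
Definition umax (R : realType) (y1 y2 : R) (u : R -> R) : R := sup (u @` `[y1, y2]).

(* For u in H^4 the infimum (resp. supremum) is attained when the set is
   nonempty; it is +oo (resp. -oo) when the set is empty. *)
Definition kappa_plus (R : realType) (y1 y2 : R) (u : R -> R) : \bar R :=
  ereal_inf [set (D y1 y2 (D y1 y2 u) y)%:E | y in
    [set y | [/\ y \in `[y1, y2], D y1 y2 u y = 0 & u y = umin y1 y2 u]]].
Definition kappa_minus (R : realType) (y1 y2 : R) (u : R -> R) : \bar R :=
  ereal_sup [set (D y1 y2 (D y1 y2 u) y)%:E | y in
    [set y | [/\ y \in `[y1, y2], D y1 y2 u y = 0 & u y = umax y1 y2 u]]].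

(* Meaningful for c outside the range of u. *)
Definition lambda (R : realType) (y1 y2 : R) (u : R -> R) (beta : R) (n : nat)
    (c : R) : R :=
  nth_eigenvalue y1 y2 (fun y => (D y1 y2 (D y1 y2 u) y - beta) / (u y - c)) n.

(* [fset_set] is the empty set on infinite sets; the sets below are finite
   when u is in H^4 and u'' does not vanish on the critical set of u. *)
Definition m_plus (R : realType) (y1 y2 : R) (u : R -> R) (beta : R) : nat :=
  #|` fset_set [set a | [/\ a \in `]y1, y2[, u a = umin y1 y2 u &
                            D y1 y2 (D y1 y2 u) a - beta < 0]]|.
Definition m_minus (R : realType) (y1 y2 : R) (u : R -> R) (beta : R) : nat :=
  #|` fset_set [set a | [/\ a \in `]y1, y2[, u a = umax y1 y2 u &
                            D y1 y2 (D y1 y2 u) a - beta > 0]]|.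

Definition inf_lambda_below (R : realType) (y1 y2 : R) (u : R -> R) (beta : R) (n : nat) :
    \bar R :=
  ereal_inf [set (lambda y1 y2 u beta n c)%:E | c in `]-oo, umin y1 y2 u[].
Definition inf_lambda_above (R : realType) (y1 y2 : R) (u : R -> R) (beta : R) (n : nat) :
    \bar R :=
  ereal_inf [set (lambda y1 y2 u beta n c)%:E | c in `]umax y1 y2 u, +oo[].

Definition M_plus (R : realType) (y1 y2 : R) (u : R -> R) (beta : R) : \bar R :=
  (- inf_lambda_below y1 y2 u beta (m_plus y1 y2 u beta).+1)%E.
Definition M_minus (R : realType) (y1 y2 : R) (u : R -> R) (beta : R) : \bar R :=
  (- inf_lambda_above y1 y2 u beta (m_minus y1 y2 u beta).+1)%E.

(* Main.v *)
Require Import Defs.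
From HB Require Import structures.
From mathcomp Require Import all_boot all_order all_algebra.
From mathcomp Require Import finmap ring lra.
From mathcomp Require Import all_classical all_reals all_analysis.
From mathcomp Require Import measurable_realfun.
Set Implicit Arguments.
Unset Strict Implicit.
Unset Printing Implicit Defensive.
Import Order.TTheory GRing.Theory Num.Theory.
Import numFieldNormedType.Exports.
Local Open Scope classical_set_scope.
Local Open Scope ring_scope.


(** Let c < umin; the case c > umax is the same statement for (- u, - beta, - c).
    Everything depends on the potential (u'' - beta) / (u - c) near the minima
    of u.  At a critical minimum x with kappa = u''(x), and with d = |y - x|,
    it resembles (kappa - beta) / (kappa d^2 / 2 + (umin - c)).  As c increases
    to umin this tends to - gamma / d^2 with gamma = 2 (beta / kappa - 1), and
    beta = 9/8 kappa is the case gamma = 1/4, the constant of Hardy's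
    inequality.

    Lower bounds on eigenvalues (M_beta finite, N_beta).  If w' + w^2 <= p then
    phi'^2 + p phi^2 >= (w phi^2)', because (phi' - w phi)^2 >= 0.  Hence a
    function w on an interval makes the quadratic form of -phi'' + p phi
    nonnegative there, provided w <= 0 at the left end and w >= 0 at the right
    end; nothing else is asked at the ends, so that these inequalities
    ([coercive]) add up over adjacent intervals and only have to be proved near
    each point ([interval_glue]).  Three kinds of w are enough, uniformly in c.
    Away from the minima w = 0.  At a point where phi vanishes, w is the
    logarithmic derivative of sqrt d (1 - K d), which reaches the Hardy
    constant and absorbs an error K / d ([hardy]).  At an interior minimum with
    u'' >= beta, phi need not vanish; there the potential is at least
    k u' / (u - c) up to an integrable error d^(-1/2), with k = u''' / u'', and
    w = k ln (u - c) + lower order terms does it ([riccati_log]).  The error is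
    integrable because u''' is Hoelder continuous of exponent 1/2, which is
    where u in H^4 enters.  So the form plus a constant is nonnegative on
    functions that vanish at the m_beta interior minima with u'' < beta and at
    the ends, and the min-max argument ([eigenvalue_count]) bounds
    lambda_(m_beta + 1) from below.  Asking phi to vanish at finitely many
    suitable points of a cover removes the constant, which gives N_beta.

    Upper bounds.  The Pruefer angle theta of the solution of
    -phi'' + q phi = l phi, phi(a) = 0, solves
    theta' = 1 - (1 + q - l) sin^2 theta, depends continuously on l, stays below
    pi when l is very negative, and passes every multiple of pi upwards.  If it
    exceeds n pi at b for some l, then the intermediate value theorem gives n
    distinct eigenvalues at most l ([eigenvalues_of_osc]).  The angle passes a
    multiple of pi on every interval on which the Riccati equation
    w' = (q - l) - w^2 has no solution ([conjugate]).  A fixed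
    neighbourhood of an interior minimum with u'' < beta is such an interval for
    c close to umin, because it contains a potential well of width of order
    sqrt (umin - c) and depth of order 1 / (umin - c) ([profile_well]).  If
    beta > 9/8 kappa then gamma > 1/4, and every interval [r, R r] of small
    distances to x, for a fixed large R, is one ([conjugate_inverse_square]);
    there are arbitrarily many of these, so that every eigenvalue tends to -oo. *)

(** * Derivatives and primitives of real functions *)

Section Calculus.
Context {R : realType}.
Implicit Types (f g h : R -> R) (x y s t : R).

(** The next lemmas are stated for eta-expanded functions, with the derivative
    as an explicit value, so that composing them computes the derivative of an
    expression and [drv_eq] leaves its simplification as a ring identity. *)
Lemma drv_eq f x (d d' : R) : is_derive x 1 f d -> d = d' -> is_derive x 1 f d'.
Proof. by move=> ? <-. Qed.
Lemma drv_cst (k x : R) : is_derive x 1 (fun=> k) (0 : R).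
Proof. exact: is_derive_cst. Qed.
Lemma drv_id x : is_derive x 1 (fun y : R => y) (1 : R).
Proof. exact: is_derive_id. Qed.
Lemma drvD f g x (a b : R) : is_derive x 1 f a -> is_derive x 1 g b ->
  is_derive x 1 (fun y => f y + g y) (a + b).
Proof. move=> ? ?; exact: is_deriveD. Qed.
Lemma drvN f x (a : R) : is_derive x 1 f a ->
  is_derive x 1 (fun y => - f y) (- a).
Proof. move=> ?; exact: is_deriveN. Qed.
Lemma drvB f g x (a b : R) : is_derive x 1 f a -> is_derive x 1 g b ->
  is_derive x 1 (fun y => f y - g y) (a - b).
Proof. move=> ? ?; exact: is_deriveB. Qed.
Lemma drvM f g x (a b : R) : is_derive x 1 f a -> is_derive x 1 g b ->
  is_derive x 1 (fun y => f y * g y) (a * g x + f x * b).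
Proof.
move=> df dg; apply: (drv_eq (is_deriveM df dg)).
by rewrite /GRing.scale /= addrC; congr (_ + _); rewrite mulrC.
Qed.
Lemma drvZ (k : R) f x (a : R) : is_derive x 1 f a ->
  is_derive x 1 (fun y => k * f y) (k * a).
Proof. by move=> df; apply: (drv_eq (drvM (drv_cst k x) df)); rewrite mul0r add0r. Qed.
Lemma drv_sqr f x (a : R) : is_derive x 1 f a ->
  is_derive x 1 (fun y => f y ^+ 2) (2 * f x * a).
Proof.
move=> df; have -> : (fun y => f y ^+ 2) = (fun y => f y * f y).
  by apply/funext => y; rewrite expr2.
by apply: (drv_eq (drvM df df)); ring.
Qed.
Lemma drvV f x (a : R) : is_derive x 1 f a -> f x != 0 ->
  is_derive x 1 (fun y => (f y)^-1) (- a / f x ^+ 2).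
Proof.
move=> df fx; apply: (drv_eq (is_deriveV fx df)).
by rewrite /GRing.scale /=; ring.
Qed.
Lemma drv_comp f g x (a b : R) : is_derive (g x) 1 f a -> is_derive x 1 g b ->
  is_derive x 1 (fun y => f (g y)) (a * b).
Proof.
move=> df dg; exact: is_derive1_comp.
Qed.
Lemma drv_continuous f x (a : R) : is_derive x 1 f a -> {for x, continuous f}.
Proof. by move=> [df _]; exact/differentiable_continuous/derivable1_diffP. Qed.

Lemma near_pos h x : {for x, continuous h} -> 0 < h x ->
  exists2 e : R, 0 < e & forall y, `|y - x| < e -> 0 < h y.
Proof.
move=> /cvgrPdist_lt ch hx; have [e /= e0 he] := ch _ hx.
exists e => // y yx; have := he y; rewrite /ball_/= distrC => /(_ yx).
by rewrite ltr_norml => /andP[]; lra.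
Qed.

Lemma in_cc (s t x : R) : s <= x -> x <= t -> x \in `[s, t].
Proof. by rewrite in_itv/= => -> ->. Qed.

Lemma cont_within f (A : set R) : (forall x, A x -> {for x, continuous f}) ->
  {within A, continuous f}.
Proof. by move=> h; apply: continuous_in_subspaceT => x /set_mem; exact: h. Qed.

Lemma mean_value f f' s t : s < t -> (forall x, x \in `]s, t[ -> is_derive x 1 f (f' x)) ->
  {within `[s, t], continuous f} ->
  exists2 c, c \in `]s, t[ & f t - f s = f' c * (t - s).
Proof. by move=> st df cf; exact: (MVT st df cf). Qed.

Lemma drv_monotone_open f f' s t : s <= t -> {within `[s, t], continuous f} ->
  (forall x, x \in `]s, t[ -> is_derive x 1 f (f' x)) ->
  (forall x, x \in `]s, t[ -> 0 <= f' x) -> f s <= f t.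
Proof.
rewrite le_eqVlt => /predU1P[->//|st] cf df f0.
have [c cst e] := mean_value st df cf.
by rewrite -subr_ge0 e mulr_ge0 ?f0// subr_ge0 ltW.
Qed.

Lemma drv_monotone f f' s t : s <= t ->
  (forall x, x \in `[s, t] -> is_derive x 1 f (f' x)) ->
  (forall x, x \in `]s, t[ -> 0 <= f' x) -> f s <= f t.
Proof.
move=> st df f0.
have cf : {within `[s, t], continuous f}.
  by apply: cont_within => x xs; exact: (drv_continuous (df x xs)).
have df' x : x \in `]s, t[ -> is_derive x 1 f (f' x).
  by move=> xs; apply: df; exact: subset_itv_oo_cc.
exact: (drv_monotone_open st cf df' f0).
Qed.


Lemma drv_exp f x (a : R) : is_derive x 1 f a ->
  is_derive x 1 (fun y => expR (f y)) (expR (f x) * a).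
Proof. by move=> df; apply: drv_comp df. Qed.
Lemma drv_ln f x (a : R) : is_derive x 1 f a -> 0 < f x ->
  is_derive x 1 (fun y => ln (f y)) (a / f x).
Proof.
move=> df fx; apply: (drv_eq (drv_comp (is_derive1_ln fx) df)).
by rewrite mulrC.
Qed.
Lemma drv_sin f x (a : R) : is_derive x 1 f a ->
  is_derive x 1 (fun y => sin (f y)) (cos (f x) * a).
Proof. by move=> df; apply: drv_comp df. Qed.
Lemma drv_cos f x (a : R) : is_derive x 1 f a ->
  is_derive x 1 (fun y => cos (f y)) (- sin (f x) * a).
Proof. by move=> df; apply: drv_comp df. Qed.
Lemma drv_atan f x (a : R) : is_derive x 1 f a ->
  is_derive x 1 (fun y => atan (f y)) (a / (1 + f x ^+ 2)).
Proof.
move=> df; apply: (drv_eq (drv_comp (is_derive1_atan (f x)) df)).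
by rewrite mulrC.
Qed.
Lemma drv_sqrt f x (a : R) : is_derive x 1 f a -> 0 < f x ->
  is_derive x 1 (fun y => Num.sqrt (f y)) (a / (2 * Num.sqrt (f x))).
Proof.
move=> df fx; apply: (drv_eq (drv_comp (is_derive1_sqrt fx) df)).
by rewrite mulrC.
Qed.

Notation mu := (@lebesgue_measure R).

Lemma cont_integrable h a b : continuous h -> mu.-integrable `[a, b] (EFin \o h).
Proof.
move=> ch; apply: continuous_compact_integrable; first exact: segment_compact.
by apply: cont_within => x _; exact: ch.
Qed.

(** The integral from a base point below both x and 0; it is differentiable on
    all of R, so that no one-sided derivative occurs later. *)
Lemma primitive h : continuous h -> exists H, forall x, is_derive x 1 H (h x).
Proof.
move=> ch.
pose G (m x : R) := \int[mu]_(t in `[m, x]) h t.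
have Gm (m m' x : R) : m' <= m -> m <= x -> G m' x = G m' m + G m x.
  move=> m'm mx; have := @Rintegral_itvB R h (BLeft m') (BRight x) m
    (cont_integrable m' x ch).
  rewrite !bnd_simp => /(_ m'm mx)/eqP; rewrite subr_eq => /eqP.
  rewrite Rintegral_itv_obnd_cbnd; first by rewrite addrC.
  apply: integrableS (cont_integrable m x ch) => //.
  exact: subset_itv_oc_cc.
pose H x := G (Num.min x 0 - 1) x - G (Num.min x 0 - 1) 0.
have HE m x : m <= Num.min x 0 - 1 -> H x = G m x - G m 0.
  move=> mx.
  have m1 : Num.min x 0 <= x by rewrite ge_min lexx.
  have m2 : Num.min x 0 <= 0 by rewrite ge_min lexx orbT.
  by rewrite /H (Gm _ _ x mx) ?(Gm _ _ 0 mx); lra.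
exists H => x.
pose m := Num.min x 0 - 2.
have mx : m < x.
  have m1 : Num.min x 0 <= x by rewrite ge_min lexx.
  by rewrite /m; lra.
apply: (@near_eq_is_derive _ _ _ (fun y => G m y - G m 0)).
  near=> y; rewrite (HE m)// /m.
  have yx : `|x - y| < 1 by near: y; apply: (nbhsx_ballx x); exact: ltr01.
  have [] : Num.min x 0 <= x /\ Num.min x 0 <= 0 by rewrite !ge_min !lexx orbT.
  rewrite ltr_distlC in yx; case/andP: yx => yx1 yx2.
  by rewrite /(Num.min y 0); case: ifP; lra.
have [d1 d2] := @continuous_FTC1_closed R h m x (x + 1) (ltr_pwDr ltr01 (lexx x))
  (cont_integrable m (x + 1) ch) mx (ch x).
have dG : is_derive x 1 (fun y => G m y) (h x).
  by apply: DeriveDef; [exact: d1|rewrite -derive1E; exact: d2].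
by apply: (drv_eq (drvB dG (drv_cst _ _))); rewrite subr0.
Unshelve. all: by end_near. Qed.

End Calculus.

(** * Sobolev functions as primitives *)

Section Bridge.
Context {R : realType}.
Implicit Types (f g h : R -> R) (a b x y : R).
Notation mu := (@lebesgue_measure R).

(** Composing with [clamp a b] extends a function on [a, b] to R without
    changing its modulus of continuity. *)
Definition clamp a b x : R := Num.max a (Num.min b x).

Lemma clamp_in a b x : a <= b -> clamp a b x \in `[a, b].
Proof.
move=> ab; rewrite in_itv/= /clamp /Num.max /Num.min.
by case: ifPn; case: ifPn; rewrite -?leNgt; lra.
Qed.

Lemma clamp_id a b x : x \in `[a, b] -> clamp a b x = x.
Proof.
rewrite in_itv/= /clamp /Num.max /Num.min => /andP[].
by case: ifPn; case: ifPn; rewrite -?leNgt; lra.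
Qed.

Lemma clamp_lip a b x y : a <= b -> `|clamp a b x - clamp a b y| <= `|x - y|.
Proof.
wlog xy : x y / x <= y.
  move=> h ab; have [xy|/ltW yx] := leP x y; first exact: h.
  by rewrite distrC (distrC x); exact: h.
move=> ab; rewrite distrC (distrC x) (ger0_norm (x := y - x)) ?subr_ge0//.
rewrite ler_norml /clamp /Num.max /Num.min.
by apply/andP; split; do 4 (case: ifPn; rewrite -?leNgt); lra.
Qed.

Lemma clamp_cont a b : a <= b -> continuous (clamp a b).
Proof.
move=> ab x; apply/cvgrPdist_le => e e0; near=> y.
apply: le_trans (clamp_lip _ _ ab) _.
by apply: ltW; near: y; exact: (nbhsx_ballx x _ e0).
Unshelve. all: by end_near. Qed.

Lemma cont_clamp a b f : a <= b ->
  (forall x, x \in `[a, b] -> {for x, continuous f}) ->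
  continuous (f \o clamp a b).
Proof.
move=> ab cf x; apply: continuous_comp; first exact: clamp_cont.
exact: cf (clamp_in x ab).
Qed.

Definition holder_half (H : R) f := forall x y, `|f x - f y| <= H * Num.sqrt `|x - y|.

Lemma holder_cont H f : 0 < H -> holder_half H f -> continuous f.
Proof.
move=> H0 hf x; apply/cvgrPdist_le => e e0.
have e1 : 0 < (e / H) ^+ 2 by rewrite exprn_gt0// divr_gt0.
near=> y; apply: (le_trans (hf x y)).
have xy : `|x - y| < (e / H) ^+ 2 by near: y; exact: (nbhsx_ballx x _ e1).
rewrite mulrC -ler_pdivlMr//.
have -> : e / H = Num.sqrt ((e / H) ^+ 2).
  by rewrite sqrtr_sqr ger0_norm// divr_ge0 ?ltW.
by rewrite ler_wsqrtr// ltW.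
Unshelve. all: by end_near. Qed.

Lemma L2_sq_integrable a b f : L2 a b f ->
  mu.-integrable `[a, b] (EFin \o (fun x => f x ^+ 2)).
Proof.
move=> [mf f2]; apply/integrableP; split.
  by apply/measurable_EFinP; exact: measurable_funX.
move: f2; congr (_ < _)%E; apply: eq_integral => x _ /=.
by rewrite ger0_norm ?sqr_ge0.
Qed.

Lemma L2_integrable a b f : L2 a b f -> mu.-integrable `[a, b] (EFin \o f).
Proof.
move=> [mf f2].
have i2 := L2_sq_integrable (conj mf f2).
have i1 : mu.-integrable `[a, b] (EFin \o (fun x => 1 : R)).
  exact: cont_integrable (@cst_continuous _ _ _).
apply: (le_integrable _ _ _ (integrableD _ i2 i1)) => //.
  exact/measurable_EFinP.
move=> x _ /=; rewrite lee_fin [leRHS]ger0_norm; last by rewrite addr_ge0 ?sqr_ge0.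
by rewrite ler_norml; nra.
Qed.

Lemma cont_L2 a b f : continuous f -> L2 a b f.
Proof.
move=> cf; have mf : measurable_fun `[a, b] f.
  apply: measurable_funTS; exact: continuous_measurable_fun.
split => //.
have : mu.-integrable `[a, b] (EFin \o (fun x => f x ^+ 2)).
  by apply: cont_integrable => x; apply: cvgM; exact: cf.
move=> /integrableP[_]; congr (_ < _)%E; apply: eq_integral => x _ /=.
by rewrite ger0_norm ?sqr_ge0.
Qed.

Lemma eq_L2 a b f g : {in `[a, b], f =1 g} -> L2 a b f -> L2 a b g.
Proof.
move=> fg [mf f2]; split.
  by apply: eq_measurable_fun mf => x /set_mem /= xi; exact: fg.
move: f2; congr (_ < _)%E; apply: eq_integral => x /set_mem /= xi.
by rewrite fg.
Qed.

Lemma integral_diff a b g x y : mu.-integrable `[a, b] (EFin \o g) ->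
  a <= x -> x <= y -> y <= b ->
  (\int[mu]_(t in `[a, y]) g t - \int[mu]_(t in `[a, x]) g t =
  \int[mu]_(t in `[x, y]) g t) /\ mu.-integrable `[x, y] (EFin \o g).
Proof.
move=> ig ax xy yb.
have iy : mu.-integrable `[x, y] (EFin \o g).
  apply: integrableS ig => //; exact: subset_itvScc.
split=> //; have := @Rintegral_itvB R g (BLeft a) (BRight y) x.
rewrite !bnd_simp => -> //.
  rewrite Rintegral_itv_obnd_cbnd//; apply: integrableS iy => //.
  exact: subset_itv_oc_cc.
by apply: integrableS ig => //; exact: subset_itvScc.
Qed.

(** Cauchy-Schwarz in the form 2 |g| <= s g^2 + 1 / s with s = sqrt (y - x). *)
Lemma L2_primitive_holder a b f g : a <= b -> L2 a b g ->
  (forall x, x \in `[a, b] -> f x = f a + \int[mu]_(t in `[a, x]) g t) ->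
  exists2 H : R, 0 < H & holder_half H (f \o clamp a b).
Proof.
move=> ab L2g fE; have ig := L2_integrable L2g; have ig2 := L2_sq_integrable L2g.
pose N := \int[mu]_(t in `[a, b]) (g t ^+ 2).
have N0 : 0 <= N by apply: Rintegral_ge0 => x _; exact: sqr_ge0.
exists (N + 1); first by lra.
suff key x y : x \in `[a, b] -> y \in `[a, b] -> x <= y ->
    `|f y - f x| <= (N + 1) * Num.sqrt (y - x).
  move=> x y /=; have xi := clamp_in x ab; have yi := clamp_in y ab.
  apply: (@le_trans _ _ ((N + 1) * Num.sqrt `|clamp a b x - clamp a b y|)).
    have [cxy|/ltW cxy] := leP (clamp a b x) (clamp a b y).
      rewrite distrC (distrC (clamp a b x)).
      by rewrite (ger0_norm (_ : 0 <= clamp a b y - _)) ?subr_ge0//; exact: key.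
    by rewrite (ger0_norm (_ : 0 <= clamp a b x - _)) ?subr_ge0//; exact: key.
  by apply: ler_wpM2l; [lra|rewrite ler_wsqrtr ?clamp_lip].
move=> xi yi xy; rewrite (fE x xi) (fE y yi).
move: xi yi; rewrite !in_itv/= => /andP[ax xb] /andP[ay yb].
have [e iy] := integral_diff ig ax xy yb.
rewrite opprD addrACA subrr add0r e.
have [->|xny] := eqVneq x y.
  by rewrite set_itv1 Rintegral_set1 subrr sqrtr0 mulr0 normr0.
have xy' : 0 < y - x by rewrite subr_gt0 lt_neqAle xny.
pose s := Num.sqrt (y - x).
have s0 : 0 < s by rewrite sqrtr_gt0.
have ss : s ^+ 2 = y - x by rewrite sqr_sqrtr ?ltW.
have iy2 : mu.-integrable `[x, y] (EFin \o (fun t => g t ^+ 2)).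
  apply: integrableS ig2 => //; exact: subset_itvScc.
have i1 : mu.-integrable `[x, y] (EFin \o (fun t => s^-1 / 2)).
  exact: cont_integrable (@cst_continuous _ _ _).
have i2 : mu.-integrable `[x, y] (EFin \o (fun t => s / 2 * g t ^+ 2)).
  by under [X in integrable _ _ X]eq_fun => t do rewrite /= EFinM; exact: integrableZl.
apply: le_trans (le_normr_Rintegral _ iy) _ => //.
apply: (@le_trans _ _ (\int[mu]_(t in `[x, y]) (s / 2 * g t ^+ 2 + s^-1 / 2))).
  apply: le_Rintegral => //.
  - exact: integrable_norm.
  - by under [X in integrable _ _ X]eq_fun => t do rewrite /= EFinD; exact: integrableD.
  - move=> t _; have sV : s * s^-1 = 1 by rewrite divff ?gt_eqF.
    have sV0 : 0 < s^-1 by rewrite invr_gt0.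
    rewrite ler_norml; apply/andP; split; rewrite -subr_ge0.
      have -> : g t - - (s / 2 * g t ^+ 2 + s^-1 / 2) = s^-1 / 2 * (s * g t + 1) ^+ 2.
        by field; lra.
      by rewrite mulr_ge0 ?sqr_ge0//; lra.
    have -> : (s / 2 * g t ^+ 2 + s^-1 / 2) - g t = s^-1 / 2 * (s * g t - 1) ^+ 2.
      by field; lra.
    by rewrite mulr_ge0 ?sqr_ge0//; lra.
rewrite RintegralD// RintegralZl// Rintegral_cst//=.
rewrite lebesgue_measure_itv/= lte_fin -subr_gt0 xy' /= -ss.
have -> : s^-1 / 2 * s ^+ 2 = s / 2 by field; lra.
have NN : \int[mu]_(t in `[x, y]) (g t ^+ 2) <= N.
  rewrite /N /Rintegral; apply: fine_le.
  - exact: integrable_fin_num iy2.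
  - exact: integrable_fin_num ig2.
  - apply: ge0_subset_integral => //.
    + by case/integrableP : ig2.
    + by move=> t _; rewrite lee_fin sqr_ge0.
    + exact: subset_itvScc.
rewrite sqrtr_sqr (gtr0_norm s0).
nra.
Qed.


Lemma Sobolev_holder a b k f : a <= b -> Sobolev a b k f -> L2 a b f /\
  ((0 < k)%N -> exists2 H : R, 0 < H & holder_half H (f \o clamp a b)).
Proof.
move=> ab; elim: k f => [f ?//|k IH f [g [/IH[L2g _] fE]]].
have [H H0 hf] := L2_primitive_holder ab L2g fE.
split; last by exists H.
apply: (@eq_L2 _ _ (f \o clamp a b)); first by move=> x xi /=; rewrite clamp_id.
exact/cont_L2/(holder_cont H0 hf).
Qed.

Lemma FTC2 f h a b : a <= b ->
  (forall x, x \in `[a, b] -> is_derive x 1 f (h x)) ->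
  (forall x, x \in `[a, b] -> {for x, continuous h}) ->
  \int[mu]_(t in `[a, b]) h t = f b - f a.
Proof.
rewrite le_eqVlt => /predU1P[->|ab] df ch.
  by rewrite set_itv1 Rintegral_set1 subrr.
rewrite /Rintegral (@continuous_FTC2 _ h f) //.
- by apply: cont_within => x; exact: ch.
- split.
  + by move=> x xi; have [] := df x (subset_itv_oo_cc xi).
  + by apply/cvg_at_right_filter/(drv_continuous (df a _)); rewrite in_itv/= lexx ltW.
  + by apply/cvg_at_left_filter/(drv_continuous (df b _)); rewrite in_itv/= lexx ltW.
- by move=> x xi; have [_] := df x (subset_itv_oo_cc xi); rewrite derive1E.
Qed.

(** Applied repeatedly, this turns a function of H^4 into the restriction of a
    C^3 function on R, so that the relative derivatives on [a, b] become ordinary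
    ones. *)
Lemma C1_extension a b f g G : a <= b -> continuous G ->
  {in `[a, b], G =1 g} ->
  (forall x, x \in `[a, b] -> f x = f a + \int[mu]_(t in `[a, x]) g t) ->
  exists2 F, forall x, is_derive x 1 F (G x) & {in `[a, b], F =1 f}.
Proof.
move=> ab cG Gg fE; have [H dH] := primitive cG.
exists (fun x => f a + (H x - H a)).
  by move=> x; apply: (drv_eq (drvD (drv_cst _ _) (drvB (dH x) (drv_cst _ _)))); lra.
move=> x xi; rewrite (fE x xi); congr (_ + _).
move: xi; rewrite in_itv/= => /andP[ax xb].
rewrite -(@FTC2 H G)//; last by move=> t _; exact: cG.
apply: eq_Rintegral => t /set_mem/=; rewrite in_itv/= => /andP[at_ tx].
by rewrite Gg// in_itv/= at_ (le_trans tx).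
Qed.

Lemma within_proper a b x : a < b -> x \in `[a, b] ->
  ProperFilter (within `[a, b] x^').
Proof.
move=> ab; rewrite in_itv/= => /andP[ax xb].
apply: Build_ProperFilter_ex => P; rewrite /within/= => -[e /= e0 h].
have [xb'|bx] := ltP x b.
  pose d := Num.min (e / 2) (b - x).
  have d0 : 0 < d by rewrite lt_min divr_gt0//= subr_gt0.
  have [d1 d2] : d <= e / 2 /\ d <= b - x by rewrite !ge_min !lexx orbT.
  exists (x + d); apply: h => /=.
  - by rewrite opprD addrA subrr sub0r normrN gtr0_norm//; lra.
  - by rewrite gt_eqF// ltrDl.
  - by rewrite in_itv/=; lra.
pose d := Num.min (e / 2) (x - a).
have d0 : 0 < d by rewrite lt_min divr_gt0//= subr_gt0; lra.
have [d1 d2] : d <= e / 2 /\ d <= x - a by rewrite !ge_min !lexx orbT.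
exists (x - d); apply: h => /=.
- by rewrite opprB addrC subrK gtr0_norm//; lra.
- by rewrite lt_eqF// ltrBlDr ltrDl.
- by rewrite in_itv/=; lra.
Qed.

Lemma within_dnbhsW a b x (P : set R) :
  (forall y, y != x -> y \in `[a, b] -> P y) -> within `[a, b] x^' P.
Proof.
move=> h; have : nbhs x [set: R] by exact: filterT.
by apply: filterS => y _ yx yi; exact: h.
Qed.

Lemma D_eq a b f F (d : R) x : a < b -> x \in `[a, b] ->
  is_derive x 1 F d -> {in `[a, b], F =1 f} -> D a b f x = d.
Proof.
move=> ab xi dF Ff; have PF := within_proper ab xi.
apply: cvg_lim => //.
have [g [gE cg gx]] := (is_derive1_caratheodory F x d).1 dF.
have -> : d = g x by [].
apply: (@cvg_trans _ (g y @[y --> within `[a, b] x^'])).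
  apply: near_eq_cvg; apply: within_dnbhsW => y yx yi.
  by rewrite -!Ff// gE mulfK// subr_eq0.
apply: cvg_within_filter; apply: cvg_within_filter; exact: cg.
Qed.

Lemma D_ext a b f g x : x \in `[a, b] -> {in `[a, b], f =1 g} ->
  D a b f x = D a b g x.
Proof.
move=> xi fg; rewrite /D; congr (lim _).
rewrite eqEsubset; split; apply: near_eq_cvg;
  by apply: within_dnbhsW => y _ yi; rewrite !fg.
Qed.

End Bridge.

(** * Weak and classical eigenfunctions *)

Section Bridge2.
Context {R : realType}.
Implicit Types (f g h q : R -> R) (a b x y : R).
Notation mu := (@lebesgue_measure R).

(** Lebesgue's differentiation theorem. *)
Lemma D_primitive_ae a b g h : a < b -> L2 a b h ->
  (forall x, x \in `[a, b] -> g x = g a + \int[mu]_(t in `[a, x]) h t) ->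
  {ae mu, forall x, x \in `]a, b[ -> D a b g x = h x}.
Proof.
move=> ab L2h gE; have ih := L2_integrable L2h.
pose hr := h \_ `[a, b].
have ihr : mu.-integrable setT (EFin \o hr).
  by rewrite -restrict_EFin; apply/integrable_restrict => //=; rewrite setTI.
have ihrS (A : set R) : measurable A -> mu.-integrable A (EFin \o hr).
  by move=> mA; apply: integrableS ihr.
have := @FTC1 R hr (BLeft a) (fun y => ihrS _ (measurable_itv _))
  (integrable_locally (measurable_itv _) ih).
have FF : Filter (nbhs (almost_everywhere mu)).
    exact: ae_filter_ringOfSetsType.
apply: filterS => x /= hx xi; have xi' := subset_itv_oo_cc xi.
move: (xi); rewrite in_itv/= => /andP[ax xb].
have [|d1 d2] := hx; first by rewrite lte_fin.
have hrx : hr x = h x by rewrite /hr patchE mem_set.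
rewrite -hrx -d2.
pose K y := \int[mu]_(t in `[a, y]) hr t.
have dK : is_derive x 1 K (derive1 K x).
  by apply: DeriveDef; [exact: d1|rewrite derive1E].
have dgK : is_derive x 1 (fun y => g a + K y) (derive1 K x).
  by apply: (drv_eq (drvD (drv_cst _ _) dK)); rewrite add0r.
apply: (D_eq ab xi' dgK).
move=> y yi; rewrite (gE y yi); congr (_ + _); apply: eq_Rintegral => t.
move/set_mem; rewrite /hr /= patchE in_itv/= => /andP[at_ ty].
rewrite mem_set//= in_itv/= at_ (le_trans ty)//.
by move: yi; rewrite in_itv/= => /andP[].
Qed.

Definition eigenfunction a b q (m : R) (phi phi1 : R -> R) :=
  [/\ forall x, x \in `[a, b] -> is_derive x 1 phi (phi1 x),
      forall x, x \in `[a, b] -> is_derive x 1 phi1 ((q x - m) * phi x),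
      phi a = 0, phi b = 0 & exists2 x, x \in `[a, b] & phi x != 0].

(** The second derivative of a weak eigenfunction agrees almost everywhere with
    the continuous function (q - m) phi, and its first derivative is the
    primitive of the former. *)
Lemma dirichlet_classical a b q q' m : a < b -> continuous q' ->
  {in `]a, b[, q' =1 q} -> dirichlet_eigenvalue a b q m ->
  exists phi phi1, eigenfunction a b q' m phi phi1.
Proof.
move=> ab cq' qq' [phi [Sphi [phia phib] [x0 x0i phix0] ae]].
have ab' := ltW ab.
have [_ /(_ isT)[Hp Hp0 hp]] := Sobolev_holder ab' Sphi.
have cphi := holder_cont Hp0 hp.
case: Sphi => g [Sg phiE].
have [L2g /(_ isT)[Hg Hg0 hg]] := @Sobolev_holder R a b 1 g ab' Sg.
have cg := holder_cont Hg0 hg.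
case: Sg => h [L2h gE].
have [F dF Ff] := @C1_extension R a b phi g _ ab' cg
  (fun x xi => congr1 g (clamp_id xi)) phiE.
have Dphi x : x \in `[a, b] -> D a b phi x = g x.
  move=> xi; rewrite -{2}(clamp_id xi); exact: (D_eq ab xi (dF x) Ff).
pose r := fun x => (q' x - m) * (phi \o clamp a b) x.
have cr : continuous r.
  by move=> x; apply: cvgM; [apply: cvgB; [exact: cq'|exact: cvg_cst]|exact: cphi].
have gE' x : x \in `[a, b] -> g x = g a + \int[mu]_(t in `[a, x]) r t.
  move=> xi; rewrite (gE x xi); congr (_ + _).
  move: xi; rewrite in_itv/= => /andP[ax xb].
  have sub : `[a, x] `<=` `[a, b] by exact: subset_itvScc.
  rewrite /Rintegral; congr fine; apply: ae_eq_integral => //.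
  - apply/measurable_EFinP; apply: (measurable_funS _ sub) => //; by case: L2h.
  - apply/measurable_EFinP/measurable_funTS; exact: continuous_measurable_fun.
  have nab y : {ae mu, forall x : R, x != y}.
    exists [set y]; split => //; first exact: lebesgue_measure_set1.
    by move=> z /= /negP; rewrite negbK => /eqP.
  have FF : Filter (nbhs (almost_everywhere mu)).
    exact: ae_filter_ringOfSetsType.
  have Dg := D_primitive_ae ab L2h gE.
  have nab2 := @filterI _ _ FF _ _ (nab a) (nab b).
  have := @filterI _ _ FF _ _ (@filterI _ _ FF _ _ ae Dg) nab2.
  apply: (@filterS _ _ FF) => t [[e1 e2] [ta tb]] ti0.
  have := sub t ti0; rewrite /= in_itv/= => /andP[at_ tb'].
  have ti : t \in `]a, b[ by rewrite in_itv/= !lt_neqAle eq_sym ta tb at_ tb'.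
  have ti' : t \in `[a, b] := subset_itv_oo_cc ti.
  have := e1 ti; rewrite (D_ext ti' Dphi) e2// -qq'// /r /= clamp_id//.
  by move=> e; congr EFin; lra.
have [F1 dF1 F1g] := @C1_extension R a b g r r ab' cr (fun _ _ => erefl) gE'.
have cF1 : continuous F1 by move=> x; exact: drv_continuous (dF1 x).
have [F0 dF0 F0f] := C1_extension ab' cF1 F1g phiE.
have [ai bi] : a \in `[a, b] /\ b \in `[a, b] by rewrite !in_itv/= !lexx ab'.
exists F0, F1; split=> //.
- by move=> x xi; apply: (drv_eq (dF1 x)); rewrite /r /= clamp_id// F0f.
- by rewrite F0f.
- by rewrite F0f.
- by exists x0 => //; rewrite F0f.
Qed.

Lemma classical_dirichlet a b q q' m phi phi1 : a < b -> continuous q' ->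
  {in `]a, b[, q' =1 q} -> eigenfunction a b q' m phi phi1 ->
  dirichlet_eigenvalue a b q m.
Proof.
move=> ab cq' qq' [dphi dphi1 pa pb [x0 x0i px0]]; have ab' := ltW ab.
have csub x : x \in `[a, b] -> forall y, y \in `[a, x] -> y \in `[a, b].
  by rewrite in_itv/= => /andP[_ xb]; apply: subset_itvScc.
have ax x : x \in `[a, b] -> a <= x by rewrite in_itv/= => /andP[].
have cphi : continuous (phi \o clamp a b).
  by apply: cont_clamp => // x xi; exact: drv_continuous (dphi x xi).
exists phi; split=> //; last 2 first.
- by exists x0.
- apply: aeW => x xi; have xi' := subset_itv_oo_cc xi.
  have e y : y \in `[a, b] -> D a b phi y = phi1 y.
    by move=> yi; exact: (D_eq ab yi (dphi y yi)).
  rewrite (D_ext xi' e) (D_eq ab xi' (dphi1 x xi'))// qq'//; lra.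
exists phi1; split.
  exists (fun x => (q' x - m) * phi x); split.
    apply: (@eq_L2 _ _ _ (fun x => (q' x - m) * (phi \o clamp a b) x)).
      by move=> x xi /=; rewrite clamp_id.
    apply: cont_L2 => x; apply: cvgM; last exact: cphi.
    by apply: cvgB; [exact: cq'|exact: cvg_cst].
  move=> x xi; rewrite (FTC2 (ax x xi) (fun y yi => dphi1 y (csub x xi y yi))).
    by lra.
  move=> y /(csub x xi) yi; apply: cvgM; last exact: drv_continuous (dphi y yi).
  by apply: cvgB; [exact: cq'|exact: cvg_cst].
move=> x xi; rewrite (FTC2 (ax x xi) (fun y yi => dphi y (csub x xi y yi))).
  by lra.
by move=> y /(csub x xi) yi; exact: drv_continuous (dphi1 y yi).
Qed.

End Bridge2.

(** * Nonnegative quadratic forms and the min-max bound *)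

Section Coercive.
Context {R : realType}.
Implicit Types (f g h p q : R -> R) (a b s t x y : R) (Z : set R).

(** The nonnegativity of the form of - phi'' + p phi on [s, t], without
    integrals: G stands for a primitive of a majorant of phi'^2 + p phi^2.
    Functions phi have to vanish on Z but not at s and t. *)
Definition coercive s t Z p := forall phi phi1 G G1 : R -> R,
  (forall x, x \in `[s, t] -> is_derive x 1 phi (phi1 x)) ->
  (forall x, x \in `[s, t] -> is_derive x 1 G (G1 x)) ->
  (forall x, x \in `[s, t] -> Z x -> phi x = 0) ->
  (forall x, x \in `[s, t] -> phi1 x ^+ 2 + p x * phi x ^+ 2 <= G1 x) ->
  G s <= G t.

Lemma coercive_cat s r t Z p : s <= r -> r <= t ->
  coercive s r Z p -> coercive r t Z p -> coercive s t Z p.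
Proof.
move=> sr rt c1 c2 phi phi1 G G1 dphi dG z le.
have s1 x : x \in `[s, r] -> x \in `[s, t] by apply: subset_itvScc.
have s2 x : x \in `[r, t] -> x \in `[s, t] by apply: subset_itvScc.
apply: (@le_trans _ _ (G r)).
  exact: (c1 phi phi1 G G1 (fun x xi => dphi x (s1 x xi))
    (fun x xi => dG x (s1 x xi)) (fun x xi => z x (s1 x xi))
    (fun x xi => le x (s1 x xi))).
exact: (c2 phi phi1 G G1 (fun x xi => dphi x (s2 x xi))
  (fun x xi => dG x (s2 x xi)) (fun x xi => z x (s2 x xi))
  (fun x xi => le x (s2 x xi))).
Qed.

Lemma coercive_mono s t Z Z' p p' :
  (forall x, x \in `[s, t] -> Z x -> Z' x) ->
  (forall x, x \in `[s, t] -> p x <= p' x) ->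
  coercive s t Z p -> coercive s t Z' p'.
Proof.
move=> ZZ pp c phi phi1 G G1 dphi dG z le.
apply: (c phi phi1 G G1 dphi dG) => x xi.
  by move=> /(ZZ _ xi); exact: z.
by apply: le_trans (le x xi); rewrite lerD2l ler_wpM2r ?sqr_ge0// pp.
Qed.

(** A property of intervals that is additive and holds around every point holds
    on [a, b].  Around an interior point x it is only required for s < x < t:
    the logarithmic estimate fails for intervals that have the minimum as an end
    point. *)
Lemma interval_glue (P : R -> R -> Prop) a b : a < b ->
  (forall s r t, a <= s -> s < r -> r < t -> t <= b -> P s r -> P r t -> P s t) ->
  (forall x, x \in `[a, b] -> exists2 d : R, 0 < d & forall s t, a <= s -> t <= b ->
     s < t -> x - d < s -> s <= x -> (s = x -> x = a) ->
     x <= t -> t < x + d -> (t = x -> x = b) -> P s t) ->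
  P a b.
Proof.
move=> ab cat loc.
(* It is not enough that P a t holds: the supremum has to be approached by
   points strictly below it. *)
pose S := [set t | a < t /\ t <= b /\ exists s0, [/\ a <= s0, s0 < t &
  forall s, s0 < s -> s < t -> P a s]].
have [da da0 ha] := loc a (in_cc (lexx a) (ltW ab)).
have minP (u v w : R) : u < v -> u < w -> [/\ u < Num.min v w, Num.min v w <= v & Num.min v w <= w].
  by move=> uv uw; rewrite lt_min uv uw !ge_min !lexx orbT.
have Sm : S (Num.min b (a + da)).
  have [m1 m2 m3] := minP a b (a + da) ab (ltr_pwDr da0 (lexx a)).
  split=> //; split=> //; exists a; split=> // s sa sm.
  by apply: ha => //; lra.
have Sb : has_sup S by split; [by exists (Num.min b (a + da))|exists b => x [_ []]].
have taub : sup S <= b by apply: sup_le_ub; [exists (Num.min b (a + da))|move=> x [_ []]].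
have atau : a < sup S.
  by apply: (lt_le_trans (proj1 Sm)); exact: sup_upper_bound.
have [d d0 hd] := loc (sup S) (in_cc (ltW atau) taub).
have [t1 [at1 [t1b [s0 [as0 s0t1 hs0]]]] t1d] := sup_adherent d0 Sb.
have t1tau : t1 <= sup S by apply: sup_upper_bound => //; split=> //; split=> //; exists s0.
pose s := (Num.max s0 (sup S - d) + t1) / 2.
have [M1 M2 M3] : [/\ s0 <= Num.max s0 (sup S - d),
    sup S - d <= Num.max s0 (sup S - d) & Num.max s0 (sup S - d) < t1].
  by rewrite !le_max !lexx orbT gt_max s0t1 t1d.
have [hs1 hs2 hs3] : [/\ s0 < s, sup S - d < s & s < t1] by rewrite /s; split; lra.
have Pas : P a s by exact: hs0.
have ext t : sup S <= t -> t < sup S + d -> t <= b -> (t = sup S -> sup S = b) -> P a t.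
  by move=> tt td tb e; apply: (cat a s t) => //; try lra; apply: hd => //; lra.
have [tb|] := ltP (sup S) b; last first.
  move=> bt; have e : sup S = b by lra.
  by apply: ext => //; lra.
have [m1 m2 m3] := minP (sup S) b (sup S + d) tb (ltr_pwDr d0 (lexx _)).
suff /(sup_upper_bound Sb) : S (Num.min b (sup S + d)) by lra.
split; first by lra.
split=> //; exists (sup S); split=> // [|r r1 r2]; first exact: ltW.
by apply: ext; lra.
Qed.

Lemma drv_sum n (h h' : 'I_n -> R -> R) x : (forall i, is_derive x 1 (h i) (h' i x)) ->
  is_derive x 1 (fun y => \sum_i h i y) (\sum_i h' i x).
Proof.
move=> dh; have -> : (fun y => \sum_i h i y) = \sum_i h i.
  by apply/funext => y; rewrite fct_sumE.
exact: is_derive_sum.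
Qed.

Lemma increase_pos a b h H x0 : a < b -> continuous h ->
  (forall x, is_derive x 1 H (h x)) -> (forall x, x \in `[a, b] -> 0 <= h x) ->
  x0 \in `[a, b] -> 0 < h x0 -> H a < H b.
Proof.
move=> ab ch dH h0 x0i hx0.
have [e e0 he] := near_pos (ch x0) hx0.
pose s := Num.max a (x0 - e / 2); pose t := Num.min b (x0 + e / 2).
move: x0i; rewrite in_itv/= => /andP[ax xb].
have [sa se at_] : [/\ a <= s, x0 - e / 2 <= s & s < t].
  rewrite /s /t !le_max !lexx orbT; split=> //.
  by rewrite lt_min !gt_max; apply/andP; split; apply/andP; split; lra.
have [tb te] : t <= b /\ t <= x0 + e / 2 by rewrite /t !ge_min !lexx orbT.
have mon u v : a <= u -> u <= v -> v <= b -> H u <= H v.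
  move=> au uv vb; apply: (@drv_monotone _ _ _ u v uv (fun x _ => dH x)) => x.
  by rewrite in_itv/= => /andP[? ?]; apply: h0; rewrite in_itv/=; lra.
have [c] := @mean_value _ H h s t at_ (fun x _ => dH x)
  (cont_within (fun x _ => drv_continuous (dH x))).
rewrite in_itv/= => /andP[sc ct] e1.
have : 0 < h c.
  by apply: he; rewrite ltr_norml; apply/andP; split; lra.
have := mon a s (lexx _) sa; have := mon t b; nra.
Qed.

(** Min-max principle: among size zs + 1 eigenfunctions some nontrivial
    combination P vanishes on zs.  If all the eigenvalues were below L, the form
    of q - L would be negative at P. *)
Lemma eigenvalue_count a b Z q L (zs : seq R) (m : 'I_(size zs).+1 -> R) :
  a < b -> coercive a b Z (fun x => q x - L) ->
  (forall x, x \in `]a, b[ -> Z x -> x \in zs) ->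
  injective m ->
  (forall i, exists phi phi1, eigenfunction a b q (m i) phi phi1) ->
  exists i, L <= m i.
Proof.
move=> ab coer Zzs inj_m eig; apply: contrapT => /forallNP mL.
have {}mL i : m i < L by rewrite ltNge; apply/negP; exact: mL.
have /choice[F hF] : forall i, exists F : (R -> R) * (R -> R),
    eigenfunction a b q (m i) F.1 F.2.
  by move=> i; have [f [g e]] := eig i; exists (f, g).
pose f i := (F i).1; pose f1 i := (F i).2.
have df i x : x \in `[a, b] -> is_derive x 1 (f i) (f1 i x).
  by have [h _ _ _ _] := hF i; exact: h.
have df1 i x : x \in `[a, b] -> is_derive x 1 (f1 i) ((q x - m i) * f i x).
  by have [_ h _ _ _] := hF i; exact: h.
have fa i : f i a = 0 by have [] := hF i.
have fb i : f i b = 0 by have [] := hF i.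
have fn i : exists2 x, x \in `[a, b] & f i x != 0 by have [] := hF i.
pose A : 'M[R]_((size zs).+1, size zs) := \matrix_(i, j) f i zs`_j.
have [c [i0 ci0] cA] : exists2 c : 'I_(size zs).+1 -> R, (exists i, c i != 0) &
    forall j, \sum_i c i * f i zs`_(j : 'I_(size zs)) = 0.
  have : kermx A != 0.
    rewrite -mxrank_eq0 mxrank_ker subn_eq0 -ltnNge.
    by rewrite ltnS rank_leq_col.
  move=> /rowV0Pn[v /sub_kermxP vA vn0].
  exists (fun i => v 0 i).
    apply: contrapT => /forallNP h; move/negP: vn0; apply; apply/eqP/rowP => i.
    by rewrite mxE; apply/eqP; rewrite -[_ == _]negbK; apply/negP; exact: h.
  move=> j; have /rowP/(_ j) := vA; rewrite !mxE => e; apply: etrans e.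
  by apply: eq_bigr => i _; rewrite mxE.
pose P x := \sum_i c i * f i x; pose P1 x := \sum_i c i * f1 i x.
have dP x : x \in `[a, b] -> is_derive x 1 P (P1 x).
  move=> xi.
  by apply: (@drv_sum _ (fun i x => c i * f i x) (fun i x => c i * f1 i x)) => i;
    apply: drvZ; exact: df.
have dP1 x : x \in `[a, b] ->
    is_derive x 1 P1 (\sum_i c i * ((q x - m i) * f i x)).
  move=> xi.
  by apply: (@drv_sum _ (fun i x => c i * f1 i x) (fun i x => c i * ((q x - m i) * f i x))) => i;
    apply: drvZ; exact: df1.
(* The antiderivatives of the products f i * f j, i <> j, are their Wronskians
   divided by m i - m j; they vanish at a and b, which is the orthogonality of
   the eigenfunctions.  G is therefore an antiderivative, vanishing at a and b,
   of the form of q - L plus the diagonal part S. *)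
pose K i j := if i == j then 0 else c i * c j * (m j - L) / (m i - m j).
pose W i j x := K i j * (f i x * f1 j x - f1 i x * f j x).
pose G x := P x * P1 x + \sum_i \sum_j W i j x.
pose S x := \sum_i c i ^+ 2 * (L - m i) * f i x ^+ 2.
have dW i j x : x \in `[a, b] ->
    is_derive x 1 (W i j) (K i j * ((m i - m j) * (f i x * f j x))).
  move=> xi; apply: drvZ; apply: (drv_eq (drvB (drvM (df i x xi) (df1 j x xi))
    (drvM (df1 i x xi) (df j x xi)))); ring.
have KE i j : K i j * (m i - m j) = (c i * c j * (m j - L)) *+ (i != j).
  rewrite /K; case: eqP => [->|/eqP ij]; first by rewrite mul0r mulr0n.
  by rewrite mulr1n mulfVK// subr_eq0 (inj_eq inj_m).
have dG x : x \in `[a, b] ->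
    is_derive x 1 G (P1 x ^+ 2 + (q x - L) * P x ^+ 2 + S x).
  move=> xi.
  have dWs : is_derive x 1 (fun y => \sum_i \sum_j W i j y)
      (\sum_i \sum_j K i j * ((m i - m j) * (f i x * f j x))).
    apply: (@drv_sum _ (fun i y => \sum_j W i j y)
      (fun i y => \sum_j K i j * ((m i - m j) * (f i y * f j y)))) => i.
    apply: (@drv_sum _ (W i) (fun j y => K i j * ((m i - m j) * (f i y * f j y)))) => j.
    exact: dW.
  apply: (drv_eq (drvD (drvM (dP x xi) (dP1 x xi)) dWs)).
  have PP : P x ^+ 2 = \sum_i \sum_j c i * f i x * (c j * f j x).
    by rewrite expr2 mulr_suml; apply: eq_bigr => i _; rewrite mulr_sumr.
  have PQ : P x * (\sum_i c i * ((q x - m i) * f i x)) =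
      \sum_i \sum_j c i * f i x * (c j * ((q x - m j) * f j x)).
    by rewrite mulr_suml; apply: eq_bigr => i _; rewrite mulr_sumr.
  rewrite PP PQ -expr2 -addrA -addrA; congr (_ + _).
  rewrite mulr_sumr -!big_split /=; apply: eq_bigr => i _.
  rewrite mulr_sumr -big_split/=.
  rewrite (bigD1 i)//= [X in _ = X + _](bigD1 i)//=.
  rewrite (eq_bigr (fun j => (q x - L) * (c i * f i x * (c j * f j x)))).
    have -> : K i i = 0 by rewrite /K eqxx.
    ring.
  move=> j ji; rewrite (mulrA (K i j)) KE eq_sym ji mulr1n; ring.
have [x0 x0i fx0] := fn i0.
have cS : continuous (S \o clamp a b).
  apply: cont_clamp; first exact: ltW.
  move=> x xi; apply: (@drv_continuous _ _ _ (\sum_i c i ^+ 2 * (L - m i) * (2 * f i x * f1 i x))).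
  apply: (@drv_sum _ (fun i x => c i ^+ 2 * (L - m i) * f i x ^+ 2)
    (fun i x => c i ^+ 2 * (L - m i) * (2 * f i x * f1 i x))) => i.
  by apply/drvZ/drv_sqr; exact: df.
have [H dH] := primitive cS.
have S0i i x : 0 <= c i ^+ 2 * (L - m i) * f i x ^+ 2.
  apply: mulr_ge0; last exact: sqr_ge0.
  by apply: mulr_ge0; [exact: sqr_ge0|rewrite subr_ge0 ltW].
have S0 x : 0 <= S x by apply: sumr_ge0 => i _; exact: S0i.
have : H a < H b.
  apply: (increase_pos ab cS dH _ x0i); first by move=> x _; exact: S0.
  rewrite /= clamp_id// /S (bigD1 i0)//= ltr_pwDl//; last first.
    by apply: sumr_ge0 => i _; exact: S0i.
  apply: mulr_gt0; last by rewrite exprn_even_gt0.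
  by apply: mulr_gt0; [rewrite exprn_even_gt0|rewrite subr_gt0].
suff : G a - H a <= G b - H b.
  have P0 y : y = a \/ y = b -> G y = 0.
    move=> yab; rewrite /G big1 => [|i _]; last first.
      apply: big1 => j _; rewrite /W.
      by case: yab => ->; rewrite ?fa ?fb; ring.
    rewrite /P big1 ?mul0r ?add0r// => i _.
    by case: yab => ->; rewrite ?fa ?fb mulr0.
  rewrite !P0; [lra|by right|by left].
apply: (coer P P1 (fun x => G x - H x)
   (fun x => P1 x ^+ 2 + (q x - L) * P x ^+ 2) dP).
- move=> x xi; apply: (drv_eq (drvB (dG x xi) (dH x))).
  by rewrite /= clamp_id// addrK.
- move=> x xi Zx.
  have [xa|xa] := eqVneq x a; first by rewrite /P big1// => i _; rewrite xa fa mulr0.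
  have [xb|xb] := eqVneq x b; first by rewrite /P big1// => i _; rewrite xb fb mulr0.
  have xz : x \in zs.
    apply: Zzs Zx; move: xi; rewrite !in_itv/= => /andP[ax xb'].
    by rewrite !lt_neqAle eq_sym xa xb ax.
  have xn : (index x zs < size zs)%N by rewrite index_mem.
  by have := cA (Ordinal xn); rewrite /= nth_index.
- by move=> x xi; exact: lexx.
Qed.

End Coercive.

(** * The Pruefer angle *)

Section Prufer.
Context {R : realType}.
Implicit Types (f g h p q : R -> R) (a b s t x y : R).

(** The sequences u n - 2 C / 2^n and u n + 2 C / 2^n are monotone and enclose
    the limit. *)
Lemma geometric_limit (u : nat -> R) (C : R) :
  (forall n, `|u n.+1 - u n| <= C / 2 ^+ n) ->
  exists l, forall n, `|l - u n| <= 2 * C / 2 ^+ n.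
Proof.
move=> hu; pose e n : R := 2 * C / 2 ^+ n.
have eS n : e n = C / 2 ^+ n + e n.+1.
  rewrite /e exprS; have : (2 : R) ^+ n != 0 by rewrite expf_neq0.
  by move=> h; field.
have e0 n : 0 <= e n.
  have C0 : 0 <= C by have := hu 0; rewrite expr0 divr1; apply: le_trans.
  by rewrite /e divr_ge0 ?exprn_ge0// mulr_ge0.
have hv n : u n - e n <= u n.+1 - e n.+1.
  by have := hu n; rewrite ler_norml eS => /andP[]; lra.
have hw n : u n.+1 + e n.+1 <= u n + e n.
  by have := hu n; rewrite ler_norml (eS n) => /andP[]; lra.
have vm : {homo (fun n => u n - e n) : n k / (n <= k)%N >-> n <= k}.
  by apply: homo_leq => //; exact: le_trans.
have wm n k : (n <= k)%N -> u k + e k <= u n + e n.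
  move=> nk; rewrite -(subnK nk); elim: (k - n)%N => [|i IH] //.
  by rewrite addSn; exact: le_trans (hw _) IH.
have vw n k : u n - e n <= u k + e k.
  case/orP: (leq_total n k) => [/vm/= h|/wm h].
    by have := e0 k; lra.
  by have := e0 n; lra.
pose S := range (fun n => u n - e n).
have supS : has_sup S.
  by split; [exists (u 0 - e 0); exists 0|exists (u 0 + e 0) => _ [n _ <-]].
exists (sup S) => n; rewrite ler_norml; apply/andP; split.
  have : u n - e n <= sup S by apply: sup_upper_bound => //; exists n.
  by rewrite /e; lra.
have : sup S <= u n + e n.
  by apply: sup_le_ub; [exact: (proj1 supS)|move=> _ [k _ <-]].
by rewrite /e; lra.
Qed.

Lemma compare_norm h h' g g' a x : a <= x ->
  (forall y, y \in `[a, x] -> is_derive y 1 h (h' y)) ->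
  (forall y, y \in `[a, x] -> is_derive y 1 g (g' y)) ->
  (forall y, y \in `[a, x] -> `|h' y| <= g' y) ->
  h a = 0 -> 0 <= g a -> `|h x| <= g x.
Proof.
move=> ax dh dg le ha ga; rewrite ler_norml; apply/andP; split.
  have : g a + h a <= g x + h x.
    apply: (@drv_monotone _ (fun y => g y + h y) (fun y => g' y + h' y)) => // y yi.
      exact: drvD (dg y yi) (dh y yi).
    by have := le y (subset_itv_oo_cc yi); rewrite ler_norml => /andP[]; lra.
  by rewrite ha; lra.
have : g a - h a <= g x - h x.
  apply: (@drv_monotone _ (fun y => g y - h y) (fun y => g' y - h' y)) => // y yi.
    exact: drvB (dg y yi) (dh y yi).
  by have := le y (subset_itv_oo_cc yi); rewrite ler_norml => /andP[]; lra.
by rewrite ha; lra.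
Qed.

Lemma cont_bounded h a b : continuous h -> a <= b ->
  exists2 C : R, 0 < C & forall x, x \in `[a, b] -> `|h x| <= C.
Proof.
move=> ch ab.
have cn : continuous (fun x => `|h x|).
  by move=> x; apply: (continuous_comp (ch x)); exact: norm_continuous.
have [c ci hc] := EVT_max ab (cont_within (fun x _ => cn x)).
exists (`|h c| + 1); first by rewrite ltr_pwDr.
by move=> x /hc; lra.
Qed.

(** Successive approximations; with the weight expR (2 L (x - a)) the map is a
    contraction of ratio 1/2 on the whole of [a, b]. *)
Lemma picard (f : R -> R -> R) (L a b : R) : a <= b -> 0 < L ->
  (forall x y z, x \in `[a, b] -> `|f x y - f x z| <= L * `|y - z|) ->
  (forall th, continuous th -> continuous (fun x => f x (th x))) ->
  exists th, th a = 0 /\ forall x, x \in `[a, b] -> is_derive x 1 th (f x (th x)).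
Proof.
move=> ab L0 lip cf.
have /choice[P hP] : forall h : R -> R, exists H : R -> R,
    continuous h -> (forall x, is_derive x 1 H (h x)) /\ H a = 0.
  move=> h; have [ch|nch] := pselect (continuous h); last by exists h.
  have [H dH] := primitive ch; exists (fun x => H x - H a) => _; split.
    by move=> x; apply: (drv_eq (drvB (dH x) (drv_cst _ _))); rewrite subr0.
  by rewrite subrr.
pose T th := P (fun x => f x (th x)).
have dT th : continuous th -> forall x, is_derive x 1 (T th) (f x (th x)).
  by move=> cth; have [] := hP _ (cf th cth).
have Ta th : continuous th -> T th a = 0 by move=> cth; have [] := hP _ (cf th cth).
have cT th : continuous th -> continuous (T th).
  by move=> cth x; exact: drv_continuous (dT th cth x).
pose u n := iter n T (fun=> 0).
have cu n : continuous (u n).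
  by elim: n => [|n IH]; [exact: cst_continuous|exact: cT].
have ua n : u n a = 0 by case: n => [//|n]; exact: Ta.
have [B B0 hB] := cont_bounded (cu 1) ab.
have sub x : x \in `[a, b] -> forall y, y \in `[a, x] -> y \in `[a, b].
  by rewrite in_itv/= => /andP[_ xb]; apply: subset_itvScc.
have ax x : x \in `[a, b] -> a <= x by rewrite in_itv/= => /andP[].
have step n x : x \in `[a, b] ->
    `|u n.+1 x - u n x| <= B / 2 ^+ n * expR (2 * L * (x - a)).
  elim: n x => [|n IH] x xi.
    rewrite subr0 expr0 divr1; apply: (le_trans (hB x xi)).
    rewrite ler_peMr//; first exact: ltW.
    rewrite -[leLHS]expR0 ler_expR mulr_ge0 ?subr_ge0 ?ax//.
    by rewrite mulr_ge0// ltW.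
  apply: (@compare_norm (fun x => u n.+2 x - u n.+1 x)
    (fun x => f x (u n.+1 x) - f x (u n x))
    (fun x => B / 2 ^+ n.+1 * expR (2 * L * (x - a)))
    (fun x => B / 2 ^+ n.+1 * (expR (2 * L * (x - a)) * (2 * L))) a x (ax x xi)).
  - move=> y _; exact: drvB (dT _ (cu n.+1) y) (dT _ (cu n) y).
  - move=> y _; apply/drvZ/drv_exp.
    by apply: (drv_eq (drvZ (2 * L) (drvB (drv_id y) (drv_cst a y)))); rewrite subr0 mulr1.
  - move=> y /(sub x xi) yi; apply: (le_trans (lip y _ _ yi)).
    have -> : B / 2 ^+ n.+1 * (expR (2 * L * (y - a)) * (2 * L)) =
       L * (B / 2 ^+ n * expR (2 * L * (y - a))).
      rewrite exprS; have : (2 : R) ^+ n != 0 by rewrite expf_neq0.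
      by move=> h; field.
    by rewrite ler_pM2l//; exact: IH.
  - by rewrite !ua subrr.
  - by rewrite mulr_ge0 ?expR_ge0// divr_ge0 ?exprn_ge0// ltW.
pose B' := B * expR (2 * L * (b - a)).
have step' x n : x \in `[a, b] -> `|u n.+1 x - u n x| <= B' / 2 ^+ n.
  move=> xi; apply: (le_trans (step n x xi)).
  rewrite /B' mulrAC ler_wpM2r ?invr_ge0 ?exprn_ge0// ler_pM2l// ler_expR.
  move: xi; rewrite in_itv/= => /andP[? ?]; nra.
have /choice[v hv] : forall x, exists l, x \in `[a, b] ->
    forall n, `|l - u n x| <= 2 * B' / 2 ^+ n.
  move=> x; have [xi|] := boolP (x \in `[a, b]); last by exists 0.
  by have [l hl] := geometric_limit (step' x ^~ xi); exists l.
have half (K e : R) : 0 < e -> exists n, K / 2 ^+ n < e.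
  move=> e0; have := @cvg_geometric R K (2^-1).
  rewrite ger0_norm ?invr_ge0// => /(_ (ltac:(lra))) /cvgrPdist_lt /(_ e e0)[n _ hn].
  exists n; have := hn n (leqnn n); rewrite /geometric/= sub0r normrN exprVn.
  by apply: le_lt_trans; exact: ler_norm.
have cv : continuous (v \o clamp a b).
  move=> x; apply/cvgrPdist_lt => e e0.
  have e3 : 0 < e / 3 by lra.
  have [n hn] := half (2 * B') _ e3.
  have cuc : continuous (u n \o clamp a b) by apply: cont_clamp => // y _; exact: cu.
  have /cvgrPdist_lt/(_ _ e3) := cuc x; apply: filterS => y /= uxy.
  have := hv _ (clamp_in x ab) n; have := hv _ (clamp_in y ab) n.
  move: uxy; rewrite !ltr_norml !ler_norml; lra.
have vE x : x \in `[a, b] -> T (v \o clamp a b) x = v x.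
  move=> xi; apply/eqP; rewrite -subr_eq0 -normr_le0; apply/ler_addgt0Pl => e e0.
  rewrite addr0.
  have [n hn] := half (2 * B' + L * (2 * B') * (x - a)) _ e0.
  have h1 : `|T (v \o clamp a b) x - u n.+1 x| <= L * (2 * B' / 2 ^+ n) * (x - a).
    apply: (@compare_norm (fun x => T (v \o clamp a b) x - u n.+1 x)
       (fun x => f x (v (clamp a b x)) - f x (u n x))
       (fun x => L * (2 * B' / 2 ^+ n) * (x - a))
       (fun x => L * (2 * B' / 2 ^+ n)) a x (ax x xi)).
    - move=> y _; exact: drvB (dT _ cv y) (dT _ (cu n) y).
    - move=> y _; apply: (drv_eq (drvZ (L * (2 * B' / 2 ^+ n)) (drvB (drv_id y) (drv_cst a y)))).
      by rewrite subr0 mulr1.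
    - move=> y /(sub x xi) yi; apply: (le_trans (lip y _ _ yi)).
      by rewrite ler_pM2l// clamp_id//; exact: hv.
    - by rewrite Ta// ua subrr.
    - by rewrite subrr mulr0.
  have h2 := hv x xi n.+1.
  have h3 : 2 * B' / 2 ^+ n.+1 <= 2 * B' / 2 ^+ n.
    rewrite exprS ler_pM2l; last by rewrite !mulr_gt0 ?expR_gt0.
    by rewrite lef_pV2 ?posrE ?mulr_gt0 ?exprn_gt0// ler_peMl ?exprn_ge0//; lra.
  have -> : T (v \o clamp a b) x - v x =
    (T (v \o clamp a b) x - u n.+1 x) - (v x - u n.+1 x) by ring.
  apply: (le_trans (ler_normB _ _)); apply: ltW; apply: le_lt_trans hn.
  have -> : (2 * B' + L * (2 * B') * (x - a)) / 2 ^+ n =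
     2 * B' / 2 ^+ n + L * (2 * B' / 2 ^+ n) * (x - a) by ring.
  by lra.
exists (T (v \o clamp a b)); split; first exact: Ta.
move=> x xi; apply: (drv_eq (dT _ cv x)).
by rewrite vE//= clamp_id.
Qed.


Lemma sign_near f (d x : R) : is_derive x 1 f d -> f x = 0 -> 0 < d ->
  exists2 e : R, 0 < e & forall y, `|y - x| < e ->
    (x < y -> 0 < f y) /\ (y < x -> f y < 0).
Proof.
move=> df fx d0; have [g [gE cg gx]] := (is_derive1_caratheodory f x d).1 df.
have gx0 : 0 < g x by rewrite gx.
have [e e0 he] := near_pos cg gx0; exists e => // y /he gy.
by have := gE y; rewrite fx subr0 => ->; split=> h; [rewrite pmulr_rgt0|rewrite pmulr_rlt0]; lra.
Qed.

(** A function with positive derivative at each of its zeros cannot return to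
    zero after it was nonnegative. *)
Lemma barrier f f' s t : (forall x, x \in `[s, t] -> is_derive x 1 f (f' x)) ->
  (forall x, x \in `[s, t] -> f x = 0 -> 0 < f' x) ->
  0 <= f s -> forall x, s < x -> x <= t -> 0 < f x.
Proof.
move=> df f0 fs x sx xt; rewrite ltNge; apply/negP => fx.
have cf y : y \in `[s, t] -> {for y, continuous f} by move=> yi; exact: drv_continuous (df y yi).
have xi : x \in `[s, t] by apply: in_cc => //; exact: ltW.
have [e e0 he] : exists2 e : R, 0 < e & forall y, `|y - x| < e -> y < x -> f y < 0.
  have [fx0|fx0] := eqVneq (f x) 0.
    have [e e0 he] := sign_near (df x xi) fx0 (f0 x xi fx0).
    by exists e => // y /he[].
  have fx' : 0 < - f x by rewrite oppr_gt0 lt_neqAle fx0.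
  have [e e0 he] := @near_pos _ (fun y => - f y) x (continuousN (cf x xi)) fx'.
  by exists e => // y /he; rewrite oppr_gt0.
pose E := [set y | s <= y /\ y < x /\ 0 <= f y].
have Es : E s by [].
have supE : has_sup E by split; [exists s|exists x => y [_ [/ltW]]].
set sg := sup E.
have ssg : s <= sg by exact: sup_upper_bound.
have sgx : sg <= x - e.
  apply: sup_le_ub; first by exists s.
  move=> y [sy [yx fy]]; rewrite leNgt; apply/negP => xey.
  have : f y < 0 by apply: he => //; rewrite ltr_norml; lra.
  by rewrite ltNge fy.
have sgi : sg \in `[s, t] by apply: in_cc; lra.
have neg y : sg < y -> y < x -> f y < 0.
  move=> sgy yx; rewrite ltNge; apply/negP => fy.
  by have : y <= sg; [apply: sup_upper_bound => //; split; lra|lra].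
have fsg0 : 0 <= f sg.
  rewrite leNgt -oppr_gt0; apply/negP => h.
  have [e' e'0 he'] := @near_pos _ (fun y => - f y) sg (continuousN (cf _ sgi)) h.
  have [y [sy [yx fy]] ye] := sup_adherent e'0 supE.
  have ysg : y <= sg by apply: sup_upper_bound.
  have : 0 < - f y by apply: he'; rewrite ltr_norml -/sg; rewrite -/sg in ye; lra.
  by rewrite oppr_gt0 ltNge fy.
have [fsg|fsg] := eqVneq (f sg) 0.
  have [e' e'0 he'] := sign_near (df _ sgi) fsg (f0 _ sgi fsg).
  have [m1 m2 m3] : [/\ 0 < Num.min e e', Num.min e e' <= e & Num.min e e' <= e'].
    by rewrite lt_min e0 e'0 !ge_min !lexx orbT.
  pose y := sg + Num.min e e' / 2.
  have y1 : sg < y by rewrite /y; lra.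
  have [|h _] := he' y; first by rewrite ltr_norml /y; lra.
  have : f y < 0 by apply: neg => //; rewrite /y; lra.
  by rewrite ltNge ltW// h.
have fsgp : 0 < f sg by rewrite lt_neqAle eq_sym fsg.
have [e' e'0 he'] := near_pos (cf _ sgi) fsgp.
have [m1 m2 m3] : [/\ 0 < Num.min e e', Num.min e e' <= e & Num.min e e' <= e'].
  by rewrite lt_min e0 e'0 !ge_min !lexx orbT.
pose y := sg + Num.min e e' / 2.
have : f y < 0 by apply: neg; rewrite /y; lra.
by rewrite ltNge ltW//; apply: he'; rewrite ltr_norml /y; lra.
Qed.

(** The equation of the angle theta in phi = r sin theta, phi' = r cos theta, for
    the equation phi'' = P phi. *)
Definition prufer P s t (th : R -> R) := forall x, x \in `[s, t] ->
  is_derive x 1 th (1 - (1 + P x) * sin (th x) ^+ 2).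

(** The angle passes n further multiples of pi on [s, t].  Allowing any initial
    angle at least k pi makes the property additive over adjacent intervals. *)
Definition osc P n s t := forall th k, prufer P s t th ->
  k%:R * pi <= th s -> (k + n)%:R * pi < th t.

Lemma sin2_shift (k : nat) x : sin (x - k%:R * pi) ^+ 2 = sin x ^+ 2.
Proof.
elim: k => [|k IH]; first by rewrite mul0r subr0.
have -> : x - k.+1%:R * pi = (x - k%:R * pi) - pi by rewrite -addn1 natrD; ring.
by rewrite sinB cospi sinpi mulr0 subr0 mulrN1 sqrrN.
Qed.

(** Multiples of pi are crossed upwards only, since theta' = 1 there. *)
Lemma prufer_barrier P s t th k x : prufer P s t th -> k%:R * pi <= th s ->
  s < x -> x <= t -> k%:R * pi < th x.
Proof.
move=> dth thk sx xt; rewrite -subr_gt0.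
apply: (@barrier (fun x => th x - k%:R * pi)
  (fun x => 1 - (1 + P x) * sin (th x) ^+ 2 - 0) s t) => //.
- by move=> y yi; exact: drvB (dth y yi) (drv_cst _ _).
- move=> y yi e; rewrite -(sin2_shift k) e sin0 expr0n mulr0; lra.
- by rewrite subr_ge0.
Qed.

Lemma prufer_sub P s t s' t' th : s <= s' -> t' <= t -> prufer P s t th ->
  prufer P s' t' th.
Proof. by move=> ss tt h x xi; apply: h; exact: subset_itvScc xi. Qed.

Lemma osc0 P s t : s < t -> osc P 0 s t.
Proof.
move=> st th k dth thk; rewrite addn0.
exact: (prufer_barrier dth thk st (lexx t)).
Qed.

Lemma osc_cat P s r t m n : s <= r -> r <= t ->
  osc P m s r -> osc P n r t -> osc P (m + n) s t.
Proof.
move=> sr rt o1 o2 th k dth thk; rewrite addnA; apply: o2.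
  exact: prufer_sub dth.
by apply/ltW/o1 => //; exact: prufer_sub dth.
Qed.

Lemma oscS P s t m n : (m <= n)%N -> osc P n s t -> osc P m s t.
Proof.
move=> mn o th k dth thk; apply: le_lt_trans (o th k dth thk).
by rewrite ler_wpM2r ?pi_ge0// ler_nat leq_add2l.
Qed.

(** If a solution of phi'' = P phi had no zero in [s, t] then w = phi' / phi
    would solve this Riccati equation. *)
Definition conjugate P s t := forall w : R -> R,
  (forall x, x \in `[s, t] -> is_derive x 1 w (P x - w x ^+ 2)) -> False.

(** Without a gain of a half turn on [s', t'], cot theta would be defined on it. *)
Lemma conjugate_osc P s s' t' t : s < s' -> s' < t' -> t' < t ->
  conjugate P s' t' -> osc P 1 s t.
Proof.
move=> ss st tt conj th k dth thk.
have s't : s' <= t by lra.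
have h1 := prufer_barrier dth thk ss s't.
suff h2 : (k + 1)%:R * pi <= th t'.
  have dth' : prufer P t' t th by apply: prufer_sub dth => //; lra.
  exact: (prufer_barrier dth' h2 tt (lexx t)).
rewrite leNgt; apply/negP => h2.
have dth' : prufer P s' t' th by apply: prufer_sub dth; lra.
pose z x := th x - k%:R * pi.
have dz x : x \in `[s', t'] -> is_derive x 1 z (1 - (1 + P x) * sin (z x) ^+ 2).
  by move=> xi; apply: (drv_eq (drvB (dth' x xi) (drv_cst _ _))); rewrite sin2_shift subr0.
have sz x : x \in `[s', t'] -> 0 < sin (z x).
  rewrite in_itv/= => /andP[sx xt]; apply: sin_gt0_pi; apply/andP; split.
    rewrite /z subr_gt0; have [e|sx'] := eqVneq s' x; first by rewrite -e.
    have sx'' : s' < x by rewrite lt_neqAle sx'.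
    exact: (prufer_barrier dth' (ltW h1) sx'' xt).
  rewrite /z ltrBlDl.
  have -> : k%:R * pi + pi = (k + 1)%:R * pi :> R by rewrite natrD; ring.
  have [->//|xt'] := eqVneq x t'.
  rewrite ltNge; apply/negP => h3.
  have dth2 : prufer P x t' th by apply: prufer_sub dth'.
  have xt2 : x < t' by rewrite lt_neqAle xt'.
  by have := prufer_barrier dth2 h3 xt2 (lexx t'); lra.
apply: (conj (fun x => cos (z x) / sin (z x))) => x xi.
have sn : sin (z x) != 0 by rewrite gt_eqF ?sz.
apply: (drv_eq (drvM (drv_cos (dz x xi)) (drvV (drv_sin (dz x xi)) sn))).
have c2 : cos (z x) ^+ 2 = 1 - sin (z x) ^+ 2 by rewrite cos2sin2.
set d := 1 - _; rewrite expr_div_n.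
have -> : - sin (z x) * d * (sin (z x))^-1 + cos (z x) *
    (- (cos (z x) * d) / sin (z x) ^+ 2) =
    - d * (1 + cos (z x) ^+ 2 / sin (z x) ^+ 2) by field.
by rewrite c2 /d; field.
Qed.

End Prufer.

(** * Shooting *)

Section Shooting.
Context {R : realType}.
Implicit Types (f g h p q P : R -> R) (a b s t x y : R).

Lemma sin2_lip y z : `|sin y ^+ 2 - sin z ^+ 2| <= 2 * `|y - z| :> R.
Proof.
wlog yz : y z / z <= y.
  move=> h; have [yz|/ltW yz] := leP z y; first exact: h.
  by rewrite distrC (distrC y); exact: h.
rewrite (ger0_norm (x := y - z)) ?subr_ge0//.
apply: (@compare_norm _ (fun y => sin y ^+ 2 - sin z ^+ 2)
  (fun y => 2 * sin y * (cos y * 1) - 0) (fun y => 2 * (y - z))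
  (fun y => 2 * (1 - 0)) z y yz).
- by move=> x _; exact: drvB (drv_sqr (drv_sin (drv_id x))) (drv_cst _ _).
- move=> x _; rewrite mulr1 !subr0 mulr1 normrM normrM (ger0_norm (x := 2))//.
  rewrite -[leRHS]mulr1 -mulrA ler_pM2l//.
  have s1 : `|sin x| <= 1 by rewrite ler_norml sin_geN1 sin_le1.
  have c1 : `|cos x| <= 1 by rewrite ler_norml cos_geN1 cos_le1.
  by rewrite -[leRHS]mulr1 ler_pM.
- by rewrite subrr.
- by rewrite subrr mulr0.
Qed.

Lemma prufer_solution P a b : a <= b -> continuous P ->
  exists th, th a = 0 /\ prufer P a b th.
Proof.
move=> ab cP.
have cP1 : continuous (fun x => 1 + P x).
  by move=> x; apply: cvgD; [exact: cvg_cst|exact: cP].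
have [C C0 hC] := cont_bounded cP1 ab.
apply: (@picard _ (fun x y => 1 - (1 + P x) * sin y ^+ 2) (2 * C)) => //.
- by lra.
- move=> x y z xi; have := hC x xi; have := sin2_lip y z.
  have -> : 1 - (1 + P x) * sin y ^+ 2 - (1 - (1 + P x) * sin z ^+ 2) =
    - ((1 + P x) * (sin y ^+ 2 - sin z ^+ 2)) by ring.
  rewrite normrN normrM => h1 h2.
  by rewrite (mulrC 2) -mulrA ler_pM.
- move=> th cth x; apply: cvgB; first exact: cvg_cst.
  apply: cvgM; first exact: cP1.
  have cs : {for x, continuous (fun x => sin (th x))}.
    by apply: (continuous_comp (cth x)); exact: continuous_sin.
  by rewrite expr2; under eq_fun do rewrite expr2; apply: cvgM.
Qed.

(** Gronwall's argument for (th1 - th2)^2. *)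
Lemma prufer_close P (d C a b : R) th1 th2 : a <= b -> 0 < C ->
  (forall x, x \in `[a, b] -> `|1 + P x| <= C) ->
  prufer P a b th1 -> prufer (fun x => P x + d) a b th2 -> th1 a = th2 a ->
  `|th1 b - th2 b| <= `|d| * expR ((4 * C + 1) * (b - a)).
Proof.
move=> ab C0 hC d1 d2 e.
pose k := 4 * C + 1; pose M := expR (k * (b - a)).
pose E x := (th1 x - th2 x) ^+ 2 + d ^+ 2.
pose r x := (1 - (1 + P x) * sin (th1 x) ^+ 2) - (1 - (1 + (P x + d)) * sin (th2 x) ^+ 2).
have dE x : x \in `[a, b] -> is_derive x 1 E (2 * (th1 x - th2 x) * r x + 0).
  by move=> xi; exact: drvD (drv_sqr (drvB (d1 x xi) (d2 x xi))) (drv_cst _ _).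
have rE x : x \in `[a, b] -> 2 * (th1 x - th2 x) * r x + 0 <= k * E x.
  move=> xi; have -> : r x = - ((1 + P x) * (sin (th1 x) ^+ 2 - sin (th2 x) ^+ 2))
     + d * sin (th2 x) ^+ 2 by rewrite /r; ring.
  set D := th1 x - th2 x; set u := (1 + P x) * _; set v := d * _.
  have hu : `|u| <= C * (2 * `|D|).
    by rewrite normrM; apply: ler_pM => //; [exact: hC|exact: sin2_lip].
  have hv : `|v| <= `|d|.
    have s2 : sin (th2 x) ^+ 2 <= 1.
      by have := sqr_ge0 (cos (th2 x)); rewrite cos2sin2; lra.
    by rewrite normrM (ger0_norm (sqr_ge0 _)) ler_piMr.
  have h3 : 2 * D * (- u + v) <= 2 * `|D| * (C * (2 * `|D|) + `|d|).
    apply: (le_trans (ler_norm _)); rewrite normrM normrM (ger0_norm (x := 2))//.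
    apply: ler_wpM2l; first by rewrite mulr_ge0.
    by apply: (le_trans (ler_normD _ _)); rewrite normrN; lra.
  rewrite addr0; apply: (le_trans h3); rewrite /E /k.
  have D2 : D ^+ 2 = `|D| ^+ 2 by rewrite real_normK ?num_real.
  have d2' : d ^+ 2 = `|d| ^+ 2 by rewrite real_normK ?num_real.
  rewrite -/D D2 d2'; move: `|D| `|d| (normr_ge0 D) (normr_ge0 d) => X Y X0 Y0.
  have := sqr_ge0 (X - Y); have := mulr_ge0 (ltW C0) (sqr_ge0 Y).
  by rewrite !expr2; lra.
have : expR (- k * (b - a)) * E b <= expR (- k * (a - a)) * E a.
  rewrite -lerN2.
  pose G x := - (expR (- k * (x - a)) * E x).
  pose G1 x := - ((expR (- k * (x - a)) * (- k * (1 - 0))) * E x +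
    expR (- k * (x - a)) * (2 * (th1 x - th2 x) * r x + 0)).
  have dG x : x \in `[a, b] -> is_derive x 1 G (G1 x).
    move=> xi; exact: drvN (drvM (drv_exp (drvZ (- k) (drvB (drv_id x) (drv_cst a x)))) (dE x xi)).
  apply: (drv_monotone ab dG) => x /subset_itv_oo_cc xi; have := rE x xi.
  rewrite /G1.
  have := expR_gt0 (- k * (x - a)); set X := expR _; set Y := _ + 0; set Z := E x.
  move=> X0 h; rewrite oppr_ge0.
  have -> : X * (- k * (1 - 0)) * Z + X * Y = X * (Y - k * Z) by ring.
  by rewrite pmulr_rle0//; lra.
rewrite subrr mulr0 expR0 mul1r /E e subrr expr0n add0r => h.
have M0 : 0 < M by exact: expR_gt0.
have M1 : 1 <= M.
  rewrite /M -[leLHS]expR0 ler_expR mulr_ge0 ?subr_ge0//; rewrite /k; lra.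
have MV : expR (- k * (b - a)) = M^-1 by rewrite mulNr expRN.
have h2 : (th1 b - th2 b) ^+ 2 <= (`|d| * M) ^+ 2.
  move: h; rewrite MV mulrC ler_pdivrMr// exprMn real_normK ?num_real//.
  set A := _ ^+ 2; set B := d ^+ 2.
  have B0 : 0 <= B by exact: sqr_ge0.
  have M2 : M <= M ^+ 2 by rewrite expr2 ler_peMl// ltW.
  by have := ler_wpM2l B0 M2; lra.
rewrite -ler_sqr ?nnegrE ?normr_ge0//.
by rewrite real_normK ?num_real.
Qed.

(** The amplitude r solves r' = r (1 + q - l) sin theta cos theta. *)
Lemma prufer_eigenfunction q l a b th (k : nat) : a < b -> continuous q ->
  prufer (fun x => q x - l) a b th -> th a = 0 -> th b = k%:R * pi ->
  exists phi phi1, eigenfunction a b q l phi phi1.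
Proof.
move=> ab cq dth tha thb.
have cth x : x \in `[a, b] -> {for x, continuous th}.
  by move=> xi; exact: drv_continuous (dth x xi).
pose rho x := (1 + (q x - l)) * (sin (th x) * cos (th x)).
have crho : continuous (rho \o clamp a b).
  apply: cont_clamp; first exact: ltW.
  move=> x xi; apply: cvgM.
    by apply: cvgD; [exact: cvg_cst|apply: cvgB; [exact: cq|exact: cvg_cst]].
  apply: cvgM; apply: (continuous_comp (cth x xi)).
    exact: continuous_sin.
  exact: continuous_cos.
have [S dS] := primitive crho.
pose r x := expR (S x).
have dr x : x \in `[a, b] -> is_derive x 1 r (r x * rho x).
  by move=> xi; apply: (drv_eq (drv_exp (dS x))); rewrite /= clamp_id.
pose phi x := r x * sin (th x); pose phi1 x := r x * cos (th x).
have sc x : cos (th x) ^+ 2 = 1 - sin (th x) ^+ 2 by rewrite cos2sin2.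
have dphi x : x \in `[a, b] -> is_derive x 1 phi (phi1 x).
  move=> xi; apply: (drv_eq (drvM (dr x xi) (drv_sin (dth x xi)))).
  by rewrite /phi1 /rho; ring.
have sk : sin (th b) = 0.
  apply/eqP; rewrite -sqrf_eq0 -(sin2_shift k) thb subrr sin0 expr0n//.
have [ai bi] : a \in `[a, b] /\ b \in `[a, b] by rewrite !in_itv/= !lexx ltW.
exists phi, phi1; split=> //.
- move=> x xi; apply: (drv_eq (drvM (dr x xi) (drv_cos (dth x xi)))).
  rewrite /phi /rho; transitivity (r x * sin (th x) * ((1 + (q x - l)) *
    (cos (th x) ^+ 2 + sin (th x) ^+ 2) - 1)); first by ring.
  by rewrite sc; ring.
- by rewrite /phi tha sin0 mulr0.
- by rewrite /phi sk mulr0.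
- have pa : phi a = 0 by rewrite /phi tha sin0 mulr0.
  have p1a : 0 < phi1 a by rewrite /phi1 tha cos0 mulr1 expR_gt0.
  have [e e0 he] := sign_near (dphi a ai) pa p1a.
  have [m1 m2 m3] : [/\ 0 < Num.min e (b - a), Num.min e (b - a) <= e & Num.min e (b - a) <= b - a].
    by rewrite lt_min e0 subr_gt0 ab !ge_min !lexx orbT.
  exists (a + Num.min e (b - a) / 2); first by rewrite in_itv/=; lra.
  have [|h _] := he (a + Num.min e (b - a) / 2).
    by rewrite ltr_norml; lra.
  by rewrite gt_eqF// h//; lra.
Qed.

(** For l below the infimum of q the angle cannot pass pi / 2, and at l0 it
    exceeds n pi; the values pi, ..., n pi are attained in between, at distinct
    parameters. *)
Lemma eigenvalues_of_osc q l0 n a b : a < b -> continuous q ->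
  osc (fun x => q x - l0) n a b ->
  exists m : 'I_n -> R, injective m /\ forall i, m i <= l0 /\
    exists phi phi1, eigenfunction a b q (m i) phi phi1.
Proof.
move=> ab cq ho; have ab' := ltW ab.
have cql l : continuous (fun x => q x - l).
  by move=> x; apply: cvgB; [exact: cq|exact: cvg_cst].
have /choice[Th hTh] := fun l => prufer_solution ab' (cql l).
have [C C0 hC] := cont_bounded cq ab'.
pose l1 := Num.min (- C - 1) l0.
have [l1C l10] : l1 <= - C - 1 /\ l1 <= l0 by rewrite /l1 !ge_min !lexx orbT.
have low : Th l1 b < pi / 2.
  have [Ta dT] := hTh l1; rewrite -subr_gt0.
  pose f x := pi / 2 - Th l1 x.
  pose f1 x := 0 - (1 - (1 + (q x - l1)) * sin (Th l1 x) ^+ 2).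
  have df x : x \in `[a, b] -> is_derive x 1 f (f1 x).
    by move=> xi; exact: drvB (drv_cst _ _) (dT x xi).
  apply: (barrier df _ _ ab (lexx b)); rewrite /f /f1.
  - move=> x xi e; have -> : Th l1 x = pi / 2 by lra.
    have := hC x xi; rewrite sin_pihalf expr1n mulr1 ler_norml => /andP[]; lra.
  - by rewrite Ta subr0 divr_ge0 ?pi_ge0.
have high : n%:R * pi < Th l0 b.
  by have [Ta dT] := hTh l0; have := ho _ 0 dT; rewrite Ta mul0r lexx; apply.
have cTh : continuous (fun l => Th l b).
  move=> l; have cl : continuous (fun x => 1 + (q x - l)).
    by move=> x; apply: cvgD; [exact: cvg_cst|exact: cql].
  have [C' C'0 hC'] := cont_bounded cl ab'.
  apply/cvgrPdist_lt => e e0.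
  pose M := expR ((4 * C' + 1) * (b - a)).
  have M0 : 0 < M by exact: expR_gt0.
  have eM : 0 < e / M by rewrite divr_gt0.
  near=> l'.
  have ll : `|l - l'| < e / M by near: l'; exact: (nbhsx_ballx l _ eM).
  have [Ta dT] := hTh l; have [Ta' dT'] := hTh l'.
  have dT2 : prufer (fun x => (q x - l) + (l - l')) a b (Th l').
    by move=> x xi; apply: (drv_eq (dT' x xi)); ring.
  have := prufer_close ab' C'0 hC' dT dT2; rewrite Ta Ta' => /(_ erefl).
  by move=> /le_lt_trans; apply; rewrite -/M -ltr_pdivlMr.
have /choice[m hm] : forall i : 'I_n, exists l, l <= l0 /\ Th l b = i.+1%:R * pi.
  move=> i; have [||l li e] := @IVT _ (fun l => Th l b) l1 l0 (i.+1%:R * pi) l10.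
  - exact: cont_within (fun x _ => cTh x).
  - have p0 := @pi_gt0 R.
    have i1 : pi <= i.+1%:R * pi :> R by rewrite ler_peMl ?pi_ge0// ler1n.
    have i2 : i.+1%:R * pi <= n%:R * pi :> R.
      by rewrite ler_wpM2r ?pi_ge0// ler_nat.
    by rewrite ge_min le_max; apply/andP; split; apply/orP; [left|right]; lra.
  - by exists l; split=> //; move: li; rewrite in_itv/= => /andP[].
exists m; split.
  move=> i j mij; have [_ ei] := hm i; have [_ ej] := hm j.
  apply: val_inj; apply: (@succn_inj).
  have : i.+1%:R * pi = j.+1%:R * pi :> R by rewrite -ei -ej mij.
  by move/(mulIf (lt0r_neq0 (pi_gt0 R)))/eqP; rewrite eqr_nat => /eqP.
move=> i; have [le e] := hm i; split=> //.
have [Ta dT] := hTh (m i).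
exact: (prufer_eigenfunction ab cq dT Ta e).
Unshelve. all: by end_near. Qed.

End Shooting.

(** * The n-th eigenvalue *)

Section Nth.
Context {R : realType}.
Implicit Types (q : R -> R) (a b l : R) (A : set R).

Lemma card_inj A n : (A #= `I_n)%card ->
  exists m : 'I_n -> R, injective m /\ forall i, A (m i).
Proof.
rewrite card_eq_sym => /card_set_bijP[f [fA fi _]].
exists (fun i => f i); split=> [i j fij|i].
  by apply/val_inj/fi => //; rewrite inE/=.
by apply: fA => /=.
Qed.

Lemma inj_card A n k : (A #= `I_n)%card -> forall m : 'I_k -> R, injective m ->
  (forall i, A (m i)) -> (k <= n)%N.
Proof.
move=> + m mi mA; rewrite card_eq_sym => /card_set_bijP[f [_ _ fs]].
have sub : {subset [seq m i | i <- enum 'I_k] <= [seq f i | i <- iota 0 n]}.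
  move=> _ /mapP[i _ ->]; have [j /= jn <-] := fs _ (mA i).
  by apply: map_f; rewrite mem_iota.
have := uniq_leq_size _ sub; rewrite size_map -cardE card_ord size_map size_iota; apply.
by rewrite map_inj_uniq// enum_uniq.
Qed.

Lemma sorted_card A n : finite_set A ->
  (exists m : 'I_n.+1 -> R, injective m /\ forall i, A (m i)) ->
  exists2 l, A l & ([set x | A x /\ x <= l] #= `I_n.+1)%card.
Proof.
move=> fA [m [mi mA]].
(* The wells are disjoint once the minima are listed in increasing order. *)
pose s := sort <=%R (fset_set A).
have ss : sorted <%R s.
  by rewrite sort_lt_sorted fset_uniq.
have us : uniq s by rewrite sort_uniq fset_uniq.
have As x : (x \in s) = (x \in A) by rewrite mem_sort in_fset_set.
have ns : (n < size s)%N.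
  have sub : {subset [seq m i | i <- enum 'I_n.+1] <= s}.
    by move=> _ /mapP[i _ ->]; rewrite As mem_set.
  have := uniq_leq_size _ sub; rewrite size_map -cardE card_ord; apply.
  by rewrite map_inj_uniq// enum_uniq.
exists s`_n; first by have := mem_nth 0 ns; rewrite As => /set_mem.
rewrite card_eq_sym; apply/card_set_bijP; exists (fun i => s`_i); split.
- move=> i /=; rewrite ltnS => ile; have is_ : (i < size s)%N by exact: leq_ltn_trans ns.
  split; first by have := mem_nth 0 is_; rewrite As => /set_mem.
  by rewrite (lt_sorted_leq_nth 0 ss).
- move=> i j; rewrite !inE/= !ltnS => ii jj /eqP.
  rewrite nth_uniq//; [by move/eqP|exact: leq_ltn_trans ns|exact: leq_ltn_trans ns].
- move=> x [/mem_set + xl]; rewrite -As => xs.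
  exists (index x s); last by rewrite nth_index.
  rewrite /= ltnS -(lt_sorted_leq_nth 0 ss) ?inE ?index_mem//.
  by rewrite nth_index.
Qed.

(** When there is no n-th eigenvalue the default value 0 satisfies the bound,
    whence the condition l <= 0. *)
Lemma nth_eigenvalue_ge a b q n l : l <= 0 ->
  (forall m : 'I_n -> R, injective m ->
    (forall i, dirichlet_eigenvalue a b q (m i)) -> exists i, l <= m i) ->
  l <= nth_eigenvalue a b q n.
Proof.
move=> l0 h; rewrite /nth_eigenvalue; case: xgetP => [x _ [_ /card_inj[m [mi mA]]]|_//].
have [|i li] := h m mi; first by move=> i; have [] := mA i.
by apply: le_trans li _; have [] := mA i.
Qed.

Lemma nth_eigenvalue_le a b q n l :
  finite_set [set x | dirichlet_eigenvalue a b q x /\ x <= l] ->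
  (exists m : 'I_n.+1 -> R, injective m /\
    forall i, m i <= l /\ dirichlet_eigenvalue a b q (m i)) ->
  nth_eigenvalue a b q n.+1 <= l.
Proof.
move=> fin [m [mi mE]].
have [|x [xE xl] cx] := sorted_card fin (n := n).
  by exists m; split=> // i; have [] := mE i.
have cx' : ([set y | dirichlet_eigenvalue a b q y /\ y <= x] #= `I_n.+1)%card.
  suff -> : [set y | dirichlet_eigenvalue a b q y /\ y <= x] =
    [set y | [set z | dirichlet_eigenvalue a b q z /\ z <= l] y /\ y <= x] by [].
  apply/seteqP; split=> y /=; last by move=> [[yE _] yx].
  by move=> [yE yx]; split=> //; split=> //; exact: le_trans xl.
rewrite /nth_eigenvalue; case: xgetP => [z _ [zE cz]|/(_ x)[]//].
rewrite leNgt; apply/negP => lz.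
pose m' (i : 'I_n.+2) := if unlift ord0 i is Some j then m j else z.
have mz j : m j != z by have [mj _] := mE j; rewrite lt_eqF// (le_lt_trans mj).
have := inj_card cz (m := m'); rewrite ltnn => h; have : false; last by [].
apply: h => [i j|i]; rewrite /m'.
  case: unliftP => [i'|] ->; case: unliftP => [j'|] -> //.
  - by move/mi ->.
  - by move=> e; have := mz i'; rewrite e eqxx.
  - by move=> e; have := mz j'; rewrite e eqxx.
case: unliftP => [j|] _ /=; last by rewrite lexx.
have [mj ?] := mE j; split=> //; exact/ltW/(le_lt_trans mj).
Qed.

End Nth.

(** * Hardy inequalities *)

Section Hardy.
Context {R : realType}.
Implicit Types (f g h p q w : R -> R) (a b s t x y : R) (Z : set R).

Lemma coercive_point s Z p : coercive s s Z p.
Proof. by []. Qed.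

Lemma coercive_nonneg s t Z p : s <= t ->
  (forall x, x \in `[s, t] -> 0 <= p x) -> coercive s t Z p.
Proof.
move=> st p0 phi phi1 G G1 dphi dG _ le; apply: (drv_monotone st dG) => x /subset_itv_oo_cc xi.
by apply: le_trans (le x xi); rewrite addr_ge0 ?sqr_ge0// mulr_ge0 ?sqr_ge0// p0.
Qed.

Lemma opp_itv s t x : (- x \in `[s, t]) = (x \in `[- t, - s]).
Proof. by rewrite !in_itv/= lerNr lerNl andbC. Qed.

Lemma drv_reflect f x (d : R) : is_derive (- x) 1 f d ->
  is_derive x 1 (fun y => f (- y)) (- d).
Proof.
move=> df; rewrite -mulrN1.
exact: (@drv_comp _ f (fun y => - y) x d (- 1) df (drvN (drv_id x))).
Qed.

Lemma coercive_opp s t Z p :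
  coercive (- t) (- s) [set x | Z (- x)] (fun x => p (- x)) -> coercive s t Z p.
Proof.
move=> c phi phi1 G G1 dphi dG z le; rewrite -lerN2.
have dphi' x : x \in `[- t, - s] -> is_derive x 1 (fun x => phi (- x)) (- phi1 (- x)).
  by rewrite -opp_itv => xi; exact: drv_reflect (dphi _ xi).
have dG' x : x \in `[- t, - s] -> is_derive x 1 (fun x => - G (- x)) (G1 (- x)).
  by rewrite -opp_itv => xi; apply: (drv_eq (drvN (drv_reflect (dG _ xi)))); rewrite opprK.
have z' x : x \in `[- t, - s] -> Z (- x) -> phi (- x) = 0.
  by rewrite -opp_itv => xi; exact: z.
have le' x : x \in `[- t, - s] ->
    (- phi1 (- x)) ^+ 2 + p (- x) * phi (- x) ^+ 2 <= G1 (- x).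
  by rewrite -opp_itv => xi; rewrite sqrrN; exact: le.
by have := c _ _ _ _ dphi' dG' z' le'; rewrite !opprK.
Qed.

(** The derivative of the difference is at least (phi' - w phi)^2 >= 0. *)
Lemma riccati_le s t p w w1 (phi phi1 G G1 : R -> R) : s <= t ->
  (forall x, x \in `]s, t[ -> is_derive x 1 w (w1 x)) ->
  (forall x, x \in `[s, t] -> {for x, continuous w}) ->
  (forall x, x \in `]s, t[ -> w1 x + w x ^+ 2 <= p x) ->
  (forall x, x \in `[s, t] -> is_derive x 1 phi (phi1 x)) ->
  (forall x, x \in `[s, t] -> is_derive x 1 G (G1 x)) ->
  (forall x, x \in `[s, t] -> phi1 x ^+ 2 + p x * phi x ^+ 2 <= G1 x) ->
  G s - w s * phi s ^+ 2 <= G t - w t * phi t ^+ 2.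
Proof.
move=> st dw cw wp dphi dG le.
pose F x := G x - w x * phi x ^+ 2.
pose F1 x := G1 x - (w1 x * phi x ^+ 2 + w x * (2 * phi x * phi1 x)).
have cF x : x \in `[s, t] -> {for x, continuous F}.
  move=> xi; apply: cvgB; first exact: drv_continuous (dG x xi).
  by apply: cvgM; [exact: cw|exact: drv_continuous (drv_sqr (dphi x xi))].
have dF x : x \in `]s, t[ -> is_derive x 1 F (F1 x).
  move=> xi; have xi' := subset_itv_oo_cc xi.
  exact: drvB (dG x xi') (drvM (dw x xi) (drv_sqr (dphi x xi'))).
apply: (drv_monotone_open st (cont_within cF) dF) => x xi; have xi' := subset_itv_oo_cc xi.
have h1 := le x xi'.
have h2 := ler_wpM2r (sqr_ge0 (phi x)) (wp x xi).
have h3 := sqr_ge0 (phi1 x - w x * phi x).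
rewrite /F1; have : (phi1 x - w x * phi x) ^+ 2 =
  phi1 x ^+ 2 - w x * (2 * phi x * phi1 x) + w x ^+ 2 * phi x ^+ 2 by ring.
by move: h2; rewrite mulrDl; lra.
Qed.

(** Since phi (y) = O(y - x) and w <= 1 / (2 (y - x)), the boundary term
    w phi^2 tends to 0 at x. *)
Lemma boundary_le x t w (phi G : R -> R) (d C : R) : x < t ->
  is_derive x 1 phi d -> phi x = 0 -> {for x, continuous G} ->
  (forall y, x < y -> y <= t -> w y <= (2 * (y - x))^-1) ->
  (forall y, x < y -> y <= t -> G y - w y * phi y ^+ 2 <= C) -> G x <= C.
Proof.
move=> xt dphi phix cG hw hG; rewrite leNgt; apply/negP => CG.
have [g [gE cg _]] := (is_derive1_caratheodory phi x _).1 dphi.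
pose M := `|g x| + 1; have Mp : 0 < M by rewrite /M ltr_wpDl.
have cM : {for x, continuous (fun y => M - `|g y|)}.
  apply: cvgB; first exact: cvg_cst.
  by apply: (continuous_comp cg); exact: norm_continuous.
have M0 : 0 < M - `|g x| by rewrite /M addrC addKr.
have [e1 e10 he1] := near_pos cM M0.
pose eta := (G x - C) / 2; have eta0 : 0 < eta by rewrite divr_gt0// subr_gt0.
have cG' : {for x, continuous (fun y => G y - C - eta)}.
  apply: cvgB; last exact: cvg_cst.
  by apply: cvgB; [exact: cG|exact: cvg_cst].
have G0 : 0 < G x - C - eta by rewrite /eta; lra.
have [e2 e20 he2] := near_pos cG' G0.
pose r := Num.min (Num.min (e1 / 2) (e2 / 2)) (Num.min (t - x) (eta / M ^+ 2)).
have r0 : 0 < r.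
  have e3 : 0 < eta / M ^+ 2 by rewrite divr_gt0 ?exprn_gt0.
  by rewrite !lt_min e3 subr_gt0 xt !divr_gt0.
have r1 : r <= e1 / 2 by rewrite /r !ge_min lexx.
have r2 : r <= e2 / 2 by rewrite /r !ge_min lexx orbT.
have r3 : r <= t - x by rewrite /r !ge_min lexx !orbT.
have r4 : r <= eta / M ^+ 2 by rewrite /r !ge_min lexx !orbT.
have xr : x < x + r by rewrite ltrDl.
have rt : x + r <= t by rewrite addrC -lerBrDr.
have xrx : x + r - x = r by rewrite addrC addKr.
have h1 : C + eta < G (x + r).
  have := he2 (x + r); rewrite xrx gtr0_norm// => /(_ ltac:(lra)).
  by clear; lra.
have h2 : `|g (x + r)| <= M.
  have := he1 (x + r); rewrite xrx gtr0_norm// => /(_ ltac:(lra)).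
  by rewrite subr_gt0 => /ltW.
have pE : phi (x + r) = g (x + r) * r by have := gE (x + r); rewrite phix subr0 xrx.
have p2 : phi (x + r) ^+ 2 <= M ^+ 2 * r ^+ 2.
  rewrite pE exprMn ler_wpM2r ?sqr_ge0//.
  by rewrite -(real_normK (num_real (g (x + r)))) lerXn2r ?nnegrE// ltW.
have h3 : w (x + r) * phi (x + r) ^+ 2 <= eta.
  apply: (@le_trans _ _ ((2 * r)^-1 * (M ^+ 2 * r ^+ 2))).
    apply: (@le_trans _ _ ((2 * r)^-1 * phi (x + r) ^+ 2)).
      by rewrite ler_wpM2r ?sqr_ge0// -[in leRHS]xrx hw.
    by apply: ler_wpM2l p2; rewrite invr_ge0 mulr_ge0// ltW.
  have -> : (2 * r)^-1 * (M ^+ 2 * r ^+ 2) = r * M ^+ 2 / 2 by field; rewrite gt_eqF.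
  by move: r4; rewrite ler_pdivlMr ?exprn_gt0//; move: eta0; clear; lra.
by have := hG _ xr rt; move: h1 h3; clear; lra.
Qed.

(** w is the logarithmic derivative of sqrt d (1 - K d), d = y - x.  It satisfies
    w' + w^2 = - 1 / (4 d^2) - K / (d (1 - K d)), and it is nonnegative as long as
    K d <= 1 / 3. *)
Lemma hardy_right x t p (K : R) : x < t -> 0 <= K -> K * (t - x) <= 1 / 3 ->
  (forall y, x < y -> y <= t -> - (4 * (y - x) ^+ 2)^-1 - K / (y - x) <= p y) ->
  coercive x t [set x] p.
Proof.
move=> xt K0 Kt hp phi phi1 G G1 dphi dG z le.
pose w y := (2 * (y - x))^-1 - K / (1 - K * (y - x)).
pose w1 y := - (2 * 1) / (2 * (y - x)) ^+ 2 -
  K * (- (0 - K * 1) / (1 - K * (y - x)) ^+ 2).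
have xi : x \in `[x, t] by apply: in_cc => //; exact: ltW.
have phix : phi x = 0 by exact: z.
have Kd y : x < y -> y <= t -> 0 < y - x /\ K * (y - x) <= 1 / 3.
  by move=> xy yt; split; [lra|apply: le_trans Kt; apply: ler_wpM2l => //; lra].
have dd y : is_derive y 1 (fun y => y - x) 1.
  by apply: (drv_eq (drvB (drv_id y) (drv_cst x y))); rewrite subr0.
have dw y : x < y -> y <= t -> is_derive y 1 w (w1 y).
  move=> xy yt; have [d0 Kd1] := Kd y xy yt.
  have n1 : 2 * (y - x) != 0 by rewrite mulf_neq0// gt_eqF.
  have n2 : 1 - K * (y - x) != 0 by rewrite gt_eqF//; lra.
  have h1 := drvV (drvZ 2 (dd y)) n1.
  have h2 := drvV (drvB (drv_cst 1 y) (drvZ K (dd y))) n2.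
  exact: drvB h1 (drvZ K h2).
have wp y : x < y -> y <= t -> w1 y + w y ^+ 2 <= p y.
  move=> xy yt; have [d0 Kd1] := Kd y xy yt.
  apply: le_trans (hp y xy yt).
  have n2 : 0 < 1 - K * (y - x) by lra.
  have -> : w1 y + w y ^+ 2 = - (4 * (y - x) ^+ 2)^-1 - K / (y - x) / (1 - K * (y - x)).
    by rewrite /w1 /w; field; rewrite !gt_eqF.
  rewrite lerD2l lerN2 ler_pdivlMr// ler_piMr//; last by rewrite gerBl mulr_ge0// ltW.
  by rewrite divr_ge0// ltW.
have wt : 0 <= w t.
  have [d0 Kd1] := Kd t xt (lexx t).
  have n2 : 0 < 1 - K * (t - x) by lra.
  rewrite /w subr_ge0 ler_pdivrMr// mulrC ler_pdivlMr; last by lra.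
  by lra.
have step y : x < y -> y <= t -> G y - w y * phi y ^+ 2 <= G t.
  move=> xy yt; apply: (@le_trans _ _ (G t - w t * phi t ^+ 2)); last first.
    by rewrite gerBl mulr_ge0// sqr_ge0.
  have sub z0 : z0 \in `[y, t] -> [/\ x < z0, z0 <= t & z0 \in `[x, t]].
    rewrite in_itv/= => /andP[yz zt]; have xz := lt_le_trans xy yz.
    by split=> //; apply: in_cc => //; exact: ltW.
  have dw' z0 : z0 \in `]y, t[ -> is_derive z0 1 w (w1 z0).
    by move=> /subset_itv_oo_cc /sub[? ? _]; exact: dw.
  have cw' z0 : z0 \in `[y, t] -> {for z0, continuous w}.
    by move=> /sub[h1 h2 _]; exact: drv_continuous (dw z0 h1 h2).
  have wp' z0 : z0 \in `]y, t[ -> w1 z0 + w z0 ^+ 2 <= p z0.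
    by move=> /subset_itv_oo_cc /sub[? ? _]; exact: wp.
  have dphi' z0 : z0 \in `[y, t] -> is_derive z0 1 phi (phi1 z0).
    by move=> /sub[_ _ ?]; exact: dphi.
  have dG' z0 : z0 \in `[y, t] -> is_derive z0 1 G (G1 z0).
    by move=> /sub[_ _ ?]; exact: dG.
  have le' z0 : z0 \in `[y, t] -> phi1 z0 ^+ 2 + p z0 * phi z0 ^+ 2 <= G1 z0.
    by move=> /sub[_ _ ?]; exact: le.
  exact: riccati_le yt dw' cw' wp' dphi' dG' le'.
apply: (boundary_le xt (dphi x xi) phix (drv_continuous (dG x xi)) _ step) => y xy yt.
have [d0 Kd1] := Kd y xy yt.
by rewrite /w gerBl divr_ge0// subr_ge0; lra.
Qed.

Lemma hardy a b x p (K d : R) : 0 <= K -> K * d <= 1 / 3 ->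
  (forall y, y \in `[a, b] -> 0 < `|y - x| -> `|y - x| < d ->
    - (4 * `|y - x| ^+ 2)^-1 - K / `|y - x| <= p y) ->
  forall s t, a <= s -> t <= b -> x - d < s -> s <= x -> x <= t -> t < x + d ->
  coercive s t [set x] p.
Proof.
move=> K0 Kd hp s t as_ tb xs sx xt tx.
have right : coercive x t [set x] p.
  have [->|xnt] := eqVneq x t; first exact: coercive_point.
  have xt' : x < t by rewrite lt_neqAle xnt.
  apply: (@hardy_right x t p K xt' K0).
    by apply: le_trans Kd; apply: ler_wpM2l => //; lra.
  move=> y xy yt; have := hp y; rewrite (gtr0_norm (x := y - x)) ?subr_gt0//.
  by apply=> //; [apply: in_cc; lra|lra].
have left : coercive s x [set x] p.
  have [->|xns] := eqVneq s x; first exact: coercive_point.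
  have sx' : s < x by rewrite lt_neqAle xns.
  apply: coercive_opp; have -> : [set y | [set x] (- y)] = [set - x].
    by apply/seteqP; split=> y /=; [move=> <-; rewrite opprK|move=> ->; rewrite opprK].
  apply: (@hardy_right (- x) (- s) _ K _ K0); first by rewrite ltrN2.
    by apply: le_trans Kd; apply: ler_wpM2l => //; lra.
  move=> y xy yt; have := hp (- y).
  have -> : `|- y - x| = y - - x by rewrite -opprD normrN gtr0_norm; lra.
  by apply; [apply: in_cc; lra|lra|lra].
exact: coercive_cat sx xt left right.
Qed.

(** Potentials p c that share their local lower bounds share the points zs. *)
Lemma hardy_cover (I : Type) (ok : I -> Prop) (p : I -> R -> R) a b : a < b ->
  (forall x, x \in `[a, b] -> exists d K : R, [/\ 0 < d, 0 <= K &
    forall c, ok c -> forall y, y \in `[a, b] -> 0 < `|y - x| -> `|y - x| < d ->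
    - (4 * `|y - x| ^+ 2)^-1 - K / `|y - x| <= p c y]) ->
  exists zs : seq R, forall c, ok c -> coercive a b [set` zs] (p c).
Proof.
move=> ab loc.
apply: (@interval_glue _ (fun s t => exists zs : seq R, forall c, ok c ->
  coercive s t [set` zs] (p c))) => //.
  move=> s r t _ sr rt _ [z1 h1] [z2 h2]; exists (z1 ++ z2) => c okc.
  apply: (coercive_cat (ltW sr) (ltW rt)).
    by apply: coercive_mono (h1 c okc) => // x _ /=; rewrite mem_cat => ->.
  by apply: coercive_mono (h2 c okc) => // x _ /=; rewrite mem_cat orbC => ->.
move=> x xi; have [d [K [d0 K0 h]]] := loc x xi.
have K1 : 0 < 3 * (K + 1) by lra.
pose d' := Num.min d (3 * (K + 1))^-1.
have [e0 e1 e2] : [/\ 0 < d', d' <= d & d' <= (3 * (K + 1))^-1].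
  by rewrite /d' lt_min d0 invr_gt0 K1 !ge_min !lexx orbT.
exists d' => // s t as_ tb st xs sx _ xt tx _.
exists [:: x] => c okc.
apply: (@coercive_mono _ _ _ [set x] _ (p c)) => //.
  by move=> y _ /= ->; rewrite mem_head.
apply: (@hardy a b x (p c) K d') => //.
  move: e2; rewrite -[(_)^-1]mul1r ler_pdivlMr// => e2.
  by have := ltW e0; lra.
by move=> y yi y0 yd; apply: h => //; exact: lt_le_trans yd e1.
Qed.

Lemma nth_eigenvalue_lower a b q q' Z (zs : seq R) n (L : R) : a < b ->
  continuous q' -> {in `]a, b[, q' =1 q} -> L <= 0 ->
  coercive a b Z (fun x => q' x - L) ->
  (forall x, x \in `]a, b[ -> Z x -> x \in zs) -> (size zs <= n)%N ->
  L <= nth_eigenvalue a b q n.+1.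
Proof.
move=> ab cq qq L0 coer Zzs zn; apply: nth_eigenvalue_ge => // m mi mE.
have [zs' szn sub] : exists2 zs' : seq R, size zs' = n & {subset zs <= zs'}.
  exists (zs ++ nseq (n - size zs) 0); first by rewrite size_cat size_nseq subnKC.
  by move=> x xz; rewrite mem_cat xz.
subst n; apply: (eigenvalue_count ab coer _ mi) => [x xi Zx|i].
  exact/sub/Zzs.
exact: dirichlet_classical (mE i).
Qed.

Lemma finite_eigenvalues a b q q' l : a < b -> continuous q' ->
  {in `]a, b[, q' =1 q} ->
  finite_set [set x | dirichlet_eigenvalue a b q x /\ x <= l].
Proof.
move=> ab cq qq.
have cql : continuous (fun x => q' x - (l + 1)).
  by move=> x; apply: cvgB; [exact: cq|exact: cvg_cst].
(* A bounded potential satisfies the local bound with K = C for d <= 1. *)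
have [C C0 hC] := cont_bounded cql (ltW ab).
have [|zs hzs] := @hardy_cover unit (fun=> True) (fun _ x => q' x - (l + 1)) a b ab.
  move=> x xi; exists 1, C; split=> //; first exact: ltW.
  move=> _ _ y yi y0 y1; have := hC y yi; rewrite ler_norml => /andP[+ _].
  apply: le_trans.
  have : 0 <= (4 * `|y - x| ^+ 2)^-1 by rewrite invr_ge0 mulr_ge0 ?exprn_ge0.
  have : C <= C / `|y - x| by rewrite ler_pdivlMr// ler_piMr// ltW.
  by lra.
apply: contrapT => /infiniteP; set A := [set _ | _].
move=> /pcard_leP [f].
pose m (i : 'I_(size zs).+1) := f i : R.
have mA i : A (m i) by apply: funS.
have mi : injective m.
  by move=> i j mij; apply/val_inj; apply: (@inj _ _ _ f) => //; rewrite inE.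
have mE i : exists phi phi1, eigenfunction a b q' (m i) phi phi1.
  by have [mE _] := mA i; exact: dirichlet_classical mE.
have [i] := eigenvalue_count ab (hzs tt I) (fun x _ xz => xz) mi mE.
by have [_ ml] := mA i => /le_trans/(_ ml); rewrite gerDl ler10.
Qed.

Lemma nth_eigenvalue_upper a b q q' n l : a < b -> continuous q' ->
  {in `]a, b[, q' =1 q} -> osc (fun x => q' x - l) n.+1 a b ->
  nth_eigenvalue a b q n.+1 <= l.
Proof.
move=> ab cq qq ho; apply: nth_eigenvalue_le; first exact: finite_eigenvalues qq.
have [m [mi mE]] := eigenvalues_of_osc ab cq ho.
exists m; split=> // i; have [ml [phi [phi1 e]]] := mE i; split=> //.
exact: classical_dirichlet e.
Qed.

End Hardy.

(** * Minima of the profile *)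

Section Local.
Context {R : realType}.
Implicit Types (f g h p q w : R -> R) (a b s t x y : R) (Z : set R).

Lemma sqr_add3_le (u v w : R) : (u - v + w) ^+ 2 <= 3 * (u ^+ 2 + v ^+ 2 + w ^+ 2).
Proof.
have := sqr_ge0 (u + v); have := sqr_ge0 (v + w); have := sqr_ge0 (u - w).
by rewrite !expr2; lra.
Qed.

(** With d = y - x, take w = Q - J sqrt d + N d: the derivative of J sqrt d
    dominates Q^2 and the error E / sqrt d, both of order d^(-1/2), and the slope
    N makes w nonnegative at t.  The constant M depends on A, E and t - x only. *)
Lemma riccati_log x t (A E : R) : x < t -> t - x <= 1 -> 0 <= A -> 0 <= E ->
  exists2 M : R, 0 <= M & forall p Q Q1 phi phi1 G G1 : R -> R,
  (forall y, y \in `[x, t] -> is_derive y 1 Q (Q1 y)) ->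
  (forall y, x < y -> y <= t -> Q1 y - E / Num.sqrt (y - x) <= p y) ->
  (forall y, x < y -> y <= t -> `|Q y| <= A / Num.sqrt (Num.sqrt (y - x))) ->
  (forall y, y \in `[x, t] -> is_derive y 1 phi (phi1 y)) ->
  (forall y, y \in `[x, t] -> is_derive y 1 G (G1 y)) ->
  (forall y, y \in `[x, t] -> phi1 y ^+ 2 + (p y + M) * phi y ^+ 2 <= G1 y) ->
  G x - Q x * phi x ^+ 2 <= G t.
Proof.
move=> xt tx1 A0 E0; pose T := t - x.
have T0 : 0 < T by rewrite subr_gt0.
pose v := Num.sqrt (Num.sqrt T); have v0 : 0 < v by rewrite !sqrtr_gt0.
pose J := 2 * (3 * A ^+ 2 + E); pose N := (A / v + J) / T.
have J0 : 0 <= J by rewrite /J mulr_ge0// addr_ge0// mulr_ge0// sqr_ge0.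
have N0 : 0 <= N by rewrite /N divr_ge0 ?(ltW T0)// addr_ge0// divr_ge0// ltW.
pose M := N + 3 * J ^+ 2 + 3 * N ^+ 2.
exists M; first by rewrite /M !addr_ge0// mulr_ge0// sqr_ge0.
move=> p Q Q1 phi phi1 G G1 dQ hp hQ dphi dG le.
pose w y := Q y - J * Num.sqrt (y - x) + N * (y - x).
pose w1 y := Q1 y - J * (1 / (2 * Num.sqrt (y - x))) + N * 1.
have dd y : is_derive y 1 (fun y => y - x) 1.
  by apply: (drv_eq (drvB (drv_id y) (drv_cst x y))); rewrite subr0.
have dw y : y \in `]x, t[ -> is_derive y 1 w (w1 y).
  move=> yi; have yi' := subset_itv_oo_cc yi.
  have d0 : 0 < y - x by move: yi; rewrite in_itv/= subr_gt0 => /andP[].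
  exact: drvD (drvB (dQ y yi') (drvZ J (drv_sqrt (dd y) d0))) (drvZ N (dd y)).
have cw y : y \in `[x, t] -> {for y, continuous w}.
  move=> yi; apply: cvgD; last exact: drv_continuous (drvZ N (dd y)).
  apply: cvgB; first exact: drv_continuous (dQ y yi).
  apply: cvgM; first exact: cvg_cst.
  by apply: (continuous_comp (drv_continuous (dd y))); exact: sqrt_continuous.
have wp y : y \in `]x, t[ -> w1 y + w y ^+ 2 <= p y + M.
  rewrite in_itv/= => /andP[xy yt]; have yt' := ltW yt.
  have d0 : 0 < y - x by rewrite subr_gt0.
  pose r := Num.sqrt (y - x); have r0 : 0 < r by rewrite sqrtr_gt0.
  have r2 : r ^+ 2 = y - x by rewrite sqr_sqrtr// ltW.
  have d1 : y - x <= 1 by lra.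
  have s0 : 0 < Num.sqrt r by rewrite sqrtr_gt0.
  have s2 : Num.sqrt r ^+ 2 = r by rewrite sqr_sqrtr// ltW.
  have Q2 : Q y ^+ 2 <= A ^+ 2 / r.
    rewrite -s2 -expr_div_n -(real_normK (num_real (Q y))).
    by rewrite lerXn2r ?nnegrE ?divr_ge0 ?(ltW s0)//; exact: hQ.
  have h1 := hp y xy yt'; have h2 := sqr_add3_le (Q y) (J * r) (N * (y - x)).
  have h3 : (J * r) ^+ 2 <= J ^+ 2.
    by rewrite exprMn r2 ler_piMr ?sqr_ge0.
  have h4 : (N * (y - x)) ^+ 2 <= N ^+ 2.
    by rewrite exprMn ler_piMr ?sqr_ge0// expr_le1// ltW.
  have -> : w1 y = Q1 y - (3 * A ^+ 2 + E) / r + N.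
    by rewrite /w1 -/r /J; field; rewrite gt_eqF.
  move: h1; rewrite -/r => h1; rewrite /M -/(w y) mulrDl -mulrA.
  have -> : w y = Q y - J * r + N * (y - x) by [].
  lra.
have wt : 0 <= w t.
  have h := hQ t xt (lexx t); rewrite -/T -/v in h.
  have NT : N * T = A / v + J by rewrite /N mulfVK// gt_eqF.
  have sT : Num.sqrt T <= 1 by rewrite -[leRHS]sqrtr1 ler_wsqrtr.
  have h2 : J * Num.sqrt T <= J by rewrite ler_piMr.
  by move: h; rewrite /w -/T NT ler_norml => /andP[h _]; lra.
have := riccati_le (ltW xt) dw cw wp dphi dG le.
have -> : w x = Q x by rewrite /w subrr sqrtr0 !mulr0 addr0 subr0.
by move=> /le_trans; apply; rewrite gerBl mulr_ge0// sqr_ge0.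
Qed.

(** A C^3 profile on R, with m a lower bound of U on [a, b] that is the minimum
    in the application. *)
Record profile a b (U U1 U2 U3 : R -> R) (m : R) : Prop := Profile {
  profile_lt : a < b;
  profile_d : forall x, is_derive x 1 U (U1 x);
  profile_d1 : forall x, is_derive x 1 U1 (U2 x);
  profile_d2 : forall x, is_derive x 1 U2 (U3 x);
  profile_holder : exists2 H : R, 0 < H & holder_half H U3;
  profile_min : forall x, x \in `[a, b] -> m <= U x;
  profile_crit : forall x, x \in `[a, b] -> U1 x = 0 -> U2 x <> 0 }.

Lemma deriv_lip f (f' : R -> R) a b x y (C : R) : (forall z : R, is_derive z 1 f (f' z)) ->
  x \in `[a, b] -> y \in `[a, b] ->
  (forall z, z \in `[a, b] -> `|z - x| <= `|y - x| -> `|f' z| <= C) ->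
  `|f y - f x| <= C * `|y - x|.
Proof.
rewrite !in_itv/= => df /andP[ax xb] /andP[ay yb] hC.
have cf z : {for z, continuous f} := drv_continuous (df z).
have [xy|yx|->] := ltgtP x y; last by rewrite !subrr normr0 mulr0.
- have [c] := mean_value xy (fun z _ => df z) (cont_within (fun z _ => cf z)).
  rewrite in_itv/= => /andP[xc cy] ->; rewrite normrM; apply: ler_wpM2r => //.
  by apply: hC; [apply: in_cc; lra|rewrite !gtr0_norm; lra].
- have [c] := mean_value yx (fun z _ => df z) (cont_within (fun z _ => cf z)).
  rewrite in_itv/= => /andP[xc cy] e.
  rewrite distrC e normrM (distrC x y); apply: ler_wpM2r => //.
  by apply: hC; [apply: in_cc; lra|rewrite !ltr0_norm; lra].
Qed.

Lemma profile_bounds a b U U1 U2 U3 m : profile a b U U1 U2 U3 m ->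
  exists2 B : R, 0 < B & forall x y, x \in `[a, b] -> y \in `[a, b] ->
   [/\ `|U2 y| <= B, `|U y - U x| <= B * `|y - x|,
     `|U2 y - U2 x| <= B * `|y - x|,
     `|U y - U x - U1 x * (y - x)| <= B * `|y - x| ^+ 2 &
     `|U y - U x - U1 x * (y - x) - U2 x / 2 * (y - x) ^+ 2| <= B * `|y - x| ^+ 3].
Proof.
move=> [ab d0 d1 d2 [H H0 hH] _ _].
have [b1 b10 hb1] := cont_bounded (fun x => drv_continuous (d1 x)) (ltW ab).
have [b2 b20 hb2] := cont_bounded (fun x => drv_continuous (d2 x)) (ltW ab).
have [b3 b30 hb3] := cont_bounded (holder_cont H0 hH) (ltW ab).
exists (b1 + b2 + b3); first by lra.
move=> x y xi yi.
have l2 z : z \in `[a, b] -> `|U2 z - U2 x| <= b3 * `|z - x|.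
  by move=> zi; apply: deriv_lip d2 xi zi _ => u ui _; exact: hb3.
have l1 z : z \in `[a, b] -> `|U1 z - U1 x| <= b2 * `|z - x|.
  by move=> zi; apply: deriv_lip d1 xi zi _ => u ui _; exact: hb2.
have l0 z : z \in `[a, b] -> `|U z - U x| <= b1 * `|z - x|.
  by move=> zi; apply: deriv_lip d0 xi zi _ => u ui _; exact: hb1.
have dd (z : R) : is_derive z 1 (fun y => y - x) 1.
  by apply: (drv_eq (drvB (drv_id z) (drv_cst x z))); rewrite subr0.
have n0 z : 0 <= `|z - x| by [].
have m1 z : z \in `[a, b] -> `|U1 z - U1 x - U2 x * (z - x)| <= b3 * `|z - x| ^+ 2.
  move=> zi; rewrite expr2 mulrA.
  have df (u : R) : is_derive u 1 (fun u => U1 u - U2 x * (u - x)) (U2 u - U2 x * 1).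
    exact: drvB (d1 u) (drvZ (U2 x) (dd u)).
  have -> : U1 z - U1 x - U2 x * (z - x) =
     (U1 z - U2 x * (z - x)) - (U1 x - U2 x * (x - x)) by ring.
  apply: (deriv_lip df xi zi) => u ui uz; rewrite mulr1.
  by apply: le_trans (l2 u ui) _; rewrite ler_pM2l.
have m0 z : z \in `[a, b] -> `|U z - U x - U1 x * (z - x)| <= b2 * `|z - x| ^+ 2.
  move=> zi; rewrite expr2 mulrA.
  have df (u : R) : is_derive u 1 (fun u => U u - U1 x * (u - x)) (U1 u - U1 x * 1).
    exact: drvB (d0 u) (drvZ (U1 x) (dd u)).
  have -> : U z - U x - U1 x * (z - x) =
     (U z - U1 x * (z - x)) - (U x - U1 x * (x - x)) by ring.
  apply: (deriv_lip df xi zi) => u ui uz; rewrite mulr1.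
  by apply: le_trans (l1 u ui) _; rewrite ler_pM2l.
have k0 z : z \in `[a, b] ->
    `|U z - U x - U1 x * (z - x) - U2 x / 2 * (z - x) ^+ 2| <= b3 * `|z - x| ^+ 3.
  move=> zi; have -> : b3 * `|z - x| ^+ 3 = b3 * `|z - x| ^+ 2 * `|z - x| by ring.
  have df (u : R) : is_derive u 1 (fun u => U u - U1 x * (u - x) - U2 x / 2 * (u - x) ^+ 2)
     (U1 u - U1 x * 1 - U2 x / 2 * (2 * (u - x) * 1)).
    exact: drvB (drvB (d0 u) (drvZ (U1 x) (dd u))) (drvZ (U2 x / 2) (drv_sqr (dd u))).
  have -> : U z - U x - U1 x * (z - x) - U2 x / 2 * (z - x) ^+ 2 =
     (U z - U1 x * (z - x) - U2 x / 2 * (z - x) ^+ 2) -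
     (U x - U1 x * (x - x) - U2 x / 2 * (x - x) ^+ 2) by ring.
  apply: (deriv_lip df xi zi) => u ui uz.
  have -> : U1 u - U1 x * 1 - U2 x / 2 * (2 * (u - x) * 1) =
    U1 u - U1 x - U2 x * (u - x) by field.
  by apply: le_trans (m1 u ui) _; rewrite ler_pM2l// lerXn2r.
have n2 := exprn_ge0 2 (n0 y); have n3 := exprn_ge0 3 (n0 y); have n1 := n0 y.
have up (K Y X : R) : 0 <= Y -> K <= b1 + b2 + b3 -> X <= K * Y -> X <= (b1 + b2 + b3) * Y.
  by move=> Y0 Kb /le_trans; apply; exact: ler_wpM2r.
split.
- by have := hb2 y yi; lra.
- by apply: (up b1) => //; [lra|exact: l0].
- by apply: (up b3) => //; [lra|exact: l2].
- by apply: (up b2) => //; [lra|exact: m0].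
- by apply: (up b3) => //; [lra|exact: k0].
Qed.

Lemma near_point a b x (e : R) : a < b -> x \in `[a, b] -> 0 < e ->
  exists y, [/\ y \in `[a, b], 0 < `|y - x| & `|y - x| < e].
Proof.
rewrite in_itv/= => ab /andP[ax xb] e0.
have [xb'|bx] := ltP x b.
  have [m1 m2 m3] : [/\ 0 < Num.min e (b - x), Num.min e (b - x) <= e & Num.min e (b - x) <= b - x].
    by rewrite lt_min e0 subr_gt0 xb' !ge_min !lexx orbT.
  exists (x + Num.min e (b - x) / 2); rewrite addrAC subrr add0r gtr0_norm; last by lra.
  by split; [apply: in_cc; lra|lra|lra].
have [m1 m2 m3] : [/\ 0 < Num.min e (x - a), Num.min e (x - a) <= e & Num.min e (x - a) <= x - a].
  by rewrite lt_min e0 subr_gt0 !ge_min !lexx orbT; split=> //; apply/andP; split=> //; lra.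
exists (x - Num.min e (x - a) / 2).
rewrite addrAC subrr add0r normrN gtr0_norm; last by lra.
by split; [apply: in_cc; lra|lra|lra].
Qed.

(** Second order condition; it is needed at the end points of [a, b] as well,
    where Taylor's formula is used on one side. *)
Lemma profile_pos a b U U1 U2 U3 m x : profile a b U U1 U2 U3 m ->
  x \in `[a, b] -> U x = m -> U1 x = 0 -> 0 < U2 x.
Proof.
move=> P xi Ux U1x; have [B B0 hB] := profile_bounds P.
have U2x := profile_crit P xi U1x.
rewrite lt_neqAle eq_sym; apply/andP; split; first exact/eqP.
rewrite leNgt; apply/negP => k0.
have e0 : 0 < - U2 x / (2 * B) by rewrite divr_gt0 ?oppr_gt0// mulr_gt0.
have [y [yi y0 ye]] := near_point (profile_lt P) xi e0.
have [_ _ _ _] := hB x y xi yi.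
have := profile_min P yi; rewrite Ux U1x mul0r subr0 => my.
rewrite -(real_normK (num_real (y - x))) exprSr.
move: ye; rewrite ltr_pdivlMr ?mulr_gt0// => ye.
have y2 : 0 < `|y - x| ^+ 2 by rewrite exprn_gt0.
rewrite ler_norml => /andP[_ h].
have : (U2 x / 2 + B * `|y - x|) * `|y - x| ^+ 2 < 0 by rewrite nmulr_rlt0//; lra.
by lra.
Qed.

Lemma profile_interior a b U U1 U2 U3 m x : profile a b U U1 U2 U3 m ->
  x \in `]a, b[ -> U x = m -> U1 x = 0.
Proof.
move=> P xi Ux.
have dr t : t \in `]a, b[ -> derivable U t 1 by have [] := profile_d P t.
have mn t : t \in `]a, b[ -> U x <= U t.
  by move=> ti; rewrite Ux; exact: profile_min P _ (subset_itv_oo_cc ti).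
have [_ e] := derive1_at_min (ltW (profile_lt P)) dr xi mn.
by have [_ <-] := profile_d P x.
Qed.

Lemma profile_quadratic a b U U1 U2 U3 m x : profile a b U U1 U2 U3 m ->
  x \in `[a, b] -> U x = m -> U1 x = 0 ->
  exists2 d : R, 0 < d & forall y, y \in `[a, b] -> `|y - x| < d ->
  U2 x / 4 * `|y - x| ^+ 2 <= U y - m.
Proof.
move=> P xi Ux U1x; have [B B0 hB] := profile_bounds P.
have k0 := profile_pos P xi Ux U1x.
exists (U2 x / (4 * B)); first by rewrite divr_gt0// mulr_gt0.
move=> y yi; rewrite ltr_pdivlMr ?mulr_gt0// => yd.
have [_ _ _ _] := hB x y xi yi.
rewrite Ux U1x mul0r subr0 -(real_normK (num_real (y - x))) exprSr ler_norml => /andP[h _].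
have : 0 <= (U2 x / 4 - B * `|y - x|) * `|y - x| ^+ 2.
  by rewrite mulr_ge0 ?exprn_ge0//; lra.
by lra.
Qed.

Lemma quotient_ge (D D0 N e : R) : 0 < D0 -> D0 <= D -> 0 <= e -> - N <= e * D0 ->
  - e <= N / D.
Proof.
move=> D00 DD e0 h; rewrite ler_pdivlMr; last exact: lt_le_trans DD.
by have := ler_wpM2l e0 DD; lra.
Qed.

End Local.

(** * The Rayleigh-Kuo potential near a point *)

Section Global.
Context {R : realType}.
Implicit Types (f g h p q w : R -> R) (a b s t x y : R) (Z : set R).

Lemma profile_opp a b U U1 U2 U3 m : profile a b U U1 U2 U3 m ->
  profile (- b) (- a) (fun y => U (- y)) (fun y => - U1 (- y))
    (fun y => U2 (- y)) (fun y => - U3 (- y)) m.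
Proof.
move=> P; split.
- by rewrite ltrN2; exact: profile_lt P.
- by move=> x; exact: drv_reflect (profile_d P (- x)).
- by move=> x; apply: (drv_eq (drvN (drv_reflect (profile_d1 P (- x))))); rewrite opprK.
- by move=> x; exact: drv_reflect (profile_d2 P (- x)).
- have [H H0 hH] := profile_holder P; exists H => // x y.
  have -> : - U3 (- x) - - U3 (- y) = - (U3 (- x) - U3 (- y)) by ring.
  have -> : x - y = - (- x - - y) by ring.
  by rewrite !normrN; exact: hH.
- by move=> x; rewrite -opp_itv; exact: (profile_min P).
- move=> x; rewrite -opp_itv => xi /eqP; rewrite oppr_eq0 => /eqP.
  exact: (profile_crit P xi).
Qed.

Lemma profile_above a b U U1 U2 U3 m x : profile a b U U1 U2 U3 m ->
  x \in `[a, b] -> U x != m ->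
  exists d e : R, [/\ 0 < d, 0 < e & forall y, y \in `[a, b] -> `|y - x| < d ->
  e <= U y - m].
Proof.
move=> P xi Ux; have [B B0 hB] := profile_bounds P.
have e0 : 0 < (U x - m) / 2.
  by rewrite divr_gt0// subr_gt0 lt_neqAle eq_sym Ux (profile_min P xi).
exists ((U x - m) / 2 / B), ((U x - m) / 2); split=> //; first exact: divr_gt0.
move=> y yi; rewrite ltr_pdivlMr// => yd.
have [_ + _ _ _] := hB x y xi yi.
by rewrite ler_norml => /andP[h _]; lra.
Qed.

Lemma profile_linear a b U U1 U2 U3 m x : profile a b U U1 U2 U3 m ->
  x \in `[a, b] -> U x = m -> U1 x != 0 ->
  exists2 d : R, 0 < d & forall y, y \in `[a, b] -> `|y - x| < d ->
  `|U1 x| / 2 * `|y - x| <= U y - m.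
Proof.
move=> P xi Ux Un; have [B B0 hB] := profile_bounds P.
have n0 : 0 < `|U1 x| by rewrite normr_gt0.
exists (`|U1 x| / (2 * B)); first by rewrite divr_gt0// mulr_gt0.
move=> y yi; rewrite ltr_pdivlMr ?mulr_gt0// => yd.
have [_ _ _ + _] := hB x y xi yi; rewrite Ux.
have my : 0 <= U y - m by rewrite subr_ge0 (profile_min P yi).
have h1 : `|U1 x| * `|y - x| <= `|U y - m| + `|U y - m - U1 x * (y - x)|.
  have e : U1 x * (y - x) = (U y - m) - (U y - m - U1 x * (y - x)) by ring.
  by rewrite -normrM {1}e ler_normB.
rewrite (ger0_norm my) in h1 => h2.
have : 0 <= (`|U1 x| / 2 - B * `|y - x|) * `|y - x| by rewrite mulr_ge0//; lra.
by rewrite expr2 in h2; lra.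
Qed.

(** The minima are isolated: at a minimum, U - m is bounded below by a multiple of
    d^2 or, when U1 does not vanish, of d. *)
Lemma profile_isolated a b U U1 U2 U3 m x : profile a b U U1 U2 U3 m ->
  x \in `[a, b] ->
  exists2 d : R, 0 < d & forall y, y \in `[a, b] -> `|y - x| < d ->
  U y = m -> y = x.
Proof.
move=> P xi; have [Ux|Ux] := eqVneq (U x) m; last first.
  have [d [e [d0 e0 h]]] := profile_above P xi Ux; exists d => // y yi yd Uy.
  by have := h y yi yd; rewrite Uy subrr leNgt e0.
have [U1x|U1x] := eqVneq (U1 x) 0.
  have [d d0 h] := profile_quadratic P xi Ux U1x; exists d => // y yi yd Uy.
  have := h y yi yd; rewrite Uy subrr pmulr_rle0; last first.
    by rewrite divr_gt0// (profile_pos P xi Ux U1x).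
  move=> h2; have : `|y - x| ^+ 2 == 0 by rewrite eq_le h2 exprn_ge0.
  by rewrite sqrf_eq0 normr_eq0 subr_eq0 => /eqP.
have [d d0 h] := profile_linear P xi Ux U1x; exists d => // y yi yd Uy.
have := h y yi yd; rewrite Uy subrr pmulr_rle0; last first.
  by rewrite divr_gt0// normr_gt0.
by rewrite normr_le0 subr_eq0 => /eqP.
Qed.

Lemma profile_finite a b U U1 U2 U3 m : profile a b U U1 U2 U3 m ->
  finite_set [set x | x \in `[a, b] /\ U x = m].
Proof.
move=> P; have ab := profile_lt P.
apply: (@interval_glue _ (fun s t => finite_set [set x | x \in `[s, t] /\ U x = m]) a b ab).
  move=> s r t _ sr rt _ f1 f2.
  have f12 : finite_set ([set x | x \in `[s, r] /\ U x = m] `|` [set x | x \in `[r, t] /\ U x = m]).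
    by rewrite finite_setU.
  apply: sub_finite_set f12 => x /= [xi Ux].
  have [xr|rx] := leP x r; [left|right]; split=> //; move: xi; rewrite !in_itv/= => /andP[? ?].
    by rewrite xr andbT.
  by rewrite ltW.
move=> x xi; have [d d0 h] := profile_isolated P xi; exists d => //.
move=> s t as_ tb st xs sx _ xt tx _.
apply: (@sub_finite_set _ _ [set x]); last exact: finite_set1.
move=> y /= [yi Uy]; apply: h => //; move: yi; rewrite in_itv/= => /andP[? ?].
  by apply: in_cc; lra.
by rewrite ltr_norml; apply/andP; split; lra.
Qed.

Definition rayleigh (U U2 : R -> R) (beta c y : R) : R := (U2 y - beta) / (U y - c).

(** At a critical minimum the inequality beta <= 9/8 U2 x bounds the numerator
    below by - U2 x / 8 - B d and U - m >= U2 x d^2 / 2 - B d^3; the quotient is at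
    least - 1 / (4 d^2) - K / d with K = 5 B / U2 x.  The bound is uniform
    in c since, where its numerator is negative, the potential is larger at c
    than at m. *)
Lemma profile_hardy a b U U1 U2 U3 m (beta : R) x : profile a b U U1 U2 U3 m ->
  x \in `[a, b] -> (U x = m -> U1 x = 0 -> beta <= 9 / 8 * U2 x) ->
  exists d K : R, [/\ 0 < d, 0 <= K &
    forall c, c < m -> forall y, y \in `[a, b] -> 0 < `|y - x| -> `|y - x| < d ->
    - (4 * `|y - x| ^+ 2)^-1 - K / `|y - x| <= rayleigh U U2 beta c y].
Proof.
move=> P xi hbeta; have [B B0 hB] := profile_bounds P.
pose C := B + `|beta|; have C0 : 0 < C by rewrite /C ltr_pwDl.
have hC y : y \in `[a, b] -> - (U2 y - beta) <= C.
  move=> yi; have [+ _ _ _ _] := hB x y xi yi; rewrite ler_norml => /andP[h _].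
  by have := ler_norm beta; rewrite /C; lra.
have q0 (z : R) : 0 < z -> 0 <= (4 * z ^+ 2)^-1.
  by move=> z0; rewrite invr_ge0 mulr_ge0 ?sqr_ge0.
have cmD c y : c < m -> U y - m <= U y - c by lra.
have [Ux|Ux] := eqVneq (U x) m; last first.
  have [d [e [d0 e0 h]]] := profile_above P xi Ux.
  have K0 : 0 <= C / e by apply: divr_ge0; exact: ltW.
  exists (Num.min d 1), (C / e); split=> //; first by rewrite lt_min d0 ltr01.
  move=> c cm y yi y0; rewrite lt_min => /andP[yd y1].
  rewrite -opprD; apply: (quotient_ge e0).
  - by have := h y yi yd; lra.
  - by rewrite addr_ge0 ?q0// divr_ge0.
  - apply: (le_trans (hC y yi)).
    have -> : ((4 * `|y - x| ^+ 2)^-1 + C / e / `|y - x|) * e =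
      (4 * `|y - x| ^+ 2)^-1 * e + C / `|y - x| by field; rewrite !gt_eqF.
    have : C <= C / `|y - x| by rewrite ler_pdivlMr// ler_piMr// ltW.
    by have := mulr_ge0 (q0 _ y0) (ltW e0); lra.
have [U1x|U1x] := eqVneq (U1 x) 0; last first.
  have [d d0 h] := profile_linear P xi Ux U1x.
  have n0 : 0 < `|U1 x| by rewrite normr_gt0.
  have K0 : 0 <= C / (`|U1 x| / 2).
    by apply: divr_ge0; [exact: ltW|rewrite divr_ge0].
  exists d, (C / (`|U1 x| / 2)); split=> //.
  move=> c cm y yi y0 yd; rewrite -opprD.
  apply: (@quotient_ge _ _ (`|U1 x| / 2 * `|y - x|)).
  - by rewrite mulr_gt0// divr_gt0.
  - by have := h y yi yd; lra.
  - by rewrite addr_ge0 ?q0// divr_ge0.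
  - apply: (le_trans (hC y yi)).
    have -> : ((4 * `|y - x| ^+ 2)^-1 + C / (`|U1 x| / 2) / `|y - x|) * (`|U1 x| / 2 * `|y - x|) =
      (4 * `|y - x| ^+ 2)^-1 * (`|U1 x| / 2 * `|y - x|) + C by field; rewrite !gt_eqF.
    by rewrite lerDr mulr_ge0 ?q0// mulr_ge0// divr_ge0.
have k0 := profile_pos P xi Ux U1x.
have {}hbeta := hbeta Ux U1x.
have K0 : 0 <= 5 * B / U2 x.
  by apply: divr_ge0; [apply: mulr_ge0 => //|]; exact: ltW.
exists (U2 x / (4 * B)), (5 * B / U2 x); split=> //.
  by rewrite divr_gt0// mulr_gt0.
move=> c cm y yi y0; rewrite ltr_pdivlMr ?mulr_gt0// => yd.
have [_ _ h2 _ h0] := hB x y xi yi.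
rewrite Ux U1x mul0r subr0 -(real_normK (num_real (y - x))) in h0.
rewrite -opprD; move: h2 h0 y0 yd; set z := `|y - x| => h2 h0 y0 yd.
have zB : 0 < U2 x / 2 - B * z by lra.
apply: (@quotient_ge _ _ ((U2 x / 2 - B * z) * z ^+ 2)).
- by rewrite mulr_gt0 ?exprn_gt0.
- by move: h0; rewrite ler_norml => /andP[h _]; have := cmD c y cm; rewrite (exprSr _ 2) in h; lra.
- by rewrite addr_ge0 ?q0// divr_ge0// ltW.
- have -> : ((4 * z ^+ 2)^-1 + 5 * B / U2 x / z) * ((U2 x / 2 - B * z) * z ^+ 2) =
    U2 x / 8 + B * z + z * (5 * B / U2 x) * (U2 x / 4 - B * z).
    by field; rewrite !gt_eqF.
  move: h2; rewrite ler_norml => /andP[h2 _].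
  have : 0 <= z * (5 * B / U2 x) * (U2 x / 4 - B * z).
    by apply: mulr_ge0; [apply: mulr_ge0 => //; exact: ltW|lra].
  lra.
Qed.

End Global.

(** * Interior minima above the threshold *)

Section Log.
Context {R : realType}.
Implicit Types (f g h p q w : R -> R) (a b s t x y : R) (Z : set R).

Lemma ln_le_sub1 (z : R) : 0 < z -> ln z <= z - 1.
Proof.
move=> z0; rewrite -{1}(subrKC 1 z); apply: le_ln1Dx; lra.
Qed.

(** The function U2 - k U1, k = U3 x / U2 x, has a derivative that vanishes at x
    and is Hoelder continuous of exponent 1/2, so that it varies by O(d^(3/2)). *)
Lemma profile_odd_part a b U U1 U2 U3 m (beta : R) x : profile a b U U1 U2 U3 m ->
  x \in `[a, b] -> 0 < U2 x -> U1 x = 0 -> beta <= U2 x ->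
  exists2 C : R, 0 < C & forall y, y \in `[a, b] -> `|y - x| <= 1 ->
    U3 x / U2 x * U1 y - C * `|y - x| * Num.sqrt `|y - x| <= U2 y - beta.
Proof.
move=> P xi k0 U1x bk; have [B B0 hB] := profile_bounds P.
have [H H0 hH] := profile_holder P.
pose k := U3 x / U2 x; pose C := H + `|k| * B.
have C0 : 0 < C by rewrite /C ltr_pwDl// mulr_ge0// ltW.
exists C => // y yi y1.
have dg (z : R) : is_derive z 1 (fun z => U2 z - k * U1 z) (U3 z - k * U2 z).
  exact: drvB (profile_d2 P z) (drvZ k (profile_d1 P z)).
have hg z : z \in `[a, b] -> `|z - x| <= `|y - x| ->
    `|U3 z - k * U2 z| <= C * Num.sqrt `|y - x|.
  move=> zi zy; have -> : U3 z - k * U2 z = (U3 z - U3 x) - k * (U2 z - U2 x).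
    by rewrite /k; field; rewrite gt_eqF.
  apply: (le_trans (ler_normB _ _)); rewrite /C mulrDl; apply: lerD.
    apply: (le_trans (hH z x)); rewrite ler_pM2l// ler_wsqrtr//.
  rewrite normrM -mulrA ler_wpM2l//.
  have [_ _ h _ _] := hB x z xi zi; apply: (le_trans h); rewrite ler_pM2l//.
  apply: (le_trans zy); set d := `|y - x|.
  have d0 : 0 <= d by rewrite /d.
  have s1 : Num.sqrt d <= 1 by rewrite -[leRHS]sqrtr1 ler_wsqrtr.
  by rewrite -{1}(sqr_sqrtr d0) expr2 ler_piMr ?sqrtr_ge0.
have := deriv_lip dg xi yi hg; rewrite U1x mulr0 subr0 ler_norml => /andP[h _].
by rewrite -/k -mulrA (mulrC `|y - x|) mulrA; lra.
Qed.

(** With r = d^(1/4), - ln r <= 1 / r - 1; the fourth root makes the square of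
    the logarithm integrable in the form 1 / sqrt d. *)
Lemma ln_bound (K B z d : R) : 0 < K -> 0 <= B -> 0 < d -> d <= 1 ->
  K * d ^+ 2 <= z -> z <= B + 1 ->
  `|ln z| <= (B + `|ln K| + 8) / Num.sqrt (Num.sqrt d).
Proof.
move=> K0 B0 d0 d1 zK zB; set r := Num.sqrt _.
have r0 : 0 < r by rewrite !sqrtr_gt0.
have r1 : r <= 1.
  by rewrite /r -[leRHS]sqrtr1 ler_wsqrtr// -[leRHS]sqrtr1 ler_wsqrtr.
have dr : d ^+ 2 = r ^+ 8.
  by rewrite (exprM _ 2 4) sqr_sqrtr ?sqrtr_ge0// (exprM _ 2 2) sqr_sqrtr ?ltW.
have Kd0 : 0 < K * d ^+ 2 by rewrite mulr_gt0 ?exprn_gt0.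
have z0 : 0 < z by exact: lt_le_trans zK.
have rV : 1 <= r^-1 by rewrite invf_ge1.
have l1 : ln z <= B by have := ln_le_sub1 z0; lra.
have l2 : ln K + ln (r ^+ 8) <= ln z.
  rewrite -lnM ?posrE ?exprn_gt0// ler_ln ?posrE ?mulr_gt0 ?exprn_gt0//.
  by rewrite -dr.
have l3 : ln (r ^+ 8) = 8 * ln r by rewrite lnXn// mulr_natl.
have l4 : - ln r <= r^-1 - 1.
  by rewrite -lnV ?posrE// ln_le_sub1// invr_gt0.
have n0 : 0 <= `|ln K| by [].
have n1 : - ln K <= `|ln K| by rewrite -normrN ler_norm.
have h (X : R) : 0 <= X -> X <= X * r^-1 by move=> X0; rewrite ler_peMr.
rewrite mulrDl mulrDl ler_norml; have := h _ B0; have := h _ n0.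
by move=> h1 h2; apply/andP; split; lra.
Qed.

(** The hypotheses of [riccati_log] for Q = k ln (U - c), uniformly in c in
    ]m - 1, m[: on dividing the error O(d^(3/2)) by U - c >= U2 x d^2 / 4 one gets
    O(d^(-1/2)). *)
Lemma profile_log_bounds a b U U1 U2 U3 m (beta : R) x : profile a b U U1 U2 U3 m ->
  x \in `]a, b[ -> U x = m -> beta <= U2 x ->
  exists d A E : R, [/\ 0 < d, d <= 1, 0 <= A, 0 <= E &
    forall c y, m - 1 < c -> c < m -> y \in `[a, b] ->
    0 < `|y - x| -> `|y - x| < d ->
    U3 x / U2 x * (U1 y / (U y - c)) - E / Num.sqrt `|y - x| <= rayleigh U U2 beta c y /\
    `|U3 x / U2 x * ln (U y - c)| <= A / Num.sqrt (Num.sqrt `|y - x|)].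
Proof.
move=> P xoi Ux bk; have xi := subset_itv_oo_cc xoi.
have U1x := profile_interior P xoi Ux.
have k0 := profile_pos P xi Ux U1x.
have [B B0 hB] := profile_bounds P.
have [d d0 hd] := profile_quadratic P xi Ux U1x.
have [C C0 hC] := profile_odd_part P xi k0 U1x bk.
pose k := U3 x / U2 x; pose K := U2 x / 4; have K0 : 0 < K by rewrite divr_gt0.
pose A := `|k| * (B + `|ln K| + 8).
have A0 : 0 <= A by rewrite mulr_ge0// !addr_ge0// ltW.
have d1 : 0 < Num.min d 1 by rewrite lt_min d0 ltr01.
have [dm1 dm2] : Num.min d 1 <= d /\ Num.min d 1 <= 1 by rewrite !ge_min !lexx orbT.
exists (Num.min d 1), A, (C / K); split=> //; first by rewrite divr_ge0// ltW.
move=> c y mc cm yi y0 yd'; have yd := lt_le_trans yd' dm1.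
have y1 := ltW (lt_le_trans yd' dm2).
have D0 : 0 < U y - c by rewrite subr_gt0 (lt_le_trans cm)// (profile_min P yi).
have h1 := hd y yi yd; have h2 := hC y yi y1.
rewrite -/K -/k in h1 h2; set z := `|y - x| in h1 h2 y0 yd y1 *.
have KD : K * z ^+ 2 <= U y - c by move: h1 cm; clear; lra.
split.
  rewrite /rayleigh mulrA lerBlDr -lerBlDl -mulrBl.
  pose r := Num.sqrt z; have r0 : 0 < r by rewrite sqrtr_gt0.
  have zr : z = r ^+ 2 by rewrite sqr_sqrtr// ltW.
  rewrite -/r ler_pdivrMr//.
  apply: (@le_trans _ _ (C * z * r)); first by rewrite lerBlDl -lerBlDr.
  have -> : C * z * r = C / K / r * (K * z ^+ 2) by rewrite zr; field; rewrite !gt_eqF.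
  by rewrite ler_wpM2l// divr_ge0 ?divr_ge0// ltW.
rewrite /A normrM -mulrA ler_wpM2l//; apply: ln_bound => //; first exact: ltW.
have [_ + _ _ _] := hB x y xi yi; rewrite Ux -/z ler_norml => /andP[_ h].
have : B * z <= B by rewrite ler_piMr// ltW.
by move: h mc; clear; lra.
Qed.

Lemma profile_log_half a b U U1 U2 U3 m (beta : R) x :
  profile a b U U1 U2 U3 m -> x \in `]a, b[ -> U x = m -> beta <= U2 x ->
  exists2 d : R, 0 < d & forall t, x < t -> t <= b -> t < x + d -> exists2 M : R, 0 <= M &
    forall c phi (phi1 G G1 : R -> R) (M' : R), m - 1 < c -> c < m -> M <= M' ->
    (forall y, y \in `[x, t] -> is_derive y 1 phi (phi1 y)) ->
    (forall y, y \in `[x, t] -> is_derive y 1 G (G1 y)) ->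
    (forall y, y \in `[x, t] ->
      phi1 y ^+ 2 + (rayleigh U U2 beta c y + M') * phi y ^+ 2 <= G1 y) ->
    G x - U3 x / U2 x * ln (U x - c) * phi x ^+ 2 <= G t.
Proof.
move=> P xoi Ux bk; have [d [A [E [d0 d1 A0 E0 facts]]]] := profile_log_bounds P xoi Ux bk.
pose k := U3 x / U2 x; exists d => // t xt tb td.
have tx1 : t - x <= 1 by move: td d1; clear; lra.
have [M M0 hM] := riccati_log xt tx1 A0 E0; exists M => //.
move=> c phi phi1 G G1 M' mc cm MM dphi dG le.
have inab y : x <= y -> y <= t -> y \in `[a, b].
  move: xoi; rewrite !in_itv/= => /andP[ax _] xy yt.
  by rewrite (le_trans (ltW ax) xy) (le_trans yt tb).
have sub y : y \in `[x, t] -> y \in `[a, b].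
  by rewrite {1}in_itv/= => /andP[]; exact: inab.
have facts' y : x < y -> y <= t ->
    k * (U1 y / (U y - c)) - E / Num.sqrt (y - x) <= rayleigh U U2 beta c y /\
    `|k * ln (U y - c)| <= A / Num.sqrt (Num.sqrt (y - x)).
  move=> xy yt; have := facts c y mc cm (inab y (ltW xy) yt).
  rewrite gtr0_norm ?subr_gt0//; apply=> //.
  by move: yt td; clear; lra.
have r1 y : y \in `[x, t] ->
    is_derive y 1 (fun y => k * ln (U y - c)) (k * (U1 y / (U y - c))).
  move=> /sub yi; have Uc : 0 < U y - c.
    by rewrite subr_gt0 (lt_le_trans cm)// (profile_min P yi).
  apply: drvZ; have dUc := drvB (profile_d P y) (drv_cst c y).
  by apply: (drv_eq (drv_ln dUc Uc)); rewrite subr0.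
have r2 y : x < y -> y <= t -> k * (U1 y / (U y - c)) - E / Num.sqrt (y - x) <=
    rayleigh U U2 beta c y + (M' - M).
  by move=> xy yt; have [+ _] := facts' y xy yt; move: MM; clear; lra.
have r3 y : x < y -> y <= t ->
    `|k * ln (U y - c)| <= A / Num.sqrt (Num.sqrt (y - x)).
  by move=> xy yt; have [_] := facts' y xy yt.
have r6 y : y \in `[x, t] ->
    phi1 y ^+ 2 + (rayleigh U U2 beta c y + (M' - M) + M) * phi y ^+ 2 <= G1 y.
  by move=> yi; rewrite -addrA subrK; exact: le.
exact: hM r1 r2 r3 dphi dG r6.
Qed.

(** The boundary terms k ln (U x - c) phi x ^+ 2 of the two sides, which are not
    bounded as c tends to m, cancel.  For c <= m - 1 the potential is bounded. *)
Lemma profile_log a b U U1 U2 U3 m (beta : R) x Z : profile a b U U1 U2 U3 m ->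
  x \in `]a, b[ -> U x = m -> beta <= U2 x ->
  exists2 d : R, 0 < d & forall s t, a <= s -> t <= b -> x - d < s -> s < x ->
    x < t -> t < x + d -> exists2 M : R, 0 <= M &
    forall c, c < m -> coercive s t Z (fun y => rayleigh U U2 beta c y + M).
Proof.
move=> P xoi Ux bk; have xi := subset_itv_oo_cc xoi.
have [B B0 hB] := profile_bounds P.
have [d1 d10 right] := profile_log_half P xoi Ux bk.
have xoi' : - x \in `]- b, - a[.
  by move: xoi; rewrite !in_itv/= !ltrN2 andbC.
have Ux' : U (- - x) = m by rewrite opprK.
have bk' : beta <= U2 (- - x) by rewrite opprK.
have [d2 d20 left] := profile_log_half (profile_opp P) xoi' Ux' bk'.
have [m0 m1 m2] : [/\ 0 < Num.min d1 d2, Num.min d1 d2 <= d1 & Num.min d1 d2 <= d2].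
  by rewrite lt_min d10 d20 !ge_min !lexx orbT.
exists (Num.min d1 d2) => // s t as_ tb xs sx xt tx.
have [M1 M10 h1] := right t xt tb (lt_le_trans tx (lerD (lexx x) m1)).
have sx' : - x < - s by rewrite ltrN2.
have sa : - s <= - a by rewrite lerN2.
have sd : - s < - x + d2 by move: xs m2; clear; lra.
have [M2 M20 h2] := left (- s) sx' sa sd.
pose C := B + `|beta|; have C0 : 0 <= C by rewrite /C addr_ge0// ltW.
have M12 : 0 <= M1 + M2 + C by rewrite addr_ge0// addr_ge0.
exists (M1 + M2 + C) => // c cm.
have [mc|mc] := ltP (m - 1) c; last first.
  apply: coercive_nonneg => [|y yi]; first by rewrite ltW// (lt_trans sx).
  have yi' : y \in `[a, b] by apply: subset_itvScc yi.
  suff : - C <= rayleigh U U2 beta c y by move: M10 M20; clear; lra.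
  rewrite -[C]mulr1; apply: (@quotient_ge _ _ 1); rewrite ?mulr1//.
    by have := profile_min P yi'; move: mc; clear; lra.
  have [+ _ _ _ _] := hB x y xi yi'; rewrite ler_norml => /andP[h _].
  by have := ler_norm beta; move: h; rewrite /C; clear; lra.
move=> phi phi1 G G1 dphi dG _ le.
have rE : G x - U3 x / U2 x * ln (U x - c) * phi x ^+ 2 <= G t.
  have sub y : y \in `[x, t] -> y \in `[s, t].
    by apply: subset_itvScc => //; exact: ltW.
  have dphi' y (yi : y \in `[x, t]) := dphi y (sub y yi).
  have dG' y (yi : y \in `[x, t]) := dG y (sub y yi).
  have le' y (yi : y \in `[x, t]) := le y (sub y yi).
  have MM : M1 <= M1 + M2 + C by move: M20 C0; clear; lra.
  exact: h1 mc cm MM dphi' dG' le'.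
have lE : - G x + U3 x / U2 x * ln (U x - c) * phi x ^+ 2 <= - G s.
  have sub y : y \in `[- x, - s] -> - y \in `[s, t].
    by rewrite -opp_itv; apply: subset_itvScc => //; exact: ltW.
  have dphi' y (yi : y \in `[- x, - s]) := drv_reflect (dphi _ (sub y yi)).
  have dG' y : y \in `[- x, - s] -> is_derive y 1 (fun y => - G (- y)) (G1 (- y)).
    by move=> yi; apply: (drv_eq (drvN (drv_reflect (dG _ (sub y yi))))); rewrite opprK.
  have le' y : y \in `[- x, - s] -> (- phi1 (- y)) ^+ 2 +
      (rayleigh (fun y => U (- y)) (fun y => U2 (- y)) beta c y + (M1 + M2 + C)) *
      phi (- y) ^+ 2 <= G1 (- y).
    by move=> yi; rewrite sqrrN; exact: le _ (sub y yi).
  have MM : M2 <= M1 + M2 + C by move: M10 C0; clear; lra.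
  have := h2 _ _ _ _ _ _ mc cm MM dphi' dG' le'.
  by rewrite !opprK !mulNr opprK.
by move: rE lE; clear; lra.
Qed.

Lemma profile_coercive a b U U1 U2 U3 m (beta : R) : profile a b U U1 U2 U3 m ->
  (forall x, x \in `[a, b] -> U x = m -> U1 x = 0 -> beta <= 9 / 8 * U2 x) ->
  exists2 M : R, 0 <= M & forall c, c < m ->
  coercive a b [set x | x = a \/ x = b \/ (U x = m /\ U2 x - beta < 0)]
    (fun y => rayleigh U U2 beta c y + M).
Proof.
move=> P hbeta; set Z := [set x | _].
apply: (@interval_glue _ (fun s t => exists2 M : R, 0 <= M &
  forall c, c < m -> coercive s t Z (fun y => rayleigh U U2 beta c y + M)) a b (profile_lt P)).
  move=> s r t _ sr rt _ [M1 M10 h1] [M2 M20 h2].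
  exists (M1 + M2); first exact: addr_ge0.
  move=> c cm; apply: (coercive_cat (ltW sr) (ltW rt)).
    by apply: coercive_mono (h1 c cm) => // x _; lra.
  by apply: coercive_mono (h2 c cm) => // x _; lra.
move=> x xi; have [Zx|nZx] := pselect (Z x).
  have [d [K [d0 K0 h]]] := profile_hardy P xi (hbeta x xi).
  have K1 : 0 < 3 * (K + 1) by lra.
  pose d' := Num.min d (3 * (K + 1))^-1.
  have [e0 e1 e2] : [/\ 0 < d', d' <= d & d' <= (3 * (K + 1))^-1].
    by rewrite /d' lt_min d0 invr_gt0 K1 !ge_min !lexx orbT.
  exists d' => // s t as_ tb st xs sx _ xt tx _.
  exists 0 => // c cm.
  apply: (@coercive_mono _ _ _ [set x] _ (rayleigh U U2 beta c)).
  - by move=> y _ /= ->.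
  - by move=> y _; rewrite addr0.
  apply: (@hardy _ a b x _ K d') => //.
    move: e2; rewrite -[(_)^-1]mul1r ler_pdivlMr// => e2.
    by have := ltW e0; lra.
  by move=> y yi y0 yd; apply: h => //; exact: lt_le_trans yd e1.
have [Ux|Ux] := eqVneq (U x) m; last first.
  have [d [e [d0 e0 h]]] := profile_above P xi Ux.
  have [B B0 hB] := profile_bounds P.
  exists d => // s t as_ tb st xs sx _ xt tx _.
  have C0 : 0 <= B + `|beta| by rewrite addr_ge0// ltW.
  exists ((B + `|beta|) / e); first by rewrite divr_ge0// ltW.
  move=> c cm; apply: coercive_nonneg => [|y]; first exact: ltW.
  rewrite in_itv/= => /andP[sy yt]; have yi : y \in `[a, b] by apply: in_cc; lra.
  suff : - ((B + `|beta|) / e) <= rayleigh U U2 beta c y by lra.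
  apply: (quotient_ge e0).
  - have yd : `|y - x| < d by rewrite ltr_norml; apply/andP; split; lra.
    by have := h y yi yd; lra.
  - by rewrite divr_ge0// ltW.
  - rewrite mulfVK ?gt_eqF//.
    have [+ _ _ _ _] := hB x y xi yi; rewrite ler_norml => /andP[hh _].
    by have := ler_norm beta; lra.
have xa : x != a by apply/eqP => xa; apply: nZx; left.
have xb : x != b by apply/eqP => xb; apply: nZx; right; left.
have xoi : x \in `]a, b[.
  by move: xi; rewrite !in_itv/= !lt_neqAle xb eq_sym xa.
have bk : beta <= U2 x.
  by rewrite leNgt; apply/negP => bk; apply: nZx; right; right; split=> //; lra.
have [d d0 h] := profile_log Z P xoi Ux bk.
exists d => // s t as_ tb st xs sx sxa xt tx txb.
apply: h => //; rewrite lt_neqAle.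
  by rewrite sx andbT; apply/eqP => e; move/eqP: xa; apply; exact: sxa.
by rewrite xt andbT; apply/eqP => e; move/eqP: xb; apply; exact/txb/esym.
Qed.

End Log.

(** * Oscillation as c tends to the minimum *)

Section Osc.
Context {R : realType}.
Implicit Types (f g h p q w P : R -> R) (a b s t x y c : R) (Z : set R).

Definition below (m : R) (Q : R -> Prop) : Prop :=
  exists2 e : R, 0 < e & forall c, m - e < c -> c < m -> Q c.

Lemma belowI m (Q Q' : R -> Prop) : below m Q -> below m Q' ->
  below m (fun c => Q c /\ Q' c).
Proof.
move=> [e e0 h] [e' e'0 h']; exists (Num.min e e'); first by rewrite lt_min e0.
move=> c; have [m1 m2] : Num.min e e' <= e /\ Num.min e e' <= e' by rewrite !ge_min !lexx orbT.
by move=> c1 c2; split; [apply: h|apply: h'] => //; lra.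
Qed.

Lemma belowS m (Q Q' : R -> Prop) : (forall c, c < m -> Q c -> Q' c) ->
  below m Q -> below m Q'.
Proof. by move=> QQ [e e0 h]; exists e => // c c1 c2; apply: QQ => //; exact: h. Qed.

Lemma belowT m (Q : R -> Prop) : (forall c, c < m -> Q c) -> below m Q.
Proof. by move=> h; exists 1 => // c _; exact: h. Qed.

Lemma growth_le f (f' : R -> R) s t (K : R) : s <= t ->
  (forall y, y \in `[s, t] -> is_derive y 1 f (f' y)) ->
  (forall y, y \in `[s, t] -> f' y <= K) -> f t - f s <= K * (t - s).
Proof.
move=> st df fK.
have dF y : y \in `[s, t] -> is_derive y 1 (fun y => K * y - f y) (K * 1 - f' y).
  by move=> yi; exact: drvB (drvZ K (drv_id y)) (df y yi).
have F0 y : y \in `]s, t[ -> 0 <= K * 1 - f' y.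
  by move=> /subset_itv_oo_cc /fK; lra.
by have := drv_monotone st dF F0; lra.
Qed.

(** Along a Riccati solution w, the function w phi^2 with
    phi = l^2 - (y - x)^2 vanishes at both ends and has derivative at most
    P phi^2 + phi'^2, which is at most H1 and, near x, very negative. *)
Lemma conjugate_well P x (l e H1 H2 : R) : 0 < e -> e <= l -> 0 <= H1 ->
  (forall y, `|y - x| <= l ->
    P y * (l ^+ 2 - (y - x) ^+ 2) ^+ 2 + 4 * (y - x) ^+ 2 <= H1) ->
  (forall y, `|y - x| <= e ->
    P y * (l ^+ 2 - (y - x) ^+ 2) ^+ 2 + 4 * (y - x) ^+ 2 <= H1 - H2 / e ^+ 2) ->
  e * (l * H1) < H2 -> conjugate P (x - l) (x + l).
Proof.
move=> e0 el H10 h1 h2 h3 w dw.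
pose phi y := l ^+ 2 - (y - x) ^+ 2.
have dd (y : R) : is_derive y 1 (fun y => y - x) 1.
  by apply: (drv_eq (drvB (drv_id y) (drv_cst x y))); rewrite subr0.
have dphi (y : R) : is_derive y 1 phi (0 - 2 * (y - x) * 1).
  exact: drvB (drv_cst _ y) (drv_sqr (dd y)).
pose F y := w y * phi y ^+ 2.
pose F1 y := (P y - w y ^+ 2) * phi y ^+ 2 + w y * (2 * phi y * (0 - 2 * (y - x) * 1)).
have dF y : y \in `[x - l, x + l] -> is_derive y 1 F (F1 y).
  by move=> yi; exact: drvM (dw y yi) (drv_sqr (dphi y)).
have F1le y : F1 y <= P y * phi y ^+ 2 + 4 * (y - x) ^+ 2.
  have := sqr_ge0 (w y * phi y + 2 * (y - x)).
  have -> : (w y * phi y + 2 * (y - x)) ^+ 2 = w y ^+ 2 * phi y ^+ 2 +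
    4 * (y - x) * (w y * phi y) + 4 * (y - x) ^+ 2 by ring.
  have -> : F1 y = P y * phi y ^+ 2 - w y ^+ 2 * phi y ^+ 2 - 4 * (y - x) * (w y * phi y).
    by rewrite /F1; ring.
  by lra.
have sub (u v : R) : - l <= u -> v <= l -> forall y, y \in `[x + u, x + v] -> y \in `[x - l, x + l].
  by move=> lu vl y; rewrite !in_itv/= => /andP[? ?]; lra.
have seg (u v K : R) : - l <= u -> u <= v -> v <= l ->
    (forall y, y \in `[x + u, x + v] -> F1 y <= K) -> F (x + v) - F (x + u) <= K * (v - u).
  move=> lu uv vl FK; have -> : v - u = (x + v) - (x + u) by ring.
  have duv y (yi : y \in `[x + u, x + v]) := dF y (sub u v lu vl y yi).
  have xuv : x + u <= x + v by rewrite lerD2l.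
  exact: growth_le xuv duv FK.
have g1 : F (x - e) - F (x - l) <= H1 * (- e - - l).
  apply: seg; [lra|lra|lra|] => y; rewrite in_itv/= => /andP[y1 y2].
  by apply: le_trans (F1le y) (h1 y _); rewrite ler_norml; lra.
have g2 : F (x + e) - F (x - e) <= (H1 - H2 / e ^+ 2) * (e - - e).
  apply: seg; [lra|lra|lra|] => y; rewrite in_itv/= => /andP[y1 y2].
  by apply: le_trans (F1le y) (h2 y _); rewrite ler_norml; lra.
have g3 : F (x + l) - F (x + e) <= H1 * (l - e).
  apply: seg; [lra|lra|lra|] => y; rewrite in_itv/= => /andP[y1 y2].
  by apply: le_trans (F1le y) (h1 y _); rewrite ler_norml; lra.
have Fl : F (x + l) = 0 by rewrite /F /phi; ring.
have Fl' : F (x - l) = 0 by rewrite /F /phi; ring.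
have e3 : H2 / e ^+ 2 * (e - - e) = 2 * (H2 / e) by field; rewrite gt_eqF.
have : l * H1 < H2 / e by rewrite ltr_pdivlMr// mulrC.
by move: g1 g2 g3; rewrite Fl Fl' mulrBl e3; lra.
Qed.

(** The well has half width e = sqrt (m - c) and depth of order 1 / e^2, so it
    lowers w phi^2 by an amount of order 1 / e, which outweighs the bounded terms
    when e is small. *)
Lemma profile_well a b U U1 U2 U3 m (beta A : R) x s r :
  profile a b U U1 U2 U3 m -> x \in `]a, b[ -> U x = m -> U2 x - beta < 0 ->
  a <= s -> s < x -> x < r -> r <= b ->
  below m (fun c => osc (fun y => rayleigh U U2 beta c y + A) 1 s r).
Proof.
move=> P xoi Ux bk as_ sx xr rb; have xi := subset_itv_oo_cc xoi.
have U1x := profile_interior P xoi Ux.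
have [B B0 hB] := profile_bounds P.
pose eta := (beta - U2 x) / 2; have eta0 : 0 < eta by rewrite /eta; lra.
pose l := Num.min (eta / B) (Num.min ((x - s) / 2) ((r - x) / 2)).
have l0 : 0 < l by rewrite !lt_min divr_gt0//=; apply/andP; split; lra.
have l1 : l <= eta / B by rewrite /l !ge_min lexx.
have l2 : l <= (x - s) / 2 by rewrite /l !ge_min lexx orbT.
have l3 : l <= (r - x) / 2 by rewrite /l !ge_min lexx !orbT.
rewrite ler_pdivlMr// in l1.
pose H1 := `|A| * l ^+ 4 + 4 * l ^+ 2.
have H10 : 0 <= H1 by rewrite addr_ge0// mulr_ge0// exprn_ge0// ltW.
pose H2 := eta * l ^+ 4 / (2 * (B + 1)).
have H20 : 0 < H2 by rewrite divr_gt0 ?mulr_gt0 ?exprn_gt0//; lra.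
have lH : 0 < l * H1 + 1 by rewrite ltr_wpDl// mulr_ge0// ltW.
pose e0 := Num.min (l / 2) (H2 / (l * H1 + 1)).
have e00 : 0 < e0 by rewrite lt_min; apply/andP; split; exact: divr_gt0.
exists (e0 ^+ 2); first by rewrite exprn_gt0.
move=> c c1 c2; pose e := Num.sqrt (m - c).
have e_gt0 : 0 < e by rewrite sqrtr_gt0 subr_gt0.
have ee : e ^+ 2 = m - c by rewrite sqr_sqrtr ?subr_ge0 ?ltW.
have e_e0 : e < e0.
  by rewrite -(ltr_pXn2r (n := 2)) ?nnegrE ?ltW//; rewrite ee; lra.
have el : e <= l / 2 by apply/ltW/(lt_le_trans e_e0); rewrite /e0 ge_min lexx.
have eH : e < H2 / (l * H1 + 1).
  by apply/(lt_le_trans e_e0); rewrite /e0 ge_min lexx orbT.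
rewrite ltr_pdivlMr// in eH.
have basic y : `|y - x| <= l -> [/\ y \in `[a, b], U2 y - beta <= - eta,
    0 < U y - c & U y - c <= B * (y - x) ^+ 2 + e ^+ 2].
  move=> yl; have yi : y \in `[a, b].
    by move: yl; rewrite ler_norml => /andP[? ?]; apply: in_cc; lra.
  have [_ _ h2 h1 _] := hB x y xi yi.
  rewrite Ux U1x mul0r subr0 real_normK ?num_real// in h1.
  have h3 : B * `|y - x| <= eta by apply: le_trans l1; rewrite mulrC ler_pM2r.
  move: h1 h2; rewrite !ler_norml => /andP[_ h1] /andP[_ h2].
  by have := profile_min P yi; split => //; rewrite ?ee; rewrite /eta in h3 *; lra.
have phil y : `|y - x| <= l -> 0 <= l ^+ 2 - (y - x) ^+ 2 /\ (l ^+ 2 - (y - x) ^+ 2) ^+ 2 <= l ^+ 4.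
  move=> yl; have h : (y - x) ^+ 2 <= l ^+ 2.
    by rewrite -(real_normK (num_real (y - x))) lerXn2r ?nnegrE// ltW.
  have h' : 0 <= l ^+ 2 - (y - x) ^+ 2 by lra.
  split=> //; rewrite (exprM _ 2 2) lerXn2r ?nnegrE ?sqr_ge0//.
  by rewrite lerBlDr lerDl sqr_ge0.
have main y : `|y - x| <= l ->
    A * (l ^+ 2 - (y - x) ^+ 2) ^+ 2 + 4 * (y - x) ^+ 2 <= H1.
  move=> yl; have [ph ph2] := phil y yl.
  have h1 : A * (l ^+ 2 - (y - x) ^+ 2) ^+ 2 <= `|A| * l ^+ 4.
    apply: (@le_trans _ _ (`|A| * (l ^+ 2 - (y - x) ^+ 2) ^+ 2)).
      by rewrite ler_wpM2r ?sqr_ge0 ?ler_norm.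
    by rewrite ler_wpM2l.
  by rewrite /H1; lra.
apply: (@conjugate_osc _ _ s (x - l) (x + l) r); [lra|lra|lra|].
apply: (@conjugate_well _ x l e H1 H2) => //; first by lra.
- move=> y yl; have [yi h1 h2 h3] := basic y yl.
  have q0 : rayleigh U U2 beta c y <= 0.
    by rewrite /rayleigh mulr_le0_ge0 ?invr_ge0 ?ltW//; lra.
  have := mulr_le0_ge0 q0 (sqr_ge0 (l ^+ 2 - (y - x) ^+ 2)).
  by have := main y yl; rewrite mulrDl; lra.
- move=> y ye; have yl : `|y - x| <= l by lra.
  have [yi h1 h2 h3] := basic y yl.
  have h4 : (y - x) ^+ 2 <= e ^+ 2.
    by rewrite -(real_normK (num_real (y - x))) lerXn2r ?nnegrE// ltW.
  have B1 : 0 < B + 1 by lra.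
  have h5 : U y - c <= (B + 1) * e ^+ 2.
    by have := ler_wpM2l (ltW B0) h4; lra.
  have q1 : rayleigh U U2 beta c y <= - (eta / ((B + 1) * e ^+ 2)).
    rewrite /rayleigh ler_pdivrMr// mulNr lerNr.
    apply: (@le_trans _ _ eta); last by lra.
    by rewrite mulrAC ler_pdivrMr ?mulr_gt0 ?exprn_gt0// ler_pM2l.
  have h6 : l ^+ 4 / 2 <= (l ^+ 2 - (y - x) ^+ 2) ^+ 2.
    have e2 : e ^+ 2 <= l ^+ 2 / 4.
      have -> : l ^+ 2 / 4 = (l / 2) ^+ 2 by field.
      by rewrite lerXn2r ?nnegrE ?divr_ge0// ltW.
    have h7 : 3 / 4 * l ^+ 2 <= l ^+ 2 - (y - x) ^+ 2 by lra.
    have l20 : 0 <= l ^+ 2 by exact: sqr_ge0.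
    apply: (@le_trans _ _ ((3 / 4 * l ^+ 2) ^+ 2)).
      have -> : (3 / 4 * l ^+ 2) ^+ 2 = 9 / 16 * l ^+ 4 by field.
      have : 0 <= l ^+ 4 by rewrite exprn_ge0// ltW.
      by lra.
    by rewrite lerXn2r ?nnegrE//; lra.
  have h8 : rayleigh U U2 beta c y * (l ^+ 2 - (y - x) ^+ 2) ^+ 2 <= - (H2 / e ^+ 2).
    have K0 : 0 < eta / ((B + 1) * e ^+ 2).
      by apply: divr_gt0 => //; apply: mulr_gt0 => //; exact: exprn_gt0.
    apply: (le_trans (ler_wpM2r (sqr_ge0 _) q1)).
    rewrite mulNr lerN2; apply: (@le_trans _ _ (eta / ((B + 1) * e ^+ 2) * (l ^+ 4 / 2))).
      by rewrite /H2 le_eqVlt; apply/orP; left; apply/eqP; field; rewrite !gt_eqF.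
    by rewrite ler_pM2l.
  by have := main y yl; rewrite mulrDl; lra.
- by apply: lt_trans eH; rewrite ltr_pM2l// ltrDl.
Qed.

Lemma profile_wells a b U U1 U2 U3 m (beta A : R) (zs : seq R) s :
  profile a b U U1 U2 U3 m ->
  {in zs, forall z, [/\ z \in `]a, b[, U z = m & U2 z - beta < 0]} ->
  a <= s -> s < b -> path <%R s zs ->
  below m (fun c => osc (fun y => rayleigh U U2 beta c y + A) (size zs) s b).
Proof.
move=> P; elim: zs s => [|z zs IH] s hz as_ sb.
  by move=> _; apply: belowT => c _; exact: osc0.
move=> /= /andP[sz pz]; have [zi Uz bz] := hz z (mem_head _ _).
have [az zb] : a < z /\ z < b by move: zi; rewrite in_itv/= => /andP[].
have [r [zr rb pr]] : exists r, [/\ z < r, r < b & path <%R r zs].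
  case: zs pz hz {IH} => [|z' zs] /=.
    by move=> _ _; exists ((z + b) / 2); split=> //; lra.
  move=> /andP[zz' ->] hz; exists ((z + z') / 2); rewrite andbT.
  have [|+ _ _] := hz z'; first by rewrite !in_cons eqxx orbT.
  by rewrite in_itv/= => /andP[_ z'b]; split; lra.
have hz' : {in zs, forall z, [/\ z \in `]a, b[, U z = m & U2 z - beta < 0]}.
  by move=> z' z'i; apply: hz; rewrite in_cons z'i orbT.
have ar : a <= r by lra.
have w1 := profile_well A P zi Uz bz as_ sz zr (ltW rb).
move: (belowI w1 (IH r hz' ar rb pr)); apply: belowS => c _ [h1 h2].
by rewrite /= -add1n; apply: osc_cat h1 h2; lra.
Qed.


Lemma conjugate_opp P s t : conjugate (fun y => P (- y)) (- t) (- s) ->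
  conjugate P s t.
Proof.
move=> cj w dw.
have dw' y : y \in `[- t, - s] ->
    is_derive y 1 (fun y => - w (- y)) (P (- y) - (- w (- y)) ^+ 2).
  rewrite -opp_itv => yi.
  by apply: (drv_eq (drvN (drv_reflect (dw _ yi)))); rewrite opprK sqrrN.
exact: cj dw'.
Qed.

(** For v = (y - x) w the Riccati equation gives
    (y - x) v' <= - ((v - 1/2)^2 + mu^2), so that
    atan ((v - 1/2) / mu) + mu ln (y - x) does not increase; over a ratio
    expR (pi / mu) of distances atan would lose pi. *)
Lemma conjugate_inverse_square P x (r mu : R) : 0 < r -> 0 < mu ->
  (forall y, r <= y - x -> y - x <= r * expR (pi / mu) ->
    P y * (y - x) ^+ 2 <= - (1 / 4 + mu ^+ 2)) ->
  conjugate P (x + r) (x + r * expR (pi / mu)).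
Proof.
move=> r0 mu0 hP w dw; pose t := r * expR (pi / mu).
have e1 : 1 <= expR (pi / mu).
  by rewrite -[leLHS]expR0 ler_expR divr_ge0 ?pi_ge0// ltW.
have rt : r <= t by rewrite /t ler_peMr// ltW.
pose v y := (y - x) * w y.
pose v1 y := 1 * w y + (y - x) * (P y - w y ^+ 2).
pose z y := (v y - 1 / 2) * mu^-1.
have dd (y : R) : is_derive y 1 (fun y => y - x) 1.
  by apply: (drv_eq (drvB (drv_id y) (drv_cst x y))); rewrite subr0.
pose F y := - (atan (z y) + mu * ln (y - x)).
pose F1 y := - ((v1 y * mu^-1) / (1 + z y ^+ 2) + mu * (1 / (y - x))).
have pos y : y \in `[x + r, x + t] -> 0 < y - x.
  by rewrite in_itv/= => /andP[h _]; lra.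
have dz y : y \in `[x + r, x + t] -> is_derive y 1 z (v1 y * mu^-1).
  move=> yi; have dv : is_derive y 1 v (v1 y) := drvM (dd y) (dw y yi).
  by apply: (drv_eq (drvM (drvB dv (drv_cst (1 / 2) y)) (drv_cst mu^-1 y))); ring.
have dF y : y \in `[x + r, x + t] -> is_derive y 1 F (F1 y).
  move=> yi; exact: drvN (drvD (drv_atan (dz y yi)) (drvZ mu (drv_ln (dd y) (pos y yi)))).
have F0 y : y \in `]x + r, x + t[ -> 0 <= F1 y.
  move=> yi; have yi' := subset_itv_oo_cc yi; have d0 := pos y yi'.
  move: yi'; rewrite in_itv/= => /andP[y1 y2].
  have hp := hP y ltac:(lra) ltac:(rewrite -/t; lra).
  have D0 : 0 < mu ^+ 2 + (v y - 1 / 2) ^+ 2.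
    by rewrite ltr_pwDl ?sqr_ge0// exprn_gt0.
  have -> : F1 y = (- (v1 y * (y - x)) - (mu ^+ 2 + (v y - 1 / 2) ^+ 2)) *
      (mu / ((y - x) * (mu ^+ 2 + (v y - 1 / 2) ^+ 2))).
    rewrite /F1 /z; field; rewrite !gt_eqF//=.
    have -> : mu ^+ 2 * 4 + (v y * 2 - 1) ^+ 2 = 4 * (mu ^+ 2 + (v y - 1 / 2) ^+ 2) by field.
    by rewrite mulr_gt0.
  apply: mulr_ge0; last by apply: divr_ge0; [exact: ltW|apply: mulr_ge0; exact: ltW].
  have -> : v1 y * (y - x) = v y + P y * (y - x) ^+ 2 - v y ^+ 2 by rewrite /v1 /v; ring.
  have -> : (v y - 1 / 2) ^+ 2 = v y ^+ 2 - v y + 1 / 4 by field.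
  lra.
have : F (x + r) <= F (x + t).
  by apply: (drv_monotone _ dF F0); rewrite lerD2l.
have xr (u : R) : x + u - x = u by ring.
rewrite /F !xr /t lnM ?posrE ?expR_gt0// expRK.
have := atan_gtNpi2 (z (x + t)); have := atan_ltpi2 (z (x + r)).
have -> : mu * (ln r + pi / mu) = mu * ln r + pi by field; rewrite gt_eqF.
by rewrite /t; lra.
Qed.

(** When m - c <= eta r^2, the potential at the distances d >= r from x is at most
    - (1/4 + 2 nu) / d^2 for some nu > 0, thanks to the margin
    beta - 9/8 U2 x > 0; at small distances A is at most nu / d^2. *)
Lemma profile_supercritical a b U U1 U2 U3 m (beta A : R) x :
  profile a b U U1 U2 U3 m -> x \in `[a, b] -> U x = m -> U1 x = 0 ->
  9 / 8 * U2 x < beta -> forall t0, x < t0 -> t0 <= b ->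
  exists s t, [/\ x < s, s < t, t < t0 &
    below m (fun c => conjugate (fun y => rayleigh U U2 beta c y + A) s t)].
Proof.
move=> P xi Ux U1x bk t0 xt0 t0b; have [B B0 hB] := profile_bounds P.
have k0 := profile_pos P xi Ux U1x.
pose eta := (beta - 9 / 8 * U2 x) / 3; have eta0 : 0 < eta by rewrite /eta; lra.
pose K := U2 x / 2 + 2 * eta; have K0 : 0 < K by rewrite /K; lra.
pose nu := 3 * eta / 4 / K.
have nu0 : 0 < nu by rewrite /nu divr_gt0//; lra.
have nuK : nu * K = 3 * eta / 4 by rewrite /nu mulfVK// gt_eqF.
pose mu := Num.sqrt nu; have mu0 : 0 < mu by rewrite sqrtr_gt0.
have mu2 : mu ^+ 2 = nu by rewrite sqr_sqrtr// ltW.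
pose E : R := expR (pi / mu); have E0 : 0 < E by exact: expR_gt0.
have E1 : 1 < E by rewrite /E expR_gt1 divr_gt0 ?pi_gt0.
pose A1 := `|A| + 1; have A10 : 0 < A1 by rewrite /A1 ltr_wpDl.
pose d := Num.min (Num.min 1 (nu / A1)) (Num.min (eta / B) (t0 - x)).
have d0 : 0 < d.
  by rewrite !lt_min ltr01 subr_gt0 xt0 andbT; apply/andP; split; exact: divr_gt0.
have d1 : d <= 1 by rewrite /d !ge_min lexx.
have d2 : d <= nu / A1 by rewrite /d !ge_min lexx orbT.
have d3 : d <= eta / B by rewrite /d !ge_min lexx !orbT.
have d4 : d <= t0 - x by rewrite /d !ge_min lexx !orbT.
rewrite ler_pdivlMr// in d2; rewrite ler_pdivlMr// in d3.
pose r := d / 2 / E; have r0 : 0 < r by rewrite /r divr_gt0// divr_gt0.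
have rE : r * E = d / 2 by rewrite /r mulfVK// gt_eqF.
have rt : r < r * E by rewrite ltr_pMr.
exists (x + r), (x + r * E); split; [lra|lra|lra|].
exists (eta * r ^+ 2); first by rewrite mulr_gt0// exprn_gt0.
move=> c c1 c2; apply: conjugate_inverse_square => // y y1; rewrite -/E rE => y2.
set z := y - x in y1 y2 *; have z0 : 0 < z by lra.
have yi : y \in `[a, b].
  by move: xi; rewrite !in_itv/= /z in y1 y2 * => /andP[? ?]; lra.
have [_ _ h2 _ h3] := hB x y xi yi; have my := profile_min P yi.
rewrite Ux U1x mul0r subr0 -/z (gtr0_norm z0) in h2 h3.
have zd : z <= d by lra.
have Bz : B * z <= eta by apply: le_trans d3; rewrite mulrC ler_pM2r.
have z2 : 0 < z ^+ 2 by rewrite exprn_gt0.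
have rz : r ^+ 2 <= z ^+ 2 by rewrite lerXn2r ?nnegrE// ltW.
have N1 : U2 y - beta <= - (U2 x / 8 + 2 * eta).
  by move: h2; rewrite ler_norml /eta in Bz * => /andP[_ h2]; lra.
have D0 : 0 < U y - c by lra.
have D1 : U y - c <= K * z ^+ 2.
  move: h3; rewrite ler_norml (exprSr _ 2) => /andP[_ h3].
  have h4 := ler_wpM2r (ltW z2) Bz; have h5 := ler_wpM2l (ltW eta0) rz.
  by rewrite /K; lra.
have q1 : rayleigh U U2 beta c y * z ^+ 2 <= - (1 / 4 + 2 * nu).
  rewrite /rayleigh mulrAC ler_pdivrMr// mulNr lerNr.
  have w0 : 0 <= 1 / 4 + 2 * nu by lra.
  apply: (le_trans (ler_wpM2l w0 D1)).
  have -> : (1 / 4 + 2 * nu) * (K * z ^+ 2) = (K / 4 + 2 * (nu * K)) * z ^+ 2 by field.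
  rewrite nuK -mulNr; apply: ler_wpM2r; first exact: ltW.
  by rewrite /K; lra.
have A2 : A * z ^+ 2 <= nu.
  have zz : z ^+ 2 <= z by rewrite expr2 ler_piMr; lra.
  have h : A * z ^+ 2 <= A1 * z.
    apply: (@le_trans _ _ (`|A| * z ^+ 2)).
      by rewrite ler_wpM2r ?ler_norm// ltW.
    have := ler_wpM2l (normr_ge0 A) zz; rewrite /A1; lra.
  have := ler_wpM2l (ltW A10) zd; lra.
by rewrite mulrDl mu2; lra.
Qed.

(** Infinitely many disjoint conjugate intervals accumulate at x. *)
Lemma osc_cluster_right b (PP : R -> R -> R) m x : x < b ->
  (forall t0, x < t0 -> t0 <= b -> exists s t, [/\ x < s, s < t, t < t0 &
    below m (fun c => conjugate (PP c) s t)]) ->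
  forall n t0, x < t0 -> t0 <= b -> exists s0, [/\ x < s0, s0 < t0 &
    below m (fun c => osc (PP c) n s0 t0)].
Proof.
move=> xb hc; elim=> [|n IH] t0 xt0 t0b.
  by exists ((x + t0) / 2); split; [lra|lra|apply: belowT => c _; apply: osc0; lra].
have [s [t [xs st tt0 hst]]] := hc t0 xt0 t0b.
pose r := (x + s) / 2.
have [xr rs rb] : [/\ x < r, r < s & r <= b] by rewrite /r; split; lra.
have [s0 [xs0 s0r hs0]] := IH r xr rb.
exists s0; split; [by []|lra|].
move: (belowI hs0 hst); apply: belowS => c _ [h1 h2]; rewrite -addn1.
apply: osc_cat h1 (conjugate_osc rs st tt0 h2); lra.
Qed.

Lemma osc_cluster_left a (PP : R -> R -> R) m x : a < x ->
  (forall s0, s0 < x -> a <= s0 -> exists s t, [/\ s0 < s, s < t, t < x &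
    below m (fun c => conjugate (PP c) s t)]) ->
  forall n s0, s0 < x -> a <= s0 -> exists t0, [/\ s0 < t0, t0 < x &
    below m (fun c => osc (PP c) n s0 t0)].
Proof.
move=> ax hc; elim=> [|n IH] s0 s0x as0.
  by exists ((s0 + x) / 2); split; [lra|lra|apply: belowT => c _; apply: osc0; lra].
have [s [t [s0s st tx hst]]] := hc s0 s0x as0.
pose r := (t + x) / 2.
have [rx tr ar] : [/\ r < x, t < r & a <= r] by rewrite /r; split; lra.
have [t0 [rt0 t0x ht0]] := IH r rx ar.
exists t0; split; [lra|by []|].
move: (belowI hst ht0); apply: belowS => c _ [h1 h2]; rewrite -add1n.
apply: osc_cat (conjugate_osc s0s st tr h1) h2; lra.
Qed.

Lemma profile_supercritical_osc a b U U1 U2 U3 m (beta A : R) x n :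
  profile a b U U1 U2 U3 m -> x \in `[a, b] -> U x = m -> U1 x = 0 ->
  9 / 8 * U2 x < beta ->
  below m (fun c => osc (fun y => rayleigh U U2 beta c y + A) n a b).
Proof.
move=> P xi Ux U1x bk; have ab := profile_lt P.
move: (xi); rewrite in_itv/= => /andP[ax xb].
have [xb'|bx] := ltP x b.
  have [s0 [xs0 s0b h]] := osc_cluster_right xb'
    (profile_supercritical A P xi Ux U1x bk) n xb' (lexx b).
  move: h; apply: belowS => c _ o; rewrite -[n]add0n.
  have as0 : a < s0 by lra.
  exact: osc_cat (ltW as0) (ltW s0b) (osc0 as0) o.
have ax' : a < x by lra.
have P' := profile_opp P.
have xi' : - x \in `[- b, - a] by rewrite opp_itv !opprK.
have Ux' : U (- - x) = m by rewrite opprK.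
have U1x' : - U1 (- - x) = 0 by rewrite opprK U1x oppr0.
have bk' : 9 / 8 * U2 (- - x) < beta by rewrite opprK.
have hleft s0 : s0 < x -> a <= s0 -> exists s t, [/\ s0 < s, s < t, t < x &
    below m (fun c => conjugate (fun y => rayleigh U U2 beta c y + A) s t)].
  move=> s0x as0; have xs0 : - x < - s0 by lra.
  have s0a : - s0 <= - a by lra.
  have [s [t [xs st ts h]]] := profile_supercritical A P' xi' Ux' U1x' bk' xs0 s0a.
  exists (- t), (- s); split; [lra|lra|lra|].
  move: h; apply: belowS => c _ hc; apply: conjugate_opp; rewrite !opprK.
  exact: hc.
have [t0 [at0 t0x h]] := osc_cluster_left ax' hleft n ax' (lexx a).
move: h; apply: belowS => c _ o; rewrite -[n]addn0.
have t0b : t0 < b by lra.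
exact: osc_cat (ltW at0) (ltW t0b) o (osc0 t0b).
Qed.

End Osc.

(** * The spectral statements *)

Section Main.
Context {R : realType}.
Implicit Types (f g h p q w u v P : R -> R) (a b s t x y c : R) (Z : set R).
Notation mu := (@lebesgue_measure R).

Lemma Sobolev_profile a b u : a < b -> Sobolev a b 4 u ->
  (forall y, y \in `[a, b] -> D a b u y = 0 -> D a b (D a b u) y <> 0) ->
  exists U U1 U2 U3 : R -> R, [/\ profile a b U U1 U2 U3 (umin a b u),
    {in `[a, b], U =1 u}, {in `[a, b], U1 =1 D a b u} &
    {in `[a, b], U2 =1 D a b (D a b u)}].
Proof.
move=> ab [u1 [[u2 [[u3 [S1 e2]] e1]] e0]] crit; have ab' := ltW ab.
have [_ /(_ isT)[H H0 hH]] := @Sobolev_holder R a b 1 u3 ab' S1.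
pose U3 := u3 \o clamp a b.
have [U2 d2 h2] := @C1_extension R a b u2 u3 U3 ab' (holder_cont H0 hH)
  (fun x xi => congr1 u3 (clamp_id xi)) e2.
have [U1 d1 h1] := C1_extension ab' (fun x => drv_continuous (d2 x)) h2 e1.
have [U d0 h0] := C1_extension ab' (fun x => drv_continuous (d1 x)) h1 e0.
have D1 x : x \in `[a, b] -> D a b u x = U1 x.
  by move=> xi; exact: D_eq ab xi (d0 x) h0.
have D2 x : x \in `[a, b] -> D a b (D a b u) x = U2 x.
  by move=> xi; rewrite (D_ext xi D1); exact: D_eq ab xi (d1 x) _.
exists U, U1, U2, U3; split=> //.
- split=> //; first by exists H.
  + have [B B0 hB] := cont_bounded (fun x => drv_continuous (d0 x)) ab'.
    move=> x xi; apply: ge_inf; last by exists x => //; rewrite h0.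
    exists (- B) => _ [z /= zi <-]; have := hB z zi; rewrite h0// ler_norml.
    by case/andP.
  + by move=> x xi; rewrite -D1// -D2//; exact: crit.
- by move=> x xi; rewrite D1.
- by move=> x xi; rewrite D2.
Qed.

Lemma osc_ext P P' n s t : (forall x, x \in `[s, t] -> P x = P' x) ->
  osc P n s t -> osc P' n s t.
Proof.
move=> PP o th k dth; apply: o => x xi.
by apply: (drv_eq (dth x xi)); rewrite PP.
Qed.

Lemma rayleigh_continuous a b U U1 U2 U3 m (beta c : R) : profile a b U U1 U2 U3 m ->
  c < m -> continuous (rayleigh U U2 beta c \o clamp a b).
Proof.
move=> P cm; apply: cont_clamp; first exact/ltW/(profile_lt P).
move=> x xi; have Uc : U x - c != 0.
  by rewrite gt_eqF// subr_gt0 (lt_le_trans cm)// (profile_min P).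
apply: cvgM.
  by apply: cvgB; [exact: drv_continuous (profile_d2 P x)|exact: cvg_cst].
apply: cvgV => //.
by apply: cvgB; [exact: drv_continuous (profile_d P x)|exact: cvg_cst].
Qed.

Section Plus.
Context (a b : R) (u : R -> R) (ab : a < b) (hu : Sobolev a b 4 u)
  (crit : forall y, y \in `[a, b] -> D a b u y = 0 -> D a b (D a b u) y <> 0).

(** Reduction of upper bounds for the n-th eigenvalue to the oscillation of the
    Pruefer angle, with the C^3 extension of u in place of u. *)
Lemma lambda_le (beta A : R) n :
  (forall U U1 U2 U3, profile a b U U1 U2 U3 (umin a b u) ->
    {in `[a, b], U =1 u} -> {in `[a, b], U1 =1 D a b u} ->
    {in `[a, b], U2 =1 D a b (D a b u)} ->
    below (umin a b u) (fun c => osc (fun y => rayleigh U U2 beta c y + - A) n.+1 a b)) ->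
  below (umin a b u) (fun c => lambda a b u beta n.+1 c <= A).
Proof.
have [U [U1 [U2 [U3 [P h0 h1 h2]]]]] := Sobolev_profile ab hu crit.
move=> /(_ U U1 U2 U3 P h0 h1 h2); apply: belowS => c cm o; rewrite /lambda /=.
apply: (nth_eigenvalue_upper ab (rayleigh_continuous (beta := beta) P cm)).
  by move=> x /subset_itv_oo_cc xi; rewrite /= clamp_id// /rayleigh h0// h2.
by apply: osc_ext o => x xi; rewrite /= clamp_id.
Qed.

Let negative_minima (beta : R) := [set x | [/\ x \in `]a, b[, u x = umin a b u &
  D a b (D a b u) x - beta < 0]].

Lemma negative_minima_finite beta : finite_set (negative_minima beta).
Proof.
have [U [U1 [U2 [U3 [P h0 h1 h2]]]]] := Sobolev_profile ab hu crit.
apply: sub_finite_set (profile_finite P) => x [xi ux _].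
by have xi' := subset_itv_oo_cc xi; split=> //; rewrite h0.
Qed.

Lemma kappa_plus_subcritical beta : (beta%:E <= (9 / 8)%:E * kappa_plus a b u)%E ->
  forall U U1 U2 U3 : R -> R, {in `[a, b], U =1 u} -> {in `[a, b], U1 =1 D a b u} ->
    {in `[a, b], U2 =1 D a b (D a b u)} ->
  forall x, x \in `[a, b] -> U x = umin a b u -> U1 x = 0 -> beta <= 9 / 8 * U2 x.
Proof.
move=> bk U U1 U2 U3 h0 h1 h2 x xi Ux U1x; rewrite -lee_fin EFinM.
apply: (le_trans bk); rewrite lee_pmul2l//.
by apply: ereal_inf_lbound; exists x; [split=> //; rewrite -?h1// -h0|rewrite h2].
Qed.

Lemma lambda_below_diverges beta n : (1 <= n <= m_plus a b u beta)%N -> forall A : R,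
  below (umin a b u) (fun c => lambda a b u beta n c <= A).
Proof.
case: n => [//|n] /andP[_ nm] A; apply: lambda_le => U U1 U2 U3 P h0 h1 h2.
have fS := negative_minima_finite beta.
pose s := sort <=%R (fset_set (negative_minima beta)).
have sE x : (x \in s) = (x \in negative_minima beta) by rewrite mem_sort in_fset_set.
have sS : {in s, forall z, [/\ z \in `]a, b[, U z = umin a b u & U2 z - beta < 0]}.
  move=> z; rewrite sE => /set_mem[zi uz bz]; have zi' := subset_itv_oo_cc zi.
  by rewrite h0// h2.
have ps : path <%R a s.
  have ss : sorted <%R s by rewrite sort_lt_sorted fset_uniq.
  case: s ss sS {sE} => //= z s' ss sS; rewrite ss andbT.
  by have [] := sS z (mem_head _ _); rewrite in_itv/= => /andP[].
have := profile_wells (- A) P sS (lexx a) ab ps.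
apply: belowS => c _; apply: oscS.
by rewrite size_sort.
Qed.

Lemma lambda_below_bounded beta : (beta%:E <= (9 / 8)%:E * kappa_plus a b u)%E ->
  exists M : R, forall c, c < umin a b u ->
    M <= lambda a b u beta (m_plus a b u beta).+1 c.
Proof.
move=> bk; have [U [U1 [U2 [U3 [P h0 h1 h2]]]]] := Sobolev_profile ab hu crit.
have [M M0 hM] := profile_coercive P (kappa_plus_subcritical bk U3 h0 h1 h2).
exists (- M) => c cm; have cq := rayleigh_continuous (beta := beta) P cm.
pose zs : seq R := fset_set (negative_minima beta).
rewrite /lambda;
  apply: (@nth_eigenvalue_lower _ a b _ _ _ zs _ (- M) ab cq).
- by move=> x /subset_itv_oo_cc xi; rewrite /= clamp_id// /rayleigh h0// h2.
- by rewrite oppr_le0.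
- apply: coercive_mono (hM c cm) => [x _ Zx|x xi]; first exact: Zx.
  by rewrite /= clamp_id// opprK.
- move=> x xi; have xi' := subset_itv_oo_cc xi.
  move: (xi); rewrite in_itv/= => /andP[ax xb].
  move=> [xa|[xa|[Ux bx]]]; [by rewrite xa ltxx in ax|by rewrite xa ltxx in xb|].
  rewrite in_fset_set; last exact: negative_minima_finite.
  by apply: mem_set; split=> //; rewrite -?h0// -h2.
- by [].
Qed.

Lemma lambda_below_nonneg beta : (beta%:E <= (9 / 8)%:E * kappa_plus a b u)%E ->
  exists N, (m_plus a b u beta < N)%N /\ forall c, c < umin a b u ->
    0 <= lambda a b u beta N c.
Proof.
move=> bk; have [U [U1 [U2 [U3 [P h0 h1 h2]]]]] := Sobolev_profile ab hu crit.
have [|zs hzs] := @hardy_cover _ R (fun c => c < umin a b u) (rayleigh U U2 beta) a b ab.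
  move=> x xi; apply: (profile_hardy P xi).
  exact: (kappa_plus_subcritical bk U3 h0 h1 h2 xi).
exists (maxn (size zs) (m_plus a b u beta)).+1; split; first by rewrite ltnS leq_maxr.
move=> c cm; have cq := rayleigh_continuous (beta := beta) P cm.
rewrite /lambda; apply: (@nth_eigenvalue_lower _ a b _ _ [set` zs] zs _ 0 ab cq) => //.
- by move=> x /subset_itv_oo_cc xi; rewrite /= clamp_id// /rayleigh h0// h2.
- apply: coercive_mono (hzs c cm) => [x _ Zx|x xi]; first exact: Zx.
  by rewrite /= clamp_id// subr0.
- by rewrite leq_maxl.
Qed.

Lemma lambda_below_supercritical beta : ((9 / 8)%:E * kappa_plus a b u < beta%:E)%E ->
  forall n, (1 <= n)%N -> forall A : R,
  below (umin a b u) (fun c => lambda a b u beta n c <= A).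
Proof.
move=> bk [//|n] _ A; apply: lambda_le => U U1 U2 U3 P h0 h1 h2.
have [x [xi Ux U1x bx]] : exists x, [/\ x \in `[a, b], U x = umin a b u, U1 x = 0 &
    9 / 8 * U2 x < beta].
  apply: contrapT => /forallNP nx; move: bk; rewrite ltNge => /negP; apply.
  have -> : beta%:E = ((9 / 8)%:E * (8 / 9 * beta)%:E)%E.
    by rewrite -EFinM; congr EFin; field.
  rewrite lee_pmul2l//.
  apply: le_ereal_inf_tmp => _ [y [yi Dy uy] <-]; rewrite lee_fin -h2//.
  rewrite leNgt; apply/negP => yb; apply: (nx y); split=> //; first by rewrite h0.
    by rewrite h1.
  by lra.
exact: profile_supercritical_osc P xi Ux U1x bx.
Qed.

End Plus.

Lemma below_left (m : R) (f : R -> R) :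
  (forall A, below m (fun c => f c <= A)) -> f c @[c --> m^'-] --> -oo%R.
Proof.
move=> h; apply/cvgrNyPle => A; have [e e0 he] := h A.
exists e => //= c; rewrite /ball_/= ltr_norml => /andP[c1 c2] cm.
by apply: he => //; lra.
Qed.

Lemma below_right (m : R) (f : R -> R) :
  (forall A, below (- m) (fun c => f (- c) <= A)) -> f c @[c --> m^'+] --> -oo%R.
Proof.
move=> h; apply/cvgrNyPle => A; have [e e0 he] := h A.
exists e => //= c; rewrite /ball_/= ltr_norml => /andP[c1 c2] cm.
by rewrite -(opprK c); apply: he; lra.
Qed.

Lemma Sobolev_opp a b k f : a <= b -> Sobolev a b k f -> Sobolev a b k (fun x => - f x).
Proof.
move=> ab; elim: k f => [f [mf f2]|k IH f [g [Sg fE]]].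
  split; first exact: measurableT_comp.
  by move: f2; congr (_ < _)%E; apply: eq_integral => x _; rewrite sqrrN.
exists (fun x => - g x); split; first exact: IH.
move=> x xi; rewrite (fE x xi) opprD; congr (_ + _).
have [L2g _] := Sobolev_holder ab Sg.
have ig : mu.-integrable `[a, x] (EFin \o g).
  apply: integrableS (L2_integrable L2g) => //.
  by move: xi; rewrite in_itv/= => /andP[_ xb]; exact: subset_itvScc.
rewrite -mulN1r -RintegralZl//; apply: eq_Rintegral => t _.
by rewrite mulN1r.
Qed.

Lemma dirichlet_ext a b q q' : {in `]a, b[, q =1 q'} ->
  dirichlet_eigenvalue a b q = dirichlet_eigenvalue a b q'.
Proof.
move=> qq; apply/funext => m; apply/propext; split=> -[phi [h1 h2 h3 h4]];
  exists phi; split=> //; have FF := ae_filter_ringOfSetsType mu;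
  move: h4; apply: filterS => x h xi; have := h xi; first by rewrite qq.
by rewrite -qq.
Qed.

Lemma umin_opp a b u : umin a b (fun x => - u x) = - umax a b u.
Proof.
rewrite /umin /umax /inf; congr (- sup _); apply/seteqP; split=> y /=.
  by move=> [_ [x xi <-] <-]; rewrite opprK; exists x.
by move=> [x xi <-]; exists (- u x); [exists x|rewrite opprK].
Qed.

Section Minus.
Context (a b : R) (u : R -> R) (ab : a < b) (hu : Sobolev a b 4 u)
  (crit : forall y, y \in `[a, b] -> D a b u y = 0 -> D a b (D a b u) y <> 0).
Let v x := - u x.

Lemma D_opp : {in `[a, b], D a b v =1 (fun x => - D a b u x)} /\
  {in `[a, b], D a b (D a b v) =1 (fun x => - D a b (D a b u) x)}.
Proof.
have [U [U1 [U2 [U3 [P h0 h1 h2]]]]] := Sobolev_profile ab hu crit.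
have D1 x : x \in `[a, b] -> D a b v x = - U1 x.
  move=> xi; apply: (D_eq ab xi (drvN (profile_d P x))) => y yi.
  by rewrite h0.
split=> x xi; first by rewrite D1// h1.
by rewrite (D_ext xi D1) (D_eq ab xi (drvN (profile_d1 P x)))// h2.
Qed.

Lemma crit_opp y : y \in `[a, b] -> D a b v y = 0 -> D a b (D a b v) y <> 0.
Proof.
have [h1 h2] := D_opp; move=> yi; rewrite h1// h2// => /eqP.
rewrite oppr_eq0 => /eqP h /eqP; rewrite oppr_eq0 => /eqP; exact: crit.
Qed.

Lemma kappa_plus_opp : kappa_plus a b v = (- kappa_minus a b u)%E.
Proof.
have [h1 h2] := D_opp.
rewrite /kappa_plus /kappa_minus ereal_infEN; congr (- ereal_sup _)%E.
apply/seteqP; split=> z /=.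
  move=> [_ [y [yi Dy vy] <-] <-]; exists y; last by rewrite h2//= opprK.
  split=> //; first by move/eqP: Dy; rewrite h1// oppr_eq0 => /eqP.
  by move: vy; rewrite /v umin_opp => /oppr_inj.
move=> [y [yi Dy uy] <-]; exists (- (D a b (D a b u) y))%:E.
  exists y; last by rewrite h2.
  by split=> //; [rewrite h1// Dy oppr0|rewrite /v umin_opp uy].
by rewrite /= opprK.
Qed.

Lemma m_plus_opp beta : m_plus a b v (- beta) = m_minus a b u beta.
Proof.
have [h1 h2] := D_opp.
rewrite /m_plus /m_minus; congr (#|` fset_set _ |).
apply/seteqP; split=> x [xi ux bx]; have xi' := subset_itv_oo_cc xi; split=> //.
- by move: ux; rewrite /v umin_opp => /oppr_inj.
- by move: bx; rewrite h2// -opprD oppr_lt0.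
- by rewrite /v umin_opp ux.
- by rewrite h2// -opprD oppr_lt0.
Qed.

Lemma lambda_opp beta c n : lambda a b v (- beta) n (- c) = lambda a b u beta n c.
Proof.
have [_ h2] := D_opp; rewrite /lambda /nth_eigenvalue.
rewrite (@dirichlet_ext a b _ (fun y => (D a b (D a b u) y - beta) / (u y - c)))//.
by move=> x /subset_itv_oo_cc xi; rewrite h2// -!opprD invrN mulrNN.
Qed.

End Minus.

End Main.

Theorem theorem2p9 (R : realType) (y1 y2 : R) (u : R -> R)
    (hy : y1 < y2)
    (hu : Sobolev y1 y2 4 u)
    (hcrit : forall y, y \in `[y1, y2] -> D y1 y2 u y = 0 ->
       D y1 y2 (D y1 y2 u) y <> 0) :
  [/\ (* (1) *)
      forall beta : R, 0 < beta ->
        (beta%:E <= (9 / 8)%:E * kappa_plus y1 y2 u)%E ->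
        [/\ forall n : nat, (1 <= n <= m_plus y1 y2 u beta)%N ->
              lambda y1 y2 u beta n c @[c --> (umin y1 y2 u)^'-] --> -oo%R,
            (M_plus y1 y2 u beta < +oo)%E &
            exists N : nat, (m_plus y1 y2 u beta < N)%N /\
              (0 <= inf_lambda_below y1 y2 u beta N)%E],
      (* (2) *)
      forall beta : R, ((9 / 8)%:E * kappa_minus y1 y2 u <= beta%:E)%E ->
        beta < 0 ->
        [/\ forall n : nat, (1 <= n <= m_minus y1 y2 u beta)%N ->
              lambda y1 y2 u beta n c @[c --> (umax y1 y2 u)^'+] --> -oo%R,
            (M_minus y1 y2 u beta < +oo)%E &
            exists N : nat, (m_minus y1 y2 u beta < N)%N /\
              (0 <= inf_lambda_above y1 y2 u beta N)%E],
      (* (3) *)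
      forall beta : R, ((9 / 8)%:E * kappa_plus y1 y2 u < beta%:E)%E ->
        forall n : nat, (1 <= n)%N ->
          lambda y1 y2 u beta n c @[c --> (umin y1 y2 u)^'-] --> -oo%R &
      (* (4) *)
      forall beta : R, (beta%:E < (9 / 8)%:E * kappa_minus y1 y2 u)%E ->
        forall n : nat, (1 <= n)%N ->
          lambda y1 y2 u beta n c @[c --> (umax y1 y2 u)^'+] --> -oo%R].
Proof.
have infM (I : interval R) (f : R -> R) (M : R) : (forall c, c \in I -> M <= f c) ->
    (M%:E <= ereal_inf [set (f c)%:E | c in [set` I]])%E.
  by move=> h; apply: le_ereal_inf_tmp => _ [c /= ci <-]; rewrite lee_fin h.
have hv := Sobolev_opp (ltW hy) hu; have cv := crit_opp hy hu hcrit.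
have uv := umin_opp y1 y2 u.
have above beta n (Q : R -> Prop) : (forall c, c < umin y1 y2 (fun x => - u x) ->
    Q (lambda y1 y2 (fun x => - u x) (- beta) n c)) ->
    forall c, c \in `]umax y1 y2 u, +oo[ -> Q (lambda y1 y2 u beta n c).
  move=> h c; rewrite in_itv/= andbT => uc.
  by rewrite -(lambda_opp hy hu hcrit); apply: h; rewrite uv ltrN2.
have right beta n : (forall A : R, below (umin y1 y2 (fun x => - u x)) (fun c =>
    lambda y1 y2 (fun x => - u x) (- beta) n c <= A)) ->
    lambda y1 y2 u beta n c @[c --> (umax y1 y2 u)^'+] --> -oo%R.
  move=> h; apply: below_right => A; rewrite -uv.
  apply: belowS (h A) => c _; rewrite -(lambda_opp hy hu hcrit).
  by rewrite opprK.
have kv (beta : R) : (((9 / 8)%:E * kappa_minus y1 y2 u <= beta%:E)%E ->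
    ((- beta)%:E <= (9 / 8)%:E * kappa_plus y1 y2 (fun x => - u x)%R)%E) /\
    ((beta%:E < (9 / 8)%:E * kappa_minus y1 y2 u)%E ->
    ((9 / 8)%:E * kappa_plus y1 y2 (fun x => - u x)%R < (- beta)%:E)%E).
  by rewrite (kappa_plus_opp hy hu hcrit) muleN EFinN leeN2 lteN2; split.
split.
- move=> beta b0 bk; split.
  + by move=> n nm; apply: below_left; exact: lambda_below_diverges.
  + have [M hM] := lambda_below_bounded hy hu hcrit bk.
    have : (M%:E <= inf_lambda_below y1 y2 u beta (m_plus y1 y2 u beta).+1)%E.
      by apply: infM => c; rewrite in_itv/=; exact: hM.
    by rewrite -leeN2 /M_plus => /le_lt_trans; apply; rewrite -EFinN ltry.
  + have [N [mN hN]] := lambda_below_nonneg hy hu hcrit bk.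
    by exists N; split=> //; apply: infM => c; rewrite in_itv/=; exact: hN.
- move=> beta bk b0; have {}bk := (kv beta).1 bk; split.
  + move=> n nm; apply: right => A; apply: (lambda_below_diverges hy hv cv).
    by rewrite (m_plus_opp hy hu hcrit).
  + have [M] := lambda_below_bounded hy hv cv bk; rewrite (m_plus_opp hy hu hcrit) => hM.
    have : (M%:E <= inf_lambda_above y1 y2 u beta (m_minus y1 y2 u beta).+1)%E.
      by apply: infM; exact: (@above _ _ (fun l => M <= l)).
    by rewrite -leeN2 /M_minus => /le_lt_trans; apply; rewrite -EFinN ltry.
  + have [N []] := lambda_below_nonneg hy hv cv bk; rewrite (m_plus_opp hy hu hcrit) => mN hN.
    exists N; split=> //; apply: infM.
    exact: (@above _ _ (fun l => 0 <= l)).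
- move=> beta bk n n1; apply: below_left.
  exact: lambda_below_supercritical bk n n1.
- move=> beta bk n n1; apply: right.
  exact: (lambda_below_supercritical hy hv cv ((kv beta).2 bk) n1).
Qed.
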